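(* Let $K$ be either the field $\mathbb{C}((t))$ or a monster model $\mathbb{M}$ of its complete theory, and let $n\ge 1$. A definable set $X\subseteq K^n$ is definably compact if and only if it is closed and bounded in $K^n$.
   Context: $\mathbb{C}((t))$ is the field of formal Laurent series over $\mathbb{C}$, viewed as a first-order structure in the language of rings (its valuation ring $\mathbb{C}[[t]]$ is definable in this language, so this is the same as working in the language of valued rings). A monster model $\mathbb{M}$ is a sufficiently saturated and strongly homogeneous elementary extension of $\mathbb{C}((t))$. ''Definable'' means definable with parameters in the structure $K$. Let $v$ be the valuation on $K$ given by the definable valuation ring, with value group $\Gamma_K$ (equal to $\mathbb{Z}$ when $K=\mathbb{C}((t))$). $K$ carries the valuation topology, $K^n$ the product topology, and subsets of $K^n$ the subspace topology. A subset $X\subseteq K^n$ is bounded if there is $\gamma\in\Gamma_K$ with $v(x_i)\ge\gamma$ for all $(x_1,\dots,x_n)\in X$ and all $i$. Definable compactness: a definable set $X$ with a definable topology is definably compact if for every definable family $\mathcal{F}=\{Y_s : s\in S\}$ (uniformly definable, indexed by a non-empty definable set $S$) of non-empty closed subsets of $X$ that is downwards directed (for all $Y,Y'\in\mathcal{F}$ there is $Y''\in\mathcal{F}$ with $Y''\subseteq Y\cap Y'$), the intersection $\bigcap\mathcal{F}$ is non-empty. *)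

(* Defs.v *)
From HB Require Import structures.
From mathcomp Require Import all_boot all_order all_algebra.
From mathcomp Require Import complex.
From mathcomp Require Import all_classical all_reals all_analysis.
From mathcomp Require Import zify.

Set Implicit Arguments.
Unset Strict Implicit.
Unset Printing Implicit Defensive.

Import Order.TTheory GRing.Theory Num.Theory.

Local Open Scope classical_set_scope.
Local Open Scope card_scope.
Local Open Scope ring_scope.

Section Laurent.
Variable F : fieldType.

Definition bounded_below (a : int -> F) (N : int) := forall k, k < N -> a k = 0.

(* The series \sum_k a_k t^k, given by its coefficients a_k. *)
Record laurent := Laurent {
  lcoef :> int -> F;
  lcoef_bounded : exists N, bounded_below lcoef N }.

HB.instance Definition _ := gen_eqMixin laurent.
HB.instance Definition _ := gen_choiceMixin laurent.

Implicit Types (a b c : laurent) (N M P k : int) (n j : nat).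

Lemma laurentP a b : (forall k, a k = b k) -> a = b.
Proof.
case: a b => [a ha] [b hb] /= /funext ab.
by move: ha hb; rewrite ab => ha hb; congr Laurent; exact: Prop_irrelevance.
Qed.

Lemma bounded_belowW a N M : M <= N -> bounded_below a N -> bounded_below a M.
Proof. by move=> MN aN k kM; apply: aN; exact: lt_le_trans MN. Qed.

Lemma bounded_below2 a b : exists N, bounded_below a N /\ bounded_below b N.
Proof.
have [N aN] := lcoef_bounded a; have [M bM] := lcoef_bounded b.
exists (Num.min N M); split.
- by apply: bounded_belowW aN; rewrite ge_min lexx.
- by apply: bounded_belowW bM; rewrite ge_min lexx orbT.
Qed.

Definition laurent0 := @Laurent (fun=> 0) (ex_intro _ 0 (fun _ _ => erefl)).

Fact laurent1_bounded : exists N, bounded_below (fun k => (k == 0)%:R) N.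
Proof. by exists 0 => k k0; rewrite lt_eqF. Qed.
Definition laurent1 := Laurent laurent1_bounded.

Fact laurent_opp_bounded a : exists N, bounded_below (fun k => - a k) N.
Proof.
by have [N aN] := lcoef_bounded a; exists N => k kN; rewrite aN // oppr0.
Qed.
Definition laurent_opp a := Laurent (laurent_opp_bounded a).

Fact laurent_add_bounded a b : exists N, bounded_below (fun k => a k + b k) N.
Proof.
have [N [aN bN]] := bounded_below2 a b.
by exists N => k kN; rewrite aN // bN // addr0.
Qed.
Definition laurent_add a b := Laurent (laurent_add_bounded a b).

(* The sum is over all of int, but only finitely many terms are nonzero. *)
Definition laurent_conv (a b : int -> F) (k : int) : F :=
  \sum_(i \in [set: int]) a i * b (k - i).

Lemma laurent_conv0 a b N M :
  bounded_below a N -> bounded_below b M ->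
  bounded_below (laurent_conv a b) (N + M).
Proof.
move=> aN bM k kNM; rewrite /laurent_conv fsbig1// => i _.
have [iN|Ni] := ltP i N; first by rewrite aN // mul0r.
by rewrite bM ?mulr0 //; lia.
Qed.

Definition laurent_trunc N n (a : int -> F) := \poly_(i < n) a (N + i%:Z).

Lemma laurent_convE a b N M n j : (j < n)%N ->
  bounded_below a N -> bounded_below b M ->
  laurent_conv a b (N + M + j%:Z) =
  (laurent_trunc N n a * laurent_trunc M n b)`_j.
Proof.
move=> jn aN bM; rewrite coefM /laurent_conv.
rewrite (@fsbigE _ _ _ _ _ [seq N + i%:Z | i <- iota 0 j.+1]) //; first last.
- move=> i _ iN; have [lt_iN|Ni] := ltP i N; first by rewrite aN // mul0r.
  have [lt_ji|ij] := ltP (N + j%:Z) i; first by rewrite bM ?mulr0 //; lia.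
  case/mapP: iN; exists `|i - N|%N; last by lia.
  by rewrite mem_iota; lia.
- by rewrite map_inj_uniq ?iota_uniq // => x y; lia.
rewrite (eq_bigl xpredT); last by move=> i; rewrite in_setT.
rewrite big_map -[iota 0 j.+1]/(index_iota 0 j.+1) big_mkord.
apply: eq_bigr => i _; rewrite !coef_poly.
rewrite (_ : (i < n)%N); last by case: i => /= i; lia.
rewrite (_ : (j - i < n)%N); last by lia.
by congr (_ * b _); case: i => /= i; lia.
Qed.

Fact laurent_mul_bounded a b : exists N, bounded_below (laurent_conv a b) N.
Proof.
have [N aN] := lcoef_bounded a; have [M bM] := lcoef_bounded b.
by exists (N + M); exact: laurent_conv0.
Qed.
Definition laurent_mul a b := Laurent (laurent_mul_bounded a b).

Fact laurent_addA : associative laurent_add.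
Proof. by move=> a b c; apply: laurentP => k /=; rewrite addrA. Qed.
Fact laurent_addC : commutative laurent_add.
Proof. by move=> a b; apply: laurentP => k /=; rewrite addrC. Qed.
Fact laurent_add0 : left_id laurent0 laurent_add.
Proof. by move=> a; apply: laurentP => k /=; rewrite add0r. Qed.
Fact laurent_addN : left_inverse laurent0 laurent_opp laurent_add.
Proof. by move=> a; apply: laurentP => k /=; rewrite addNr. Qed.

HB.instance Definition _ := GRing.isZmodule.Build laurent
  laurent_addA laurent_addC laurent_add0 laurent_addN.

Lemma laurent_ltP N k : k < N \/ exists j, k = N + j%:Z.
Proof.
by have [|Nk] := ltP k N; [left | right; exists `|k - N|%N; lia].
Qed.

Lemma eq_coefM (p p' q q' : {poly F}) j :
  (forall i, (i <= j)%N -> p`_i = p'`_i) ->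
  (forall i, (i <= j)%N -> q`_i = q'`_i) -> (p * q)`_j = (p' * q')`_j.
Proof.
move=> pp' qq'; rewrite !coefM; apply: eq_bigr => -[i /=] ij _.
by rewrite pp' ?qq' //; lia.
Qed.

Fact laurent_mulC : commutative laurent_mul.
Proof.
move=> a b; apply: laurentP => k /=.
have [N aN] := lcoef_bounded a; have [M bM] := lcoef_bounded b.
have [kNM|[j ->]] := laurent_ltP (N + M) k.
  by rewrite (laurent_conv0 aN bM) // (laurent_conv0 bM aN) // addrC.
rewrite (laurent_convE (ltnSn j)) // mulrC (addrC N).
by rewrite (laurent_convE (ltnSn j)).
Qed.

Fact laurent_mulA : associative laurent_mul.
Proof.
move=> a b c; apply: laurentP => k /=.
have [N aN] := lcoef_bounded a; have [M bM] := lcoef_bounded b.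
have [P cP] := lcoef_bounded c.
have bc := laurent_conv0 bM cP; have ab := laurent_conv0 aN bM.
have [kNM|[j ->]] := laurent_ltP (N + (M + P)) k.
  rewrite (@laurent_conv0 a (laurent_mul b c) _ _ aN bc) //.
  by rewrite (@laurent_conv0 (laurent_mul a b) c _ _ ab cP) // -addrA.
rewrite (@laurent_convE a (laurent_mul b c) _ _ _ _ (ltnSn j)) //.
rewrite addrA (@laurent_convE (laurent_mul a b) c _ _ _ _ (ltnSn j)) //.
transitivity ((laurent_trunc N j.+1 a * laurent_trunc M j.+1 b
  * laurent_trunc P j.+1 c)`_j).
  rewrite -mulrA; apply: eq_coefM => // i ij.
  by rewrite coef_poly ltnS ij; exact: laurent_convE.
apply: eq_coefM => // i ij.
by rewrite [RHS]coef_poly ltnS ij -laurent_convE.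
Qed.

Fact laurent_mul1 : left_id laurent1 laurent_mul.
Proof.
move=> a; apply: laurentP => k /=; have [N aN] := lcoef_bounded a.
have l1 : bounded_below laurent1 0 by move=> i i0 /=; rewrite lt_eqF.
have [kN|[j ->]] := laurent_ltP N k.
  by rewrite (@laurent_conv0 laurent1 a _ _ l1 aN) ?add0r // aN.
rewrite -[N]add0r (@laurent_convE laurent1 a _ _ _ _ (ltnSn j)) // add0r.
transitivity ((1 * laurent_trunc N j.+1 a)`_j).
  apply: eq_coefM => // i ij; rewrite coef_poly ltnS ij /= coef1.
  by congr (_%:R); lia.
by rewrite mul1r coef_poly ltnSn.
Qed.

Fact laurent_mulDl : left_distributive laurent_mul laurent_add.
Proof.
move=> a b c; apply: laurentP => k /=.
have [N [aN bN]] := bounded_below2 a b; have [M cM] := lcoef_bounded c.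
have abN : bounded_below (laurent_add a b) N.
  by move=> i iN /=; rewrite aN // bN // addr0.
have [kN|[j ->]] := laurent_ltP (N + M) k.
  rewrite (@laurent_conv0 (laurent_add a b) c _ _ abN cM) //.
  by rewrite (laurent_conv0 aN cM) // (laurent_conv0 bN cM) // addr0.
rewrite (@laurent_convE (laurent_add a b) c _ _ _ _ (ltnSn j)) //.
rewrite !(laurent_convE (ltnSn j)) // -coefD -mulrDl.
apply: eq_coefM => // i ij.
by rewrite coefD !coef_poly ltnS ij.
Qed.

Fact laurent1_neq0 : laurent1 != laurent0.
Proof.
by apply/eqP => /(congr1 (fun a : laurent => a 0)) /= /eqP; rewrite oner_eq0.
Qed.

HB.instance Definition _ := GRing.Zmodule_isComNzRing.Build laurent
  laurent_mulA laurent_mulC laurent_mul1 laurent_mulDl laurent1_neq0.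

Definition laurent_inv a : laurent := xget 0 [set b | b * a = 1].

Fact laurent_inv0 : laurent_inv 0 = 0.
Proof.
rewrite /laurent_inv; case: xgetP => // b _ /=.
by rewrite mulr0 => /esym/eqP; rewrite oner_eq0.
Qed.

Lemma laurent_order a : a != 0 -> exists2 N, bounded_below a N & a N != 0.
Proof.
move=> a0; have [N aN] := lcoef_bounded a.
have ex : exists j, a (N + j%:Z) != 0.
  apply: contrapT => /forallNP h; case/eqP: a0; apply: laurentP => k /=.
  have [/aN //|[j ->]] := laurent_ltP N k.
  by have /negP := h j; rewrite negbK => /eqP.
case: (ex_minnP ex) => m am mmin; exists (N + m%:Z) => // k km.
have [/aN //|[j kj]] := laurent_ltP N k; rewrite kj in km *.
apply/eqP; apply: contraT => /mmin; lia.
Qed.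

Section Inverse.
Variable g : nat -> F.

Fixpoint inv_coefs n : seq F :=
  if n is n'.+1 then
    let s := inv_coefs n' in
    rcons s ((g 0%N)^-1 *
      ((n' == 0%N)%:R - \sum_(i < n') s`_i * g (n' - i)%N))
  else [::].

Lemma size_inv_coefs n : size (inv_coefs n) = n.
Proof. by elim: n => //= n IH; rewrite size_rcons IH. Qed.

Definition inv_coef n := (inv_coefs n.+1)`_n.

Lemma inv_coefsE n i : (i < n)%N -> (inv_coefs n)`_i = inv_coef i.
Proof.
elim: n => // n IH; rewrite ltnS leq_eqVlt => /orP[/eqP -> //|lt_in].
by rewrite /= nth_rcons size_inv_coefs lt_in IH.
Qed.

Lemma inv_coefP n : g 0%N != 0 ->
  \sum_(i < n.+1) inv_coef i * g (n - i)%N = (n == 0%N)%:R.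
Proof.
move=> g0; rewrite big_ord_recr /= subnn.
rewrite {2}/inv_coef /= nth_rcons size_inv_coefs ltnn eqxx.
rewrite mulrC mulrA mulfV // mul1r addrC.
rewrite -[RHS]addr0 -addrA; congr (_ + _); apply/eqP; rewrite addrC subr_eq0.
by apply/eqP; apply: eq_bigr => -[i /= ni] _; rewrite inv_coefsE.
Qed.

End Inverse.

Fact laurent_mulV a : a != 0 -> laurent_inv a * a = 1.
Proof.
move=> /laurent_order [N aN aN0]; rewrite /laurent_inv; case: xgetP => //= nex.
exfalso; pose g j := a (N + j%:Z).
pose h (k : int) : F := if k < - N then 0 else inv_coef g (absz (k + N)).
have hN : bounded_below h (- N) by move=> k kN; rewrite /h kN.
pose b := Laurent (ex_intro _ _ hN : exists N, bounded_below h N).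
apply: (nex b); apply: laurentP => k /=.
have [k0|[j ->]] := laurent_ltP 0 k.
  by rewrite (@laurent_conv0 b a _ _ hN aN) ?addNr // lt_eqF.
rewrite -{1}(addNr N) (@laurent_convE b a _ _ _ _ (ltnSn j)) //.
rewrite coefM add0r -[RHS](@inv_coefP g j) ?/g ?addr0 //.
apply: eq_bigr => -[i /=] ij _; rewrite !coef_poly ij.
rewrite (_ : (j - i < j.+1)%N); last by lia.
congr (_ * _); rewrite /= /h ifF; last by lia.
by congr inv_coef; lia.
Qed.

HB.instance Definition _ := GRing.ComNzRing_isField.Build laurent
  laurent_mulV laurent_inv0.

Definition power_series : set laurent := [set a : laurent | bounded_below a 0].

End Laurent.

(* [GRing.formula K] are formulas with parameters in [K]; those satisfying
   [GRing.rformula] only use the symbols of the language of rings. In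
   [GRing.holds e f] the i-th free variable takes the value [e`_i], which is 0
   when i is out of range. *)

Section ChangeOfConstants.
Variables (K L : fieldType).

Fixpoint term_over (A : set K) (u : GRing.term K) : Prop :=
  match u with
  | GRing.Var _ | GRing.NatConst _ => True
  | GRing.Const x => A x
  | GRing.Add u1 u2 | GRing.Mul u1 u2 => term_over A u1 /\ term_over A u2
  | GRing.Opp u1 | GRing.NatMul u1 _ | GRing.Inv u1 | GRing.Exp u1 _ =>
      term_over A u1
  end.

Fixpoint formula_over (A : set K) (f : GRing.formula K) : Prop :=
  match f with
  | GRing.Bool _ => True
  | GRing.Equal u1 u2 => term_over A u1 /\ term_over A u2
  | GRing.Unit u => term_over A u
  | GRing.And f1 f2 | GRing.Or f1 f2 | GRing.Implies f1 f2 =>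
      formula_over A f1 /\ formula_over A f2
  | GRing.Not f1 | GRing.Exists _ f1 | GRing.Forall _ f1 => formula_over A f1
  end.

Variable h : K -> L.

Fixpoint map_term (u : GRing.term K) : GRing.term L :=
  match u with
  | GRing.Var i => GRing.Var L i
  | GRing.Const x => GRing.Const (h x)
  | GRing.NatConst n => GRing.NatConst L n
  | GRing.Add u1 u2 => GRing.Add (map_term u1) (map_term u2)
  | GRing.Opp u1 => GRing.Opp (map_term u1)
  | GRing.NatMul u1 n => GRing.NatMul (map_term u1) n
  | GRing.Mul u1 u2 => GRing.Mul (map_term u1) (map_term u2)
  | GRing.Inv u1 => GRing.Inv (map_term u1)
  | GRing.Exp u1 n => GRing.Exp (map_term u1) n
  end.

Fixpoint map_formula (f : GRing.formula K) : GRing.formula L :=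
  match f with
  | GRing.Bool b => GRing.Bool b
  | GRing.Equal u1 u2 => GRing.Equal (map_term u1) (map_term u2)
  | GRing.Unit u => GRing.Unit (map_term u)
  | GRing.And f1 f2 => GRing.And (map_formula f1) (map_formula f2)
  | GRing.Or f1 f2 => GRing.Or (map_formula f1) (map_formula f2)
  | GRing.Implies f1 f2 => GRing.Implies (map_formula f1) (map_formula f2)
  | GRing.Not f1 => GRing.Not (map_formula f1)
  | GRing.Exists i f1 => GRing.Exists i (map_formula f1)
  | GRing.Forall i f1 => GRing.Forall i (map_formula f1)
  end.

(* [h], restricted to [A], is a partial elementary map; with [A := setT],
   it is an elementary embedding. *)
Definition elementary_on (A : set K) : Prop :=
  forall f : GRing.formula K, GRing.rformula f -> formula_over A f ->
    (GRing.holds [::] f <-> GRing.holds [::] (map_formula f)).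

End ChangeOfConstants.

Section MonsterModel.
Variable kappa : Type.

Definition small (T : Type) (A : set T) : Prop := ~ ([set: kappa] #<= A).

(* Every finitely satisfiable set of formulas in the variable 0, with
   parameters in a set of cardinality < kappa, is realised. *)
Definition saturated (M : fieldType) : Prop :=
  forall (A : set M) (p : set (GRing.formula M)), small A ->
    (forall f, p f -> GRing.rformula f /\ formula_over A f) ->
    (forall q, q `<=` p -> finite_set q ->
      exists x, forall f, q f -> GRing.holds [:: x] f) ->
    exists x, forall f, p f -> GRing.holds [:: x] f.

Definition strongly_homogeneous (M : fieldType) : Prop :=
  forall (A : set M) (h : M -> M), small A -> elementary_on h A ->
    exists2 s : {rmorphism M -> M}, bijective s & {in A, s =1 h}.

End MonsterModel.

(* How large |kappa| has to be is a matter of convention: allowing any infinite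
   cardinal covers all choices. *)
Definition monster_model (L M : fieldType) (iota : L -> M) : Prop :=
  elementary_on iota setT /\
  exists kappa : Type, [/\ infinite_set [set: kappa],
    saturated kappa M & strongly_homogeneous kappa M].

Variant base_or_monster (L : fieldType) :
    forall K : fieldType, (L -> K) -> Prop :=
  | BaseModel : @base_or_monster L L id
  | MonsterModel (M : fieldType) (iota : L -> M) :
      monster_model iota -> base_or_monster iota.

Section Definable.
Variable K : fieldType.

Definition point_env n (x : 'rV[K]_n) : seq K := [seq x 0 i | i <- enum 'I_n].

Definition definable n (X : set 'rV[K]_n) : Prop :=
  exists2 f : GRing.formula K, GRing.rformula f &
    X = [set x | GRing.holds (point_env x) f].

Definition definable_family m n (S : set 'rV[K]_m)
    (Y : 'rV[K]_m -> set 'rV[K]_n) : Prop :=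
  definable S /\
  definable [set z : 'rV[K]_(m + n) | S (lsubmx z) /\ Y (lsubmx z) (rsubmx z)].

End Definable.

Section Valuation.
Variables (K : fieldType) (O : set K).

Definition val_units : set K := [set u | [/\ u != 0, O u & O u^-1]].

(* The value of x is its class modulo the units of O; the class {0} of 0 plays
   the role of infinity. *)
Definition value (x : K) : set K := [set x * u | u in val_units].

Definition value_group : set (set K) := [set value x | x in [set x | x != 0]].

Definition val_le (gamma delta : set K) : Prop :=
  exists x y, [/\ gamma x, delta y & exists2 z, O z & y = x * z].

Definition val_ball (a : K) (gamma : set K) : set K :=
  [set x | val_le gamma (value (x - a))].

(* [K] equipped with the valuation topology: the balls form a base of it as
   soon as [O] is a valuation ring. *)
Definition vtop of set K : Type := K.

HB.instance Definition _ := Choice.on (vtop O).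
HB.instance Definition _ := @isSubBaseTopological.Build (vtop O) (set K)
  [set val_ball a gamma | a in [set: K] & gamma in value_group] id.

(* 'rV[vtop O]_n carries the product topology. *)
Definition val_closed n (X : set 'rV[K]_n) : Prop :=
  @closed 'rV[vtop O]_n X.

Definition val_closed_in n (X Y : set 'rV[K]_n) : Prop :=
  exists2 Z, val_closed Z & Y = X `&` Z.

Definition val_bounded n (X : set 'rV[K]_n) : Prop :=
  exists2 gamma, value_group gamma &
    forall x, X x -> forall i, val_le gamma (value (x 0 i)).

Definition definably_compact n (X : set 'rV[K]_n) : Prop :=
  forall m (S : set 'rV[K]_m) (Y : 'rV[K]_m -> set 'rV[K]_n),
    S !=set0 -> definable_family S Y ->
    (forall s, S s -> Y s !=set0 /\ val_closed_in X (Y s)) ->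
    (forall s s', S s -> S s' ->
      exists2 s'', S s'' & Y s'' `<=` Y s `&` Y s') ->
    \bigcap_(s in S) Y s !=set0.

End Valuation.

(* The valuation ring of an elementary extension [iota] of F((t)): the set
   defined in [K] by the formulas that define F[[t]] in F((t)). *)
Definition valuation_ring (F K : fieldType) (iota : laurent F -> K) : set K :=
  [set x | exists f : GRing.formula (laurent F),
    [/\ GRing.rformula f,
        forall y : laurent F, GRing.holds [:: y] f <-> power_series y &
        GRing.holds [:: x] (map_formula iota f)]].

(* Main.v *)
Require Import Defs.
From mathcomp Require Import all_boot all_order all_algebra finmap.
From mathcomp Require Import complex closed_field.
From mathcomp Require Import all_classical all_reals all_analysis.
From mathcomp Require Import zify ring.

Set Implicit Arguments.
Unset Strict Implicit.
Unset Printing Implicit Defensive.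

Import Order.TTheory GRing.Theory Num.Theory.

Local Open Scope classical_set_scope.
Local Open Scope ring_scope.

(** The sets in question are subsets of [K^n], where [K] is an elementary
    extension of the field [L] of Laurent series over an algebraically closed
    field [F] of characteristic 0, and [O] is the valuation ring of [K].

    A definably compact [X] is closed and bounded because two families of
    closed subsets of [X], both indexed by the nonzero elements [s] of [K], are
    directed: the points of [X] outside the ball of radius [s] around 0, and
    the points of [X] in the ball of radius [s] around a point [a] of the
    closure of [X]. The first has empty intersection, so [X] is bounded; the
    second can only have [a] in its intersection, so [a] belongs to [X]
    ([definably_compact_bounded], [definably_compact_closed]).

    For the converse, suppose first that [K] is [L]. A common point of a
    directed family of closed sets [Y_s] in a bounded set is constructed digit
    by digit. If every [Y_s] meets [c + t^k O^n], consider the set [Z_s] of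
    those [a] in [F^n] that occur as the next digit of a point of [Y_s] in this
    ball. If some [a] lies in all [Z_s], it is the next digit of the point
    ([next_digit]); the limit exists because [L] is complete and lies in all
    [Y_s] because they are closed ([laurent_compact]). If there were no such
    [a], the sets [Z_s] would contain an infinite strictly decreasing sequence,
    and points [a_i] with [a_i] in [Z_(s_j)] exactly when [j <= i]. This is
    impossible if membership is a stable relation. Stability is used in the
    form that two limits along an ultrafilter commute: this property passes to
    Boolean combinations, linear algebra gives it for polynomial equations, and
    quantifier elimination in [F] for all formulas over [F] ([commute_holds],
    [residue_compact]).

    It remains to see that membership of [a] in [Z_s] is given by formulas over
    [F]. This is a relative quantifier elimination for [L]: every definable set
    is a finite union of boxes, each given by a first-order condition on the
    leading coefficients of finitely many polynomials and an arbitrary condition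
    on their orders ([rvdef_holds]). Only leading coefficients involve [a], so
    the conditions on orders do not disturb stability.

    To eliminate [y] from conditions on the leading term of [f(y)], expand [f]
    at a center [c]. The leading term of [f(y)] can be read off that of [y - c],
    unless the leading coefficient of [y - c] is a root of a certain polynomial
    over [F]. If its multiplicity is [e + 1], Hensel's lemma gives a root [c'] of
    the derivative of order [e] close to [y]. At the center [c'] the
    multiplicity is smaller, because a binomial power has no vanishing
    coefficient in characteristic 0 ([recenter]). So finitely many centers
    determine the leading term of [f(y)] ([stable_tree_center]), and whether
    given leading terms of the [y - c] are compatible is a condition on the
    leading terms of the differences of the centers ([rvdef_meet]). The
    centers are not polynomials in the remaining variables. That they may still
    occur in definable conditions ([good_roots]) is proved together with the
    previous step, by induction on the degree: a polynomial at a root of [f] can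
    be reduced modulo [f], which leaves the leading terms of the differences
    between this root and the centers of a polynomial of smaller degree, and
    these are given by Newton's formula ([newton_rv]).

    For an arbitrary [K], the constants of a formula defining the family are
    turned into variables ([separate_parameters]), and compactness of all the
    families obtained from one formula is expressed by a sentence
    ([udef_family_compact]), which holds in [K] because it holds in [L]. *)


(** * Substitution in formulas *)

Section Substitution.
Variables K L : fieldType.
Implicit Types (s : nat -> GRing.term L) (k : K -> GRing.term L) (N : nat).

Fixpoint term_sub s k (u : GRing.term K) : GRing.term L :=
  match u with
  | GRing.Var i => s i
  | GRing.Const x => k x
  | GRing.NatConst n => GRing.NatConst L n
  | GRing.Add u1 u2 => GRing.Add (term_sub s k u1) (term_sub s k u2)
  | GRing.Opp u1 => GRing.Opp (term_sub s k u1)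
  | GRing.NatMul u1 n => GRing.NatMul (term_sub s k u1) n
  | GRing.Mul u1 u2 => GRing.Mul (term_sub s k u1) (term_sub s k u2)
  | GRing.Inv u1 => GRing.Inv (term_sub s k u1)
  | GRing.Exp u1 n => GRing.Exp (term_sub s k u1) n
  end.

Definition bind_var s i N : nat -> GRing.term L :=
  fun j => if j == i then GRing.Var L N else s j.

(** The substituted terms only use variables below [N], so that binding the
    variable [N] instead of the original one captures nothing. *)
Fixpoint formula_sub s k N (f : GRing.formula K) : GRing.formula L :=
  match f with
  | GRing.Bool b => GRing.Bool b
  | GRing.Equal u1 u2 => GRing.Equal (term_sub s k u1) (term_sub s k u2)
  | GRing.Unit u => GRing.Unit (term_sub s k u)
  | GRing.And f1 f2 => GRing.And (formula_sub s k N f1) (formula_sub s k N f2)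
  | GRing.Or f1 f2 => GRing.Or (formula_sub s k N f1) (formula_sub s k N f2)
  | GRing.Implies f1 f2 =>
      GRing.Implies (formula_sub s k N f1) (formula_sub s k N f2)
  | GRing.Not f1 => GRing.Not (formula_sub s k N f1)
  | GRing.Exists i f1 => GRing.Exists N (formula_sub (bind_var s i N) k N.+1 f1)
  | GRing.Forall i f1 => GRing.Forall N (formula_sub (bind_var s i N) k N.+1 f1)
  end.

Lemma rterm_sub s k u : (forall i, GRing.rterm (s i)) ->
  (forall x, GRing.rterm (k x)) -> GRing.rterm u -> GRing.rterm (term_sub s k u).
Proof. by move=> rs rk; elim: u => //= u1 IH1 u2 IH2 /andP[/IH1-> /IH2->]. Qed.

Lemma rformula_sub s k N f : (forall i, GRing.rterm (s i)) ->
  (forall x, GRing.rterm (k x)) -> GRing.rformula f ->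
  GRing.rformula (formula_sub s k N f).
Proof.
move=> rs rk; elim: f s N rs => //=.
- by move=> u1 u2 s N rs /andP[r1 r2]; rewrite !rterm_sub.
- by move=> f1 IH1 f2 IH2 s N rs /andP[/IH1-> // /IH2->].
- by move=> f1 IH1 f2 IH2 s N rs /andP[/IH1-> // /IH2->].
- by move=> f1 IH1 f2 IH2 s N rs /andP[/IH1-> // /IH2->].
- by move=> i f1 IH1 s N rs; apply: IH1 => j; rewrite /bind_var; case: eqP.
- by move=> i f1 IH1 s N rs; apply: IH1 => j; rewrite /bind_var; case: eqP.
Qed.

End Substitution.

Section SubstitutionSemantics.
Variables (K0 K L : fieldType) (g : K0 -> K) (h : L -> K).

Definition depends_below N (u : GRing.term L) : Prop :=
  forall e e' : seq K, (forall i, (i < N)%N -> e`_i = e'`_i) ->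
    GRing.eval e (map_term h u) = GRing.eval e' (map_term h u).

Lemma depends_belowW N M u : (N <= M)%N -> depends_below N u -> depends_below M u.
Proof. by move=> NM uN e e' ee'; apply: uN => i iN; apply: ee'; lia. Qed.

Lemma eval_set_nth N u e x : depends_below N u ->
  GRing.eval (set_nth 0 e N x) (map_term h u) = GRing.eval e (map_term h u).
Proof. by move=> uN; apply: uN => i iN; rewrite nth_set_nth /= ltn_eqF. Qed.

Lemma eval_term_sub (e e' : seq K) s k (A : set K0) u :
  (forall i, e`_i = GRing.eval e' (map_term h (s i))) ->
  (forall x, A x -> g x = GRing.eval e' (map_term h (k x))) ->
  term_over A u ->
  GRing.eval e (map_term g u) = GRing.eval e' (map_term h (term_sub s k u)).
Proof.
move=> es ek; elim: u => //=.
- by move=> u1 IH1 u2 IH2 [/IH1-> /IH2->].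
- by move=> u1 IH1 /IH1->.
- by move=> u1 IH1 n /IH1->.
- by move=> u1 IH1 u2 IH2 [/IH1-> /IH2->].
- by move=> u1 IH1 /IH1->.
- by move=> u1 IH1 n /IH1->.
Qed.

Lemma holds_formula_sub (e e' : seq K) s k N (A : set K0) f :
  (forall i, depends_below N (s i)) -> (forall x, depends_below N (k x)) ->
  (forall i, e`_i = GRing.eval e' (map_term h (s i))) ->
  (forall x, A x -> g x = GRing.eval e' (map_term h (k x))) ->
  formula_over A f ->
  GRing.holds e (map_formula g f) <->
  GRing.holds e' (map_formula h (formula_sub s k N f)).
Proof.
have step s1 N1 i (e1 e1' : seq K) x :
    (forall j, depends_below N1 (s1 j)) ->
    (forall j, e1`_j = GRing.eval e1' (map_term h (s1 j))) ->
    forall j, (set_nth 0 e1 i x)`_j =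
      GRing.eval (set_nth 0 e1' N1 x) (map_term h (bind_var s1 i N1 j)).
  move=> s1N es1 j; rewrite nth_set_nth /= /bind_var; case: eqP => _ /=.
    by rewrite nth_set_nth /= eqxx.
  by rewrite eval_set_nth.
have stepN s1 N1 i : (forall j, depends_below N1 (s1 j)) ->
    forall j, depends_below N1.+1 (bind_var s1 i N1 j).
  move=> s1N j; rewrite /bind_var; case: eqP => _.
    by move=> e1 e2 ee /=; apply: ee.
  by apply: depends_belowW (s1N j).
elim: f s N e e' => //=.
- by move=> u1 u2 s N e e' _ _ es ek [q1 q2]; rewrite -!(eval_term_sub es ek).
- by move=> u1 s N e e' _ _ es ek q1; rewrite -!(eval_term_sub es ek).
- move=> f1 IH1 f2 IH2 s N e e' sN kN es ek [q1 q2].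
  by have := IH1 s N e e' sN kN es ek q1; have := IH2 s N e e' sN kN es ek q2; tauto.
- move=> f1 IH1 f2 IH2 s N e e' sN kN es ek [q1 q2].
  by have := IH1 s N e e' sN kN es ek q1; have := IH2 s N e e' sN kN es ek q2; tauto.
- move=> f1 IH1 f2 IH2 s N e e' sN kN es ek [q1 q2].
  by have := IH1 s N e e' sN kN es ek q1; have := IH2 s N e e' sN kN es ek q2; tauto.
- move=> f1 IH1 s N e e' sN kN es ek q1.
  by have := IH1 s N e e' sN kN es ek q1; tauto.
- move=> i f1 IH1 s N e e' sN kN es ek q1.
  have IH x := IH1 (bind_var s i N) N.+1 (set_nth 0 e i x) (set_nth 0 e' N x)
    (stepN _ _ _ sN) (fun c => depends_belowW (leqnSn N) (kN c))
    (step _ _ _ _ _ _ sN es).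
  have ek' x c : A c ->
      g c = GRing.eval (set_nth 0 e' N x) (map_term h (k c)).
    by move=> Ac; rewrite eval_set_nth // -ek.
  by split=> -[x hx]; exists x; apply/IH => //; exact: ek'.
- move=> i f1 IH1 s N e e' sN kN es ek q1.
  have IH x := IH1 (bind_var s i N) N.+1 (set_nth 0 e i x) (set_nth 0 e' N x)
    (stepN _ _ _ sN) (fun c => depends_belowW (leqnSn N) (kN c))
    (step _ _ _ _ _ _ sN es).
  have ek' x c : A c ->
      g c = GRing.eval (set_nth 0 e' N x) (map_term h (k c)).
    by move=> Ac; rewrite eval_set_nth // -ek.
  by split=> hx x; apply/IH => //; exact: ek'.
Qed.

End SubstitutionSemantics.

Lemma formula_overT (K : fieldType) (f : GRing.formula K) : formula_over setT f.
Proof.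
have oT (u : GRing.term K) : term_over setT u by elim: u => /=; tauto.
by elim: f => //= ; tauto.
Qed.

Lemma rformula_rename (L : fieldType) (f : GRing.formula L) N M (p : nat -> nat) :
  GRing.rformula f -> (forall i, (i < N)%N -> (p i < M)%N) ->
  exists2 f' : GRing.formula L, GRing.rformula f' &
    forall (K : fieldType) (h : L -> K) (e e' : seq K), (size e <= N)%N ->
      (forall i, (i < N)%N -> e`_i = e'`_(p i)) ->
      GRing.holds e (map_formula h f) <-> GRing.holds e' (map_formula h f').
Proof.
move=> rf pM.
pose s i := if (i < N)%N then GRing.Var L (p i) else GRing.NatConst L 0.
exists (formula_sub s (@GRing.Const L) M f).
  by apply: rformula_sub => // i; rewrite /s; case: ifP.
move=> K h e e' eN ee'.
apply: (@holds_formula_sub L K L h h e e' s _ M setT) => //.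
- move=> i; rewrite /s; case: ifP => // iN e1 e2 ee /=; exact: (ee _ (pM _ iN)).
- move=> i; rewrite /s; case: ltnP => iN /=; first exact: ee'.
  by rewrite nth_default // (leq_trans eN).
- exact: formula_overT.
Qed.

Lemma map_term_id (K : fieldType) (u : GRing.term K) : map_term id u = u.
Proof. by elim: u => //= [u1 -> u2 ->|u1 ->|u1 -> n|u1 -> u2 ->|u1 ->|u1 -> n]. Qed.

Lemma map_formula_id (K : fieldType) (f : GRing.formula K) : map_formula id f = f.
Proof.
elim: f => //=.
- by move=> u1 u2; rewrite !map_term_id.
- by move=> u1; rewrite !map_term_id.
- by move=> f1 -> f2 ->.
- by move=> f1 -> f2 ->.
- by move=> f1 -> f2 ->.
- by move=> f1 ->.
- by move=> i f1 ->.
- by move=> i f1 ->.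
Qed.

(** * Orders and leading terms of Laurent series *)

Section LaurentOrder.
Variable F : fieldType.
Local Notation K := (laurent F).
Implicit Types (x y z c : K) (k m n : int) (a b : F) (p q : {poly K}).

Definition ord_ge x n : Prop := bounded_below x n.

Lemma coefD_laurent x y k : (x + y) k = x k + y k. Proof. by []. Qed.
Lemma coefN_laurent x k : (- x) k = - x k. Proof. by []. Qed.
Lemma coefB_laurent x y k : (x - y) k = x k - y k. Proof. by []. Qed.
Lemma coef1_laurent k : (1 : K) k = (k == 0)%:R. Proof. by []. Qed.

Lemma ord_geW x m n : n <= m -> ord_ge x m -> ord_ge x n.
Proof. exact: bounded_belowW. Qed.

Lemma ord_geD x y n : ord_ge x n -> ord_ge y n -> ord_ge (x + y) n.
Proof. by move=> xn yn k kn; rewrite coefD_laurent xn // yn // addr0. Qed.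

Lemma ord_geN x n : ord_ge x n -> ord_ge (- x) n.
Proof. by move=> xn k kn; rewrite coefN_laurent xn // oppr0. Qed.

Lemma ord_geB x y n : ord_ge x n -> ord_ge y n -> ord_ge (x - y) n.
Proof. by move=> xn yn; apply: ord_geD => //; apply: ord_geN. Qed.

Lemma ord_geM x y m n : ord_ge x m -> ord_ge y n -> ord_ge (x * y) (m + n).
Proof. exact: laurent_conv0. Qed.

Lemma ord_coefM x y m n : ord_ge x m -> ord_ge y n ->
  (x * y) (m + n) = x m * y n.
Proof.
move=> xm yn.
have := laurent_convE (ltnSn 0) xm yn; rewrite addr0 => h.
by rewrite [LHS]h coefM big_ord1 !coef_poly /= !addr0.
Qed.

Lemma ord_ge_sum (I : Type) (r : seq I) (P : pred I) (f : I -> K) n :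
  (forall i, P i -> ord_ge (f i) n) -> ord_ge (\sum_(i <- r | P i) f i) n.
Proof. by move=> fn; elim/big_ind: _ => [//|x y|//]; exact: ord_geD. Qed.

Lemma coef_sum_laurent (I : Type) (r : seq I) (P : pred I) (f : I -> K) k :
  (\sum_(i <- r | P i) f i) k = \sum_(i <- r | P i) f i k.
Proof. by elim/big_rec2: _ => // i x y _ <-. Qed.

Lemma ord_ge1 : ord_ge 1 0.
Proof. by move=> k k0; rewrite coef1_laurent lt_eqF. Qed.

Lemma ord_geX x n (j : nat) : ord_ge x n -> ord_ge (x ^+ j) (n * j%:Z).
Proof.
move=> xn; elim: j => [|j IH]; first by rewrite mulr0; exact: ord_ge1.
by rewrite exprS (_ : n * j.+1%:Z = n + n * j%:Z); [exact: ord_geM | lia].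
Qed.

Lemma ord_coefX x n (j : nat) : ord_ge x n -> (x ^+ j) (n * j%:Z) = x n ^+ j.
Proof.
move=> xn; elim: j => [|j IH]; first by rewrite mulr0 coef1_laurent.
rewrite !exprS (_ : n * j.+1%:Z = n + n * j%:Z); last by lia.
by rewrite ord_coefM ?IH //; exact: ord_geX.
Qed.

Lemma ord_geMn x n (j : nat) : ord_ge x n -> ord_ge (x *+ j) n.
Proof. by move=> xn; elim: j => // j IH; rewrite mulrS; exact: ord_geD. Qed.

Lemma coefMn_laurent x k (j : nat) : (x *+ j) k = x k *+ j.
Proof. by elim: j => // j IH; rewrite !mulrS coefD_laurent IH. Qed.

Lemma ord_geS x n : ord_ge x n -> x n = 0 -> ord_ge x (n + 1).
Proof.
move=> xn x0 k kn; have [kn'|kn'] := ltP k n; first exact: xn.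
by rewrite (_ : k = n) //; lia.
Qed.

Lemma ord_ge_all0 x n : (forall j : nat, ord_ge x (n + j%:Z)) -> x = 0.
Proof.
by move=> xj; apply: laurentP => k; apply: (xj `|k - n|.+1); lia.
Qed.

Fact monomial_bounded a k : exists N, bounded_below (fun i => if i == k then a else 0) N.
Proof. by exists k => i ik; rewrite lt_eqF. Qed.
Definition monomial a k : K := Laurent (monomial_bounded a k).

Lemma coef_monomial a k i : monomial a k i = if i == k then a else 0.
Proof. by []. Qed.

Lemma ord_ge_monomial a k : ord_ge (monomial a k) k.
Proof. by move=> i ik; rewrite coef_monomial lt_eqF. Qed.

Lemma monomial_coef a k : monomial a k k = a.
Proof. by rewrite coef_monomial eqxx. Qed.

(** The coefficient of order [k] of [u j] does not depend on [j] once
    [n + j > k]: these stable coefficients form the limit. *)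
Lemma laurent_complete (u : nat -> K) n :
  (forall j, ord_ge (u j.+1 - u j) (n + j%:Z)) ->
  exists x, forall j, ord_ge (x - u j) (n + j%:Z).
Proof.
move=> uS.
have uD i j : (i <= j)%N -> ord_ge (u j - u i) (n + i%:Z).
  elim: j => [|j IH]; first by rewrite leqn0 => /eqP->; rewrite subrr.
  rewrite leq_eqVlt => /predU1P[<-|]; first by rewrite subrr.
  rewrite ltnS => ij; rewrite -(subrKA (u j)).
  by apply: ord_geD; [apply: ord_geW (uS j); lia | exact: IH].
have [m um] := lcoef_bounded (u 0%N).
pose f k := u `|k - n|.+1 k.
have fb : bounded_below f (Order.min m n).
  move=> k; rewrite lt_min => /andP[km kn].
  have h : ord_ge (u `|k - n|.+1 - u 0%N) (n + 0%:Z) by exact: uD.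
  have kn0 : k < n + 0%:Z by rewrite addr0.
  by have := h k kn0; rewrite coefB_laurent um // subr0.
exists (Laurent (ex_intro _ _ fb)) => j k kn; rewrite coefB_laurent /= /f.
have [kj|jk] := leqP `|k - n|.+1 j.
  apply/eqP; rewrite -opprB oppr_eq0 -coefB_laurent; apply/eqP.
  by apply: uD kj _ _; lia.
by rewrite -coefB_laurent; apply: uD (ltnW jk) _ _.
Qed.

Definition lorder x : int :=
  if pselect (x != 0) is left h then sval (cid2 (laurent_order h)) else 0.

Lemma lorderP x : x != 0 -> ord_ge x (lorder x) /\ x (lorder x) != 0.
Proof.
by rewrite /lorder; case: pselect => // h _; case: cid2.
Qed.

Lemma lorderE x n : ord_ge x n -> x n != 0 -> lorder x = n.
Proof.
move=> xn xn0; have x0 : x != 0 by apply: contraNneq xn0 => ->.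
have [h1 h2] := lorderP x0.
have [lt|lt|//] := ltgtP (lorder x) n.
  by rewrite xn ?eqxx in h2.
by rewrite h1 ?eqxx in xn0.
Qed.

Definition lead x : F := x (lorder x).

Lemma lorder0 : lorder 0 = 0.
Proof. by rewrite /lorder; case: pselect => // h; have := h; rewrite eqxx. Qed.

Lemma lead0 : lead 0 = 0. Proof. by []. Qed.

Lemma lead_eq0 x : (lead x == 0) = (x == 0).
Proof.
apply/idP/idP => [|/eqP->]; last by rewrite lead0.
by apply: contraTT => /lorderP[].
Qed.

(** Leading terms: a leading coefficient and an order, with [(0, 0)] for the
    series 0. *)
Definition RV : Type := (F * int)%type.

Definition rv x : RV := (lead x, lorder x).

Lemma rv0 : rv 0 = (0, 0). Proof. by rewrite /rv lorder0. Qed.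

Lemma rvE x n a : ord_ge x n -> x n = a -> a != 0 -> rv x = (a, n).
Proof. by move=> xn <- a0; rewrite /rv /lead (lorderE xn). Qed.

Lemma rv_ord x a n : rv x = (a, n) -> a != 0 -> ord_ge x n /\ x n = a.
Proof.
move=> [<- <-]; rewrite lead_eq0 => /lorderP[h _]; by split.
Qed.

Lemma rv_eq0 x : (rv x).1 = 0 -> x = 0.
Proof. by move=> /eqP; rewrite lead_eq0 => /eqP. Qed.

Lemma rv_neq0 x : (rv x).1 != 0 -> x != 0.
Proof. by rewrite lead_eq0. Qed.

Lemma ord_geP x n : ord_ge x n <-> (x = 0 \/ n <= lorder x).
Proof.
split=> [xn|[->//|nx]].
  case: (eqVneq x 0) => [->|x0]; [by left | right].
  have [_ h] := lorderP x0; rewrite leNgt; apply: contraNN h => lt.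
  by rewrite xn.
have [->//|x0] := eqVneq x 0.
by apply: ord_geW nx _; have [] := lorderP x0.
Qed.

Lemma rv_monomial a k : a != 0 -> rv (monomial a k) = (a, k).
Proof. by move=> a0; apply: rvE => //; [exact: ord_ge_monomial | exact: monomial_coef]. Qed.

Lemma lorderM x y : x != 0 -> y != 0 -> lorder (x * y) = lorder x + lorder y.
Proof.
move=> /lorderP[xn x0] /lorderP[yn y0]; apply: lorderE; first exact: ord_geM.
by rewrite ord_coefM // mulf_neq0.
Qed.

Lemma leadM x y : lead (x * y) = lead x * lead y.
Proof.
have [->|x0] := eqVneq x 0; first by rewrite mul0r lead0 mul0r.
have [->|y0] := eqVneq y 0; first by rewrite mulr0 lead0 mulr0.
have [xn _] := lorderP x0; have [yn _] := lorderP y0.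
by rewrite /lead lorderM // ord_coefM.
Qed.

Definition rv_mul (r s : RV) : RV :=
  if (r.1 == 0) || (s.1 == 0) then (0, 0) else (r.1 * s.1, r.2 + s.2).

Lemma rvM x y : rv (x * y) = rv_mul (rv x) (rv y).
Proof.
rewrite /rv_mul /= !lead_eq0.
have [->|x0] := eqVneq x 0; first by rewrite mul0r rv0.
have [->|y0] := eqVneq y 0; first by rewrite mulr0 rv0.
by rewrite /rv leadM lorderM.
Qed.

Definition rv_div (r s : RV) : RV :=
  if (r.1 == 0) || (s.1 == 0) then (0, 0) else (r.1 / s.1, r.2 - s.2).

Lemma rv_mulK (r s : RV) : (r.1 == 0 -> r = (0, 0)) -> s.1 != 0 ->
  rv_div (rv_mul s r) s = r.
Proof.
move=> r0 s0; rewrite /rv_div /rv_mul (negPf s0) /=.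
have [r10|r10] := eqVneq r.1 0; first by rewrite eqxx (r0 _) ?r10.
rewrite /= mulf_eq0 (negPf s0) (negPf r10) /= mulrAC divff // mul1r.
by rewrite addrAC subrr add0r -surjective_pairing.
Qed.

Lemma rv_divM x y : y != 0 -> rv_div (rv (y * x)) (rv y) = rv x.
Proof.
move=> y0; rewrite rvM rv_mulK //=; last by rewrite lead_eq0.
by rewrite lead_eq0 => /eqP ->; rewrite rv0.
Qed.

Definition rv_opp (r : RV) : RV := (- r.1, r.2).

Lemma rvN x : rv (- x) = rv_opp (rv x).
Proof.
have [->|x0] := eqVneq x 0; first by rewrite oppr0 rv0 /rv_opp /= oppr0.
have [xn h] := lorderP x0.
rewrite /rv_opp /=; apply: rvE; [exact: ord_geN | by [] |].
by rewrite oppr_eq0 lead_eq0.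
Qed.

(** The leading term of [x + y] is determined by those of [x] and [y] except
    when they cancel. *)
Definition rv_cancel (r s : RV) : Prop := [/\ r.1 != 0, r.2 = s.2 & r.1 + s.1 = 0].

Definition rv_add (r s : RV) : RV :=
  if r.1 == 0 then s else if s.1 == 0 then r else
  if r.2 < s.2 then r else if s.2 < r.2 then s else (r.1 + s.1, r.2).

Lemma rvD x y : ~ rv_cancel (rv x) (rv y) -> rv (x + y) = rv_add (rv x) (rv y).
Proof.
rewrite /rv_add /= !lead_eq0.
have [->|x0] := eqVneq x 0; first by rewrite add0r.
have [->|y0] := eqVneq y 0; first by rewrite addr0.
have [xn xl] := lorderP x0; have [yn yl] := lorderP y0.
case: ltgtP => [lt|lt|eq] nc.
- apply: rvE; last by rewrite lead_eq0.
  + by apply: ord_geD => //; apply: ord_geW (ltW lt) yn.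
  + by rewrite coefD_laurent yn // addr0.
- apply: rvE; last by rewrite lead_eq0.
  + by apply: ord_geD => //; apply: ord_geW (ltW lt) xn.
  + by rewrite coefD_laurent xn // add0r.
- apply: rvE.
  + by apply: ord_geD => //; rewrite eq.
  + by rewrite coefD_laurent /lead eq.
  + by apply/eqP => h; apply: nc; split => //; rewrite lead_eq0.
Qed.

Lemma rv_cancelP x y : rv_cancel (rv x) (rv y) -> rv y = rv (- x).
Proof.
case=> h1 h2 h3; rewrite rvN /rv_opp /rv /= in h1 h2 h3 *.
by rewrite h2; congr (_, _); apply/eqP; rewrite -addr_eq0 addrC h3.
Qed.

Lemma rv_eqP x y a n : a != 0 -> rv x = (a, n) ->
  rv y = (a, n) <-> ord_ge (y - x) (n + 1).
Proof.
move=> a0 rx; have [xn xa] := rv_ord rx a0; split=> [ry|h].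
  have [yn ya] := rv_ord ry a0; apply: ord_geS; first exact: ord_geB.
  by rewrite coefB_laurent xa ya subrr.
rewrite -[y](subrK x); apply: rvE => //.
  by apply: ord_geD => //; apply: ord_geW h; lia.
by rewrite coefD_laurent h ?add0r //; lia.
Qed.

End LaurentOrder.

(** * Hensel's lemma *)

Lemma taylor_wide (R : comNzRingType) (p : {poly R}) N x h : (size p <= N)%N ->
  p.[x + h] = \sum_(k < N) p^`N(k).[x] * h ^+ k.
Proof.
move=> pN; rewrite nderiv_taylor; last exact: mulrC.
rewrite (big_ord_widen _ (fun k => p^`N(k).[x] * h ^+ k) pN) big_mkcond /=.
apply: eq_bigr => k _; case: ltnP => // pk.
by rewrite nderivn_poly0 // horner0 mul0r.
Qed.

Lemma nderivn_nderivn (R : nzRingType) (p : {poly R}) j k :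
  (p^`N(j))^`N(k) = p^`N(j + k) *+ 'C(j + k, j).
Proof.
apply/polyP => i; rewrite coef_nderivn coefMn !coef_nderivn -!mulrnA addnA.
congr (_ *+ _).
have bf a b : ('C(a + b, a) * (a`! * b`!) = (a + b)`!)%N.
  by have := bin_fact (leq_addr b a); rewrite addKn.
have h1 := bf j (k + i)%N; have h2 := bf k i; have h3 := bf (j + k)%N i.
have h4 := bf j k; rewrite addnA in h1.
apply/eqP; rewrite -(eqn_pmul2r (fact_gt0 j)) -(eqn_pmul2r (fact_gt0 k)).
rewrite -(eqn_pmul2r (fact_gt0 i)); apply/eqP.
move: h1 h2 h3 h4.
move: (j`!) (k`!) (i`!) ((k + i)`!) ((j + k)`!) ((j + k + i)`!) => a b c d e f.
move: 'C(_, j) 'C(_, k) 'C(_, j + k) 'C(_, j) => x y z w h1 h2 h3 h4.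
transitivity f; first by rewrite -h1 -h2; ring.
by rewrite -h3 -h4; ring.
Qed.

Lemma nderivn_at0 (R : comNzRingType) (p : {poly R}) k : p^`N(k).[0] = p`_k.
Proof. by rewrite horner_coef0 coef_nderivn addn0 binn. Qed.

Section Hensel.
Variable F : fieldType.
Local Notation K := (laurent F).
Implicit Types (x y z c w : K) (g m n : int) (a b : F) (p : {poly K}) (Q R : {poly F}).

(** [Q] is the reduction of [t^-m p(c + t^g X)], a polynomial with integral
    coefficients. *)
Definition residue_poly p c m g Q : Prop := forall k : nat,
  ord_ge (p^`N(k).[c]) (m - k%:Z * g) /\ p^`N(k).[c] (m - k%:Z * g) = Q`_k.

Lemma size_residue p c m g Q : residue_poly p c m g Q -> (size Q <= size p)%N.
Proof.
move=> res; apply/leq_sizeP => k pk; have [_ <-] := res k.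
by rewrite nderivn_poly0 // horner0.
Qed.

Lemma residue_horner p c m g Q z : residue_poly p c m g Q -> ord_ge z g ->
  ord_ge p.[c + z] m /\ p.[c + z] m = Q.[z g].
Proof.
move=> res zg; rewrite (taylor_wide _ _ (leqnn _)).
have term k : ord_ge (p^`N(k).[c] * z ^+ k) m /\
    (p^`N(k).[c] * z ^+ k) m = Q`_k * z g ^+ k.
  have [h1 h2] := res k.
  rewrite (_ : m = (m - k%:Z * g) + g * k%:Z); last by lia.
  split; first by apply: ord_geM => //; exact: ord_geX.
  rewrite ord_coefM //; last exact: ord_geX.
  by rewrite ord_coefX // h2.
split; first by apply: ord_ge_sum => k _; have [] := term k.
rewrite coef_sum_laurent (horner_coef_wide _ (size_residue res)).
by apply: eq_bigr => k _; have [] := term k.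
Qed.

Lemma residue_nderivn p c m g Q (j : nat) : residue_poly p c m g Q ->
  residue_poly p^`N(j) c (m - j%:Z * g) g Q^`N(j).
Proof.
move=> res k; rewrite nderivn_nderivn hornerMn coef_nderivn.
have [h1 h2] := res (j + k)%N.
rewrite (_ : m - j%:Z * g - k%:Z * g = m - (j + k)%N%:Z * g); last first.
  by rewrite PoszD mulrDl opprD addrA.
by split; [exact: ord_geMn | rewrite coefMn_laurent h2].
Qed.

Definition taylor_poly Q a : {poly F} := \poly_(k < size Q) Q^`N(k).[a].

Lemma coef_taylor_poly Q a k : (taylor_poly Q a)`_k = Q^`N(k).[a].
Proof.
by rewrite coef_poly; case: ltnP => // Qk; rewrite nderivn_poly0 // horner0.
Qed.

Lemma residue_shift p c m g Q z : residue_poly p c m g Q -> ord_ge z g ->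
  residue_poly p (c + z) m g (taylor_poly Q (z g)).
Proof.
move=> res zg k; rewrite coef_taylor_poly.
exact: residue_horner (residue_nderivn k res) zg.
Qed.

Lemma residue_shift0 p c m g Q z : residue_poly p c m g Q -> ord_ge z (g + 1) ->
  residue_poly p (c + z) m g Q.
Proof.
move=> res zg; have zg' : ord_ge z g by apply: ord_geW zg; lia.
move=> k; have := residue_shift res zg' k.
by rewrite coef_taylor_poly zg ?nderivn_at0 //; lia.
Qed.

(** From degree 2 on the Taylor expansion at [c] is negligible at points of
    order larger than [g]: this drives the approximation of roots and Newton's
    formula. *)
Lemma residue_linear p c m g Q w n : residue_poly p c m g Q ->
  ord_ge w n -> g < n ->
  ord_ge (p.[c + w] - (p.[c] + p^`N(1).[c] * w)) (m - g + n + 1).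
Proof.
move=> res wn gn.
rewrite (@taylor_wide _ _ (size p).+2) ?leqW //.
rewrite !big_ord_recl /= expr0 mulr1 expr1 nderivn0.
rewrite opprD addrACA subrr add0r addrAC subrr add0r.
apply: ord_ge_sum => i _; rewrite (_ : bump 0 (bump 0 i) = i.+2) //.
have [h _] := res i.+2; have := ord_geM h (@ord_geX _ w n i.+2 wn).
apply: ord_geW.
by nia.
Qed.

Lemma residue_order1 p c m g Q : residue_poly p c m g Q -> Q`_1 != 0 ->
  rv p^`N(1).[c] = (Q`_1, m - g).
Proof.
move=> res Q1; have [h1 h2] := res 1%N; rewrite mul1r in h1 h2.
exact: rvE.
Qed.

(** Newton approximation, one coefficient at a time: [u j] is a root up to
    order [m + 1 + j], and a correction of order [g + 1 + j] gains one order. *)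
Lemma hensel0 p c m g Q : residue_poly p c m g Q -> Q`_0 = 0 -> Q`_1 != 0 ->
  exists2 c', p.[c'] = 0 & ord_ge (c' - c) (g + 1).
Proof.
move=> res Q0 Q1.
pose step (j : nat) x := x + monomial (- (p.[x] (m + 1 + j%:Z) / Q`_1)) (g + 1 + j%:Z).
pose fix u j := if j is j'.+1 then step j' (u j') else c.
have uS j : ord_ge (u j.+1 - u j) (g + 1 + j%:Z).
  by rewrite /= /step addrAC subrr add0r; exact: ord_ge_monomial.
have uc j : ord_ge (u j - c) (g + 1).
  elim: j => [|j IH]; first by rewrite subrr.
  rewrite -(subrKA (u j)); apply: ord_geD => //; apply: ord_geW (uS j).
  by lia.
have resu j : residue_poly p (u j) m g Q.
  by rewrite -(subrK c (u j)) addrC; apply: residue_shift0.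
have pu j : ord_ge p.[u j] (m + 1 + j%:Z).
  elim: j => [|j IH].
    have [h1 h2] := res 0%N; rewrite nderivn0 mul0r subr0 in h1 h2.
    by rewrite addr0; apply: ord_geS => //; rewrite h2.
  set w := monomial (- (p.[u j] (m + 1 + j%:Z) / Q`_1)) (g + 1 + j%:Z).
  have wn : ord_ge w (g + 1 + j%:Z) by exact: ord_ge_monomial.
  have := @residue_linear _ _ _ _ _ w (g + 1 + j%:Z) (resu j) wn.
  move=> /(_ ltac:(lia)); rewrite -/(step j (u j)) => lin.
  rewrite /= -(subrK (p.[u j] + p^`N(1).[u j] * w) p.[step j (u j)]).
  apply: ord_geD; first by apply: ord_geW lin; lia.
  have [h1 h2] := resu j 1%N; rewrite mul1r in h1 h2.
  have e : m + 1 + j%:Z = (m - g) + (g + 1 + j%:Z) by lia.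
  rewrite (_ : m + 1 + j.+1%:Z = m + 1 + j%:Z + 1); last by lia.
  apply: ord_geS.
    by apply: ord_geD => //; rewrite e; exact: ord_geM.
  rewrite coefD_laurent {2}e ord_coefM // h2 monomial_coef mulrN mulrC divfK //.
  by rewrite subrr.
have [x xu] := laurent_complete uS.
exists x.
  apply: (@ord_ge_all0 _ _ (m + 1)) => j.
  have -> : x = u j + (x - u j) by rewrite addrC subrK.
  have := residue_linear (resu j) (xu j) ltac:(lia) => lin.
  rewrite -(subrK (p.[u j] + p^`N(1).[u j] * (x - u j)) p.[u j + (x - u j)]).
  apply: ord_geD; first by apply: ord_geW lin; lia.
  apply: ord_geD => //.
  have [h1 _] := resu j 1%N; rewrite mul1r in h1.
  by apply: ord_geW (ord_geM h1 (xu j)); lia.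
by have := xu 0%N; rewrite addr0.
Qed.

(** Moving the center to [c + a t^g] turns the simple root [a] into 0. *)
Lemma hensel p c m g Q a : residue_poly p c m g Q ->
  Q.[a] = 0 -> Q^`N(1).[a] != 0 ->
  exists2 c', p.[c'] = 0 & ord_ge (c' - c) g /\ (c' - c) g = a.
Proof.
move=> res Qa Qa'.
have := residue_shift res (@ord_ge_monomial F a g); rewrite monomial_coef => res'.
have [||c' pc' h] := hensel0 res'; rewrite ?coef_taylor_poly ?nderivn0 //.
have e : c' - c = (c' - (c + monomial a g)) + monomial a g by ring.
exists c' => //; rewrite e; split.
  by apply: ord_geD; [apply: ord_geW h; lia | exact: ord_ge_monomial].
by rewrite coefD_laurent monomial_coef h ?add0r //; lia.
Qed.

(** Newton's formula: [p(c) + p'(c) w] is smaller than [p'(c) w]. This makes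
    the leading distance to a root computable without knowing the root. *)
Lemma newton_rv p c m g Q w : residue_poly p c m g Q -> Q`_1 != 0 ->
  ord_ge w (g + 1) -> p.[c + w] = 0 ->
  rv w = rv_div (rv (- p.[c])) (rv p^`N(1).[c]).
Proof.
move=> res Q1 wg pw.
have r1 := residue_order1 res Q1.
have d0 : p^`N(1).[c] != 0 by rewrite -lead_eq0 [lead _](congr1 fst r1).
have [w0|w0] := eqVneq w 0.
  rewrite w0 rv0 -[c]addr0 -{1}w0 pw oppr0.
  by rewrite /rv_div rv0 /= eqxx.
have [wn wl] := lorderP w0.
have gn : g < lorder w.
  by case/ord_geP: wg => [w0'|]; [rewrite w0' eqxx in w0 | lia].
have := residue_linear res wn gn; rewrite pw sub0r => lin.
rewrite -(rv_divM w d0); congr (rv_div _ _).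
have rvdw : rv (p^`N(1).[c] * w) = (Q`_1 * lead w, m - g + lorder w).
  by rewrite rvM r1 /rv_mul /= (negPf Q1) lead_eq0 (negPf w0).
symmetry; rewrite rvdw.
have dw0 : Q`_1 * lead w != 0 by rewrite mulf_neq0 // lead_eq0.
apply/(rv_eqP _ dw0 rvdw).
move: lin; rewrite opprD; apply: ord_geW; lia.
Qed.

Lemma residue_rv p c m g Q a z : residue_poly p c m g Q -> rv z = (a, g) ->
  a != 0 -> Q.[a] != 0 -> rv p.[c + z] = (Q.[a], m).
Proof.
move=> res rz a0 Qa; have [zg za] := rv_ord rz a0.
by have [h1 h2] := residue_horner res zg; rewrite za in h2; exact: rvE.
Qed.

(** A polynomial of degree at most [e + 1] without term of degree [e] is not a
    multiple of [(X - a)^(e + 1)]: this is where characteristic 0 matters. *)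
Lemma multiplicity_drop (char0 : [pchar F] =i pred0) R a (e : nat) :
  (size R <= e.+2)%N -> R`_e = 0 -> R != 0 -> a != 0 ->
  exists2 k, (k <= e)%N & R^`N(k).[a] != 0.
Proof.
move=> sR Re R0 a0; apply: contrapT => no.
have Rk k : (k <= e)%N -> R^`N(k).[a] = 0.
  by move=> ke; apply/eqP/negPn/negP => nz; apply: no; exists k.
have Tay j : R`_j = \sum_(k < e.+2) (R^`N(j + k) *+ 'C(j + k, j)).[a] * (- a) ^+ k.
  have sz : (size R^`N(j) <= e.+2)%N.
    apply/leq_sizeP => i ei; rewrite coef_nderivn (leq_sizeP _ _ sR) ?mul0rn //.
    by lia.
  rewrite -nderivn_at0 -[X in R^`N(j).[X]](subrr a) (taylor_wide _ _ sz).
  by apply: eq_bigr => k _; rewrite nderivn_nderivn.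
have Rlarge k : (e.+1 < k)%N -> R^`N(k).[a] = 0.
  by move=> ek; rewrite nderivn_poly0 ?horner0 // (leq_trans sR).
have Re1 : R^`N(e.+1).[a] = 0.
  have := Tay e; rewrite Re big_ord_recl /= big_ord_recl /= big1 => [|k _].
    rewrite /bump /= addn0 addn1 binn binSn !mulr1n expr0 expr1 hornerMn Rk //.
    rewrite mul0r add0r addr0 => /esym/eqP; rewrite mulrN oppr_eq0 mulf_eq0.
    rewrite (negPf a0) orbF -mulr_natr mulf_eq0 => /orP[/eqP//|].
    by move/pcharf0P: char0 => ->.
  by rewrite hornerMn Rlarge ?mul0rn ?mul0r // /bump /=; lia.
case/eqP: R0; apply/polyP => j; rewrite coef0 Tay big1 // => k _.
rewrite hornerMn; case: (ltngtP (j + k) e.+1) => jk.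
- by rewrite Rk ?mul0rn ?mul0r //; lia.
- by rewrite Rlarge // mul0rn mul0r.
- by rewrite jk Re1 mul0rn mul0r.
Qed.

(** At [c'] the Taylor coefficient of order [e] vanishes and that of order
    [e + 1] dominates the later ones at all points closer than [g]. So the new
    residue polynomial has degree at most [e + 1] and no term of degree [e]. *)
Lemma recenter (char0 : [pchar F] =i pred0) p c m g Q a (e : nat) c' m' g' R b :
  residue_poly p c m g Q ->
  (forall k, (k <= e)%N -> Q^`N(k).[a] = 0) -> Q^`N(e.+1).[a] != 0 ->
  p^`N(e).[c'] = 0 -> ord_ge (c' - c) g -> (c' - c) g = a ->
  g < g' -> residue_poly p c' m' g' R -> R != 0 -> b != 0 ->
  exists2 k, (k <= e)%N & R^`N(k).[b] != 0.
Proof.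
move=> res Qk Qe pe cg ca gg' res' R0 b0.
have sh := residue_shift res cg; rewrite addrC subrK ca in sh.
have [h1 h2] := sh e.+1; rewrite coef_taylor_poly in h2.
have [h3 _] := res' e.+1.
have ineq : m' - e.+1%:Z * g' <= m - e.+1%:Z * g.
  rewrite leNgt; apply/negP => lt.
  by move: Qe; rewrite -h2 h3 ?eqxx.
apply: (multiplicity_drop char0) => //.
  apply/leq_sizeP => k ek; have [_ <-] := res' k; have [h4 _] := sh k.
  by apply: h4; nia.
by have [_ <-] := res' e; rewrite pe.
Qed.

End Hensel.

(** * Sets defined from leading terms *)

Section LeadingTermSets.
Variable F : fieldType.
Local Notation RV := (RV F).

Section Based.
Variables (T : Type) (N : nat) (u : nat -> T -> RV).

Definition leads t : seq F := mkseq (fun i => (u i t).1) N.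
Definition orders t : seq int := mkseq (fun i => (u i t).2) N.

(** Separating the two kinds of conditions in boxes is what makes projections
    harmless: see [based_ex]. *)
Inductive based : set T -> Prop :=
| based_box f (B : set (seq int)) : GRing.rformula f ->
    based [set t | GRing.holds (leads t) f /\ B (orders t)]
| based_or S1 S2 : based S1 -> based S2 -> based (S1 `|` S2)
| based_eqv S S' : (forall t, S t <-> S' t) -> based S -> based S'.

Lemma based_and S1 S2 : based S1 -> based S2 -> based (S1 `&` S2).
Proof.
move=> b1; elim: b1 S2 => {S1}.
- move=> f B rf S2; elim => {S2}.
  + move=> f2 B2 rf2.
    apply: (based_eqv _ (@based_box (GRing.And f f2) (B `&` B2) _)) => /=.
      by move=> t /=; tauto.
    by rewrite rf.
  + move=> S2 S3 _ b2 _ b3; apply: based_eqv (based_or b2 b3) => t /=.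
    by rewrite /setI /setU /=; tauto.
  + move=> S2 S3 e _ b2; apply: based_eqv b2 => t /=.
    by have := e t; rewrite /setI /=; tauto.
- move=> S1 S2 _ b1 _ b2 S3 b3; apply: based_eqv (based_or (b1 _ b3) (b2 _ b3)) => t /=.
  by rewrite /setI /setU /=; tauto.
- move=> S1 S2 e _ b1 S3 b3; apply: based_eqv (b1 _ b3) => t /=.
  by have := e t; rewrite /setI /=; tauto.
Qed.

Lemma based_not S : based S -> based (~` S).
Proof.
elim => {S}.
- move=> f B rf.
  apply: (based_eqv _ (based_or (@based_box (GRing.Not f) (fun _ => True) _)
    (@based_box (GRing.Bool true) (~` B) _))) => //= t /=.
  rewrite /setU /setC /=.
  have tr : true by []; have [h|h] := pselect (B (orders t)); have [h2|h2] := pselect (GRing.holds (leads t) f); tauto.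
- move=> S1 S2 _ b1 _ b2; apply: based_eqv (based_and b1 b2) => t.
  by rewrite /setI /setU /setC /=; tauto.
- move=> S1 S2 e _ b1; apply: based_eqv b1 => t.
  by have := e t; rewrite /setC /=; tauto.
Qed.

End Based.

Lemma based_rename T N N' (u u' : nat -> T -> RV) (p : nat -> nat) S :
  (forall i, (i < N)%N -> (p i < N')%N /\ u i = u' (p i)) ->
  based N u S -> based N' u' S.
Proof.
move=> pN; elim => {S}.
- move=> f B rf.
  have [f' rf' ff'] := @rformula_rename F f N N' p rf (fun i iN => (pN i iN).1).
  apply: (based_eqv _ (@based_box T N' u' f'
    [set l | B (mkseq (fun i => l`_(p i)) N)] rf')) => t /=.
  rewrite (_ : mkseq _ N = orders N u t); last first.
    apply: (@eq_from_nth _ 0); rewrite !size_mkseq // => i iN.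
    by have [pi ui] := pN i iN; rewrite !nth_mkseq // ui.
  have := ff' F id (leads N u t) (leads N' u' t); rewrite !map_formula_id.
  move=> -> //; first by rewrite size_mkseq.
  by move=> i iN; have [pi ui] := pN i iN; rewrite !nth_mkseq // ui.
- by move=> S1 S2 _ b1 _ b2; exact: based_or.
- by move=> S1 S2 e _; exact: based_eqv.
Qed.

(** Quantifiers over leading terms are treated by adding a component [RV] to
    the type [T] of parameters, which avoids named variables. *)
Definition rv_extend T (G : set (T -> RV)) : set (T * RV -> RV) :=
  [set r | r = snd \/ exists2 g, G g & r = g \o fst].

(** The leading coefficient and the order of the quantified leading term occur
    in different factors of a box, so that both can be projected away
    independently. *)
Lemma based_ex T N (u : nat -> T -> RV) (u' : nat -> T * RV -> RV) S :
  (forall i, (i < N)%N -> u' i = u i \o fst) -> u' N = snd ->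
  based N.+1 u' S -> based N u [set t | exists r, S (t, r)].
Proof.
move=> uu' uN; elim => {S}.
- move=> f B rf.
  apply: (based_eqv _ (@based_box T N u (GRing.Exists N f)
    [set l | exists n, B (rcons l n)] rf)) => t /=.
  have lE r : leads N.+1 u' (t, r) = rcons (leads N u t) r.1.
    apply: (@eq_from_nth _ 0); rewrite ?size_rcons !size_mkseq // => i iN.
    rewrite nth_rcons size_mkseq [LHS]nth_mkseq //.
    move: iN; rewrite ltnS leq_eqVlt => /predU1P[->|iN]; first by rewrite ltnn eqxx uN.
    by rewrite iN nth_mkseq // uu'.
  have oE r : orders N.+1 u' (t, r) = rcons (orders N u t) r.2.
    apply: (@eq_from_nth _ 0); rewrite ?size_rcons !size_mkseq // => i iN.
    rewrite nth_rcons size_mkseq [LHS]nth_mkseq //.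
    move: iN; rewrite ltnS leq_eqVlt => /predU1P[->|iN]; first by rewrite ltnn eqxx uN.
    by rewrite iN nth_mkseq // uu'.
  have sE x : set_nth 0 (leads N u t) N x = rcons (leads N u t) x.
    by rewrite set_nthE size_mkseq ltnn subnn cats1.
  split=> [[[x hx] [n hn]]|[r]].
    by exists (x, n); rewrite lE oE -sE.
  by rewrite lE oE => -[h1 h2]; split; [exists r.1; rewrite sE | exists r.2].
- move=> S1 S2 _ b1 _ b2; apply: based_eqv (based_or b1 b2) => t /=.
  split=> [[] [r Sr]|[r [] Sr]].
  + by exists r; left.
  + by exists r; right.
  + by left; exists r.
  + by right; exists r.
- move=> S1 S2 e _ b1; apply: based_eqv b1 => t /=.
  by split=> -[r Sr]; exists r; apply/e.
Qed.

(** The sets definable from leading terms belonging to [G]. *)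
Definition rvdef T (G : set (T -> RV)) (S : set T) : Prop :=
  exists N u, (forall i, (i < N)%N -> G (u i)) /\ based N u S.

Section RvDef.
Variable T : Type.
Implicit Types (G : set (T -> RV)) (S : set T) (u v : nat -> T -> RV).

Lemma rvdef_eqv G S S' : (forall t, S t <-> S' t) -> rvdef G S -> rvdef G S'.
Proof. by move=> e [N [u [uG b]]]; exists N, u; split=> //; exact: based_eqv b. Qed.

Lemma based_merge N1 N2 u1 u2 G :
  (forall i, (i < N1)%N -> G (u1 i)) -> (forall i, (i < N2)%N -> G (u2 i)) ->
  exists u, [/\ forall i, (i < N1 + N2)%N -> G (u i),
    forall S, based N1 u1 S -> based (N1 + N2) u S &
    forall S, based N2 u2 S -> based (N1 + N2) u S].
Proof.
move=> u1G u2G; exists (fun i => if (i < N1)%N then u1 i else u2 (i - N1)%N).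
split.
- move=> i iN; case: ltnP => h; first exact: u1G.
  by apply: u2G; lia.
- move=> S; apply: (@based_rename _ _ _ _ _ id) => i iN; rewrite iN.
  by split=> //; lia.
- move=> S; apply: (@based_rename _ _ _ _ _ (addn N1)) => i iN.
  by rewrite ltn_add2l iN ifN ?addKn // -leqNgt leq_addr.
Qed.

Lemma rvdef_or G S1 S2 : rvdef G S1 -> rvdef G S2 -> rvdef G (S1 `|` S2).
Proof.
move=> [N1 [u1 [uG1 b1]]] [N2 [u2 [uG2 b2]]].
have [u [uG h1 h2]] := based_merge uG1 uG2.
by exists (N1 + N2)%N, u; split=> //; apply: based_or; [exact: h1 | exact: h2].
Qed.

Lemma rvdef_not G S : rvdef G S -> rvdef G (~` S).
Proof.
by move=> [N [u [uG b]]]; exists N, u; split=> //; exact: based_not.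
Qed.

Lemma rvdef_and G S1 S2 : rvdef G S1 -> rvdef G S2 -> rvdef G (S1 `&` S2).
Proof.
move=> d1 d2; apply: rvdef_eqv (rvdef_not (rvdef_or (rvdef_not d1) (rvdef_not d2))).
move=> t; rewrite /setI /setU /setC /=.
by have [h1|h1] := pselect (S1 t); have [h2|h2] := pselect (S2 t); tauto.
Qed.

Lemma rvdef_const G (P : Prop) : rvdef G (fun _ => P).
Proof.
exists 0%N, (fun _ _ => (0, 0)); split=> //.
apply: (based_eqv _ (@based_box T 0 _ (GRing.Bool true) (fun _ => P) _)) => //.
by move=> t /=; split=> [[]|].
Qed.

Lemma rvdef_imp G S1 S2 : rvdef G S1 -> rvdef G S2 ->
  rvdef G [set t | S1 t -> S2 t].
Proof.
move=> d1 d2; apply: rvdef_eqv (rvdef_or (rvdef_not d1) d2) => t.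
rewrite /setU /setC /=.
by have [h1|h1] := pselect (S1 t); have [h2|h2] := pselect (S2 t); tauto.
Qed.

Lemma rvdef_all G (n : nat) (S : nat -> set T) : (forall k, rvdef G (S k)) ->
  rvdef G [set t | forall k, (k < n)%N -> S k t].
Proof.
move=> d; elim: n => [|n IH].
  by apply: rvdef_eqv (rvdef_const G True).
apply: rvdef_eqv (rvdef_and IH (d n)) => t; split=> [[h1 h2] k|h].
  by rewrite ltnS leq_eqVlt => /predU1P[->|/h1].
by split=> [k kn|]; apply: h; rewrite ltnS // ltnW.
Qed.

Lemma rvdef_some G (n : nat) (S : nat -> set T) : (forall k, rvdef G (S k)) ->
  rvdef G [set t | exists2 k, (k < n)%N & S k t].
Proof.
move=> d; apply: rvdef_eqv (rvdef_not (rvdef_all n (fun k => rvdef_not (d k)))).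
move=> t; rewrite /setC /=; split=> [h|[k kn Sk] h]; last exact: h Sk.
by apply: contrapT => h'; apply: h => k kn Sk; apply: h'; exists k.
Qed.

End RvDef.

Lemma rvdef_pull T1 T2 (G1 : set (T1 -> RV)) (G2 : set (T2 -> RV)) (f : T1 -> T2) S :
  (forall r, G2 r -> G1 (r \o f)) -> rvdef G2 S -> rvdef G1 (S \o f).
Proof.
move=> fG [N [u [uG b]]]; exists N, (fun i => u i \o f).
split; first by move=> i iN; apply/fG/uG.
elim: b => {S}.
- by move=> g B rg; apply: based_eqv (@based_box T1 N _ g B rg).
- by move=> S1 S2 _ b1 _ b2; apply: based_eqv (based_or b1 b2).
- by move=> S1 S2 e _ b1; apply: based_eqv b1 => t; exact: e.
Qed.

Lemma rvdef_ex T (G : set (T -> RV)) S : rvdef (rv_extend G) S ->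
  rvdef G [set t | exists r, S (t, r)].
Proof.
move=> [N [u [uG b]]].
have [v [n [vG [p hp]]]] : exists v n, (forall i, (i < n)%N -> G (v i)) /\
    exists p : nat -> nat, forall i, (i < N)%N -> (p i < n.+1)%N /\
      u i = if (p i < n)%N then v (p i) \o fst else snd.
  elim: N uG {b} => [|N IH] uG.
    by exists (fun _ _ => (0, 0)), 0%N; split=> //; exists id.
  have [v [n [vG [p hp]]]] := IH (fun i iN => uG i (ltnW iN)).
  case: (uG N (ltnSn N)) => [uN|[g Gg uN]].
    exists v, n; split=> //; exists (fun i => if (i < N)%N then p i else n) => i.
    rewrite ltnS leq_eqVlt => /predU1P[->|iN]; last by rewrite iN; exact: hp.
    by rewrite !ltnn ltnSn.
  exists (fun i => if (i < n)%N then v i else g), n.+1; split.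
    by move=> i; rewrite ltnS; case: ltnP => // iN _; exact: vG.
  exists (fun i => if (i < N)%N then (if (p i < n)%N then p i else n.+1) else n) => i.
  rewrite ltnS leq_eqVlt => /predU1P[->|iN].
    by rewrite !ltnn ltnSn ltnW ?ltnSn.
  rewrite iN; have [h1 ->] := hp i iN.
  case: ifP => h; last by rewrite ltnn ltnSn.
  by rewrite h !ltnS !(ltnW h) ltnW.
exists n, v; split=> //.
pose u' i : T * RV -> RV := if (i < n)%N then v i \o fst else snd.
apply: (@based_ex _ _ _ u'); first by move=> i iN; rewrite /u' iN.
  by rewrite /u' ltnn.
by apply: based_rename b => i iN; exact: hp.
Qed.

(** Definability of the graph; [rvdef_subst] then allows to substitute the
    function for a leading term. *)
Definition rvfun T (G : set (T -> RV)) (r : T -> RV) : Prop :=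
  rvdef (rv_extend G) [set z | r z.1 = z.2].

Lemma rv_extend_fst T (G : set (T -> RV)) g : G g -> rv_extend G (g \o fst).
Proof. by move=> Gg; right; exists g. Qed.

Lemma rvdef_fst T (G : set (T -> RV)) S : rvdef G S ->
  rvdef (rv_extend G) [set z | S z.1].
Proof. exact: (@rvdef_pull _ _ (rv_extend G) G fst S (@rv_extend_fst _ _)). Qed.

Lemma rvdef_subst T (G : set (T -> RV)) r S : rvfun G r ->
  rvdef (rv_extend G) S -> rvdef G [set t | S (t, r t)].
Proof.
move=> dr dS; apply: rvdef_eqv (rvdef_ex (rvdef_and dr dS)) => t /=.
by split=> [[s []] /= -> //|h]; exists (r t).
Qed.

Lemma rvfun_fst T (G : set (T -> RV)) r : rvfun G r -> rvfun (rv_extend G) (r \o fst).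
Proof.
move=> dr; pose f (z : T * RV * RV) := (z.1.1, z.2).
apply: rvdef_eqv (rvdef_pull (f := f) _ dr) => //.
by move=> g [->|[g' Gg' ->]]; [left|right; exists (g' \o fst) => //; right; exists g'].
Qed.

Lemma based_values T N (u : nat -> T -> RV) S : based N u S ->
  exists2 V : set (nat -> RV), based N (fun i v => v i) V &
    forall t, S t <-> V (fun i => u i t).
Proof.
elim => {S}.
- by move=> f B rf; exists [set v | GRing.holds (leads N (fun i v => v i) v) f /\
    B (orders N (fun i v => v i) v)] => //; exact: based_box.
- move=> S1 S2 _ [V1 b1 e1] _ [V2 b2 e2]; exists (V1 `|` V2).
    exact: based_or.
  by move=> t; rewrite /setU /=; have := e1 t; have := e2 t; tauto.
- by move=> S1 S2 e _ [V bV eV]; exists V => // t; have := e t; have := eV t; tauto.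
Qed.

Lemma based_of_values T N (u : nat -> T -> RV) V : based N (fun i v => v i) V ->
  based N u [set t | V (fun i => u i t)].
Proof.
elim => {V}.
- by move=> f B rf; exact: (@based_box T N u f B).
- by move=> V1 V2 _ b1 _ b2; exact: based_or.
- by move=> V1 V2 e _; apply: based_eqv => t; exact: e.
Qed.

Lemma based_local N V (v v' : nat -> RV) : based N (fun i v => v i) V ->
  (forall i, (i < N)%N -> v i = v' i) -> V v <-> V v'.
Proof.
move=> bV vv'; elim: bV => {V}.
- move=> f B _ /=.
  have -> : leads N (fun i v => v i) v = leads N (fun i v => v i) v'.
    apply: (@eq_from_nth _ 0); rewrite !size_mkseq // => i iN.
    by rewrite !nth_mkseq // vv'.
  have -> // : orders N (fun i v => v i) v = orders N (fun i v => v i) v'.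
  apply: (@eq_from_nth _ 0); rewrite !size_mkseq // => i iN.
  by rewrite !nth_mkseq // vv'.
- by move=> V1 V2 _ e1 _ e2; rewrite /setU /=; tauto.
- by move=> V1 V2 e _ e1; have := e v; have := e v'; tauto.
Qed.

(** Definable functions may be substituted for generators: replace them one
    after the other by a quantified leading term. *)
Lemma rvdef_values T (G : set (T -> RV)) N (w : nat -> T -> RV) V :
  based N (fun i v => v i) V -> (forall i, (i < N)%N -> rvfun G (w i)) ->
  rvdef G [set t | V (fun i => w i t)].
Proof.
move=> bV wG.
suff main M : (M <= N)%N -> forall (T : Type) (G : set (T -> RV)) (w : nat -> T -> RV),
    (forall i, (i < N)%N -> if (i < M)%N then rvfun G (w i) else G (w i)) ->
    rvdef G [set t | V (fun i => w i t)].
  by apply: (main N) => // i iN; rewrite iN; exact: wG.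
elim: M => [|M IH] MN {}T {}G {}w {}wG.
  by exists N, w; split=> //; exact: based_of_values.
pose w' i : T * RV -> RV := if i == M then snd else w i \o fst.
have /(rvdef_subst (r := w M)) : rvdef (rv_extend G) [set z | V (fun i => w' i z)].
  apply: (IH (ltnW MN)) => i iN; have := wG i iN; rewrite ltnS leq_eqVlt /w'.
  case: eqP => [->|_] /=; first by rewrite ltnn => _; left.
  by case: ifP => _ => [|h]; [exact: rvfun_fst | right; exists (w i)].
have -> : [set t | [set z | V (fun i => w' i z)] (t, w M t)] = [set t | V (fun i => w i t)].
  apply/funext => t /=; congr V; apply/funext => i.
  by rewrite /w' /=; case: eqP => // ->.
by apply; have := wG M MN; rewrite ltnSn.
Qed.

Lemma rvdef_pull_fun T1 T2 (G1 : set (T1 -> RV)) (G2 : set (T2 -> RV))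
    (f : T1 -> T2) S :
  (forall r, G2 r -> rvfun G1 (r \o f)) -> rvdef G2 S -> rvdef G1 [set t | S (f t)].
Proof.
move=> fG [N [u [uG /based_values[V bV eV]]]].
apply: (@rvdef_eqv _ _ [set t | V (fun i => u i (f t))]) => [t|].
  by have := eV (f t); rewrite /=; tauto.
by apply: (@rvdef_values _ _ N (fun i => u i \o f)) => // i iN; apply/fG/uG.
Qed.

Section RvFun.
Variables (T : Type) (G : set (T -> RV)).
Implicit Types (r s : T -> RV) (a b : T -> F) (g h : T -> int).

Lemma rvdef_box N (w : nat -> T -> RV) f (B : set (seq int)) :
  (forall i, (i < N)%N -> rvfun G (w i)) -> GRing.rformula f ->
  rvdef G [set t | GRing.holds (mkseq (fun i => (w i t).1) N) f /\
    B (mkseq (fun i => (w i t).2) N)].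
Proof.
move=> wG rf.
exact: (rvdef_values (@based_box _ N (fun i (v : nat -> RV) => v i) f B rf) wG).
Qed.

Lemma rvdef_lead2 r s (f : GRing.formula F) : rvfun G r -> rvfun G s ->
  GRing.rformula f -> rvdef G [set t | GRing.holds [:: (r t).1; (s t).1] f].
Proof.
move=> dr ds rf.
have h : forall i, (i < 2)%N -> rvfun G (nth r [:: r; s] i) by move=> [|[|]].
by apply: rvdef_eqv (@rvdef_box 2 _ f (fun _ => True) h rf) => t /=; split=> [[]|?].
Qed.

Lemma rvdef_order2 r s (B : int -> int -> Prop) : rvfun G r -> rvfun G s ->
  rvdef G [set t | B (r t).2 (s t).2].
Proof.
move=> dr ds.
have h : forall i, (i < 2)%N -> rvfun G (nth r [:: r; s] i) by move=> [|[|]].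
have b := @rvdef_box 2 _ (GRing.Bool true) (fun l => B l`_0 l`_1) h isT.
by apply: rvdef_eqv b => t /=; split=> [[]|].
Qed.

Lemma rvdef_if S0 S1 S2 S : rvdef G S0 -> rvdef G S1 -> rvdef G S2 ->
  (forall t, S0 t -> (S t <-> S1 t)) -> (forall t, ~ S0 t -> (S t <-> S2 t)) ->
  rvdef G S.
Proof.
move=> d0 d1 d2 e1 e2.
apply: rvdef_eqv (rvdef_or (rvdef_and d0 d1) (rvdef_and (rvdef_not d0) d2)) => t.
rewrite /setI /setU /setC /=.
by have [h|h] := pselect (S0 t); [have := e1 t h | have := e2 t h]; tauto.
Qed.

Lemma rvdef_cover N (M : nat -> set T) S (S' : nat -> set T) :
  (forall k, rvdef G (M k)) -> (forall k, (k < N)%N -> rvdef G (S' k)) ->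
  (forall t, exists2 k, (k < N)%N & M k t) ->
  (forall k t, (k < N)%N -> M k t -> (S t <-> S' k t)) -> rvdef G S.
Proof.
move=> dM dS cov e.
have dS' k : rvdef G (if (k < N)%N then S' k else set0).
  by case: ltnP => [/dS //|_]; exact: (rvdef_const G False).
apply: rvdef_eqv (rvdef_some N (fun k => rvdef_and (dM k) (dS' k))) => t /=.
rewrite /setI /=; split=> [[k kN []]|St]; first by rewrite kN => Mt St; apply/(e k t kN Mt).
by have [k kN Mt] := cov t; exists k => //; rewrite kN; split=> //; apply/(e k t kN Mt).
Qed.

End RvFun.

Definition leadfun T (G : set (T -> RV)) (a : T -> F) : Prop :=
  rvdef (rv_extend G) [set z | a z.1 = z.2.1].
Definition orderfun T (G : set (T -> RV)) (g : T -> int) : Prop :=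
  rvdef (rv_extend G) [set z | g z.1 = z.2.2].

Lemma rvfun_snd T (G : set (T -> RV)) : rvfun (rv_extend G) snd.
Proof.
exists 2%N, (fun i => if i == 0%N then snd \o fst else snd); split.
  by move=> [|[|//]] _ /=; [right; exists snd => //; left | left].
apply: (based_eqv _ (@based_box _ 2 _ ('X_0 == 'X_1)%T (fun l => l`_0 = l`_1) isT)).
by move=> [[t r] [a n]] /=; split=> [[<- <-]|->//]; case: r.
Qed.

Lemma rvfun_gen T (G : set (T -> RV)) r : G r -> rvfun G r.
Proof.
move=> Gr.
exists 2%N, (fun i => if i == 0%N then r \o fst else snd); split.
  by move=> [|[|//]] _ /=; [right; exists r | left].
apply: (based_eqv _ (@based_box _ 2 _ ('X_0 == 'X_1)%T (fun l => l`_0 = l`_1) isT)).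
by move=> [t [a n]] /=; split=> [[<- <-]|->//]; case: (r t).
Qed.

Section LeadOrderFun.
Variables (T : Type) (G : set (T -> RV)).
Implicit Types (r s : T -> RV) (a b : T -> F) (g h : T -> int).

Lemma rvfun_pair a g : leadfun G a -> orderfun G g -> rvfun G (fun t => (a t, g t)).
Proof.
move=> da dg; apply: rvdef_eqv (rvdef_and da dg) => -[t [x n]] /=.
by rewrite /setI /=; split=> [[-> ->]|[]].
Qed.

Lemma leadfun_fst r : rvfun G r -> leadfun G (fun t => (r t).1).
Proof.
move=> dr; apply: (@rvdef_lead2 _ _ (r \o fst) snd ('X_0 == 'X_1)%T) => //.
  exact: rvfun_fst.
exact: rvfun_snd.
Qed.

Lemma orderfun_snd r : rvfun G r -> orderfun G (fun t => (r t).2).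
Proof.
move=> dr; apply: (@rvdef_order2 _ _ (r \o fst) snd (fun x y => x = y)) => //.
  exact: rvfun_fst.
exact: rvfun_snd.
Qed.

Lemma leadfun_const x : leadfun G (fun _ => x).
Proof.
have h := @rvdef_lead2 _ _ _ snd (GRing.Const x == 'X_1)%T (@rvfun_snd _ G)
  (@rvfun_snd _ G) isT.
by apply: rvdef_eqv h => z /=.
Qed.

Lemma orderfun_const n : orderfun G (fun _ => n).
Proof.
exact: (@rvdef_order2 _ _ _ snd (fun x y => n = y) (@rvfun_snd _ G) (@rvfun_snd _ G)).
Qed.

Lemma leadfun_rv a : leadfun G a -> rvfun G (fun t => (a t, 0)).
Proof. by move=> da; apply: rvfun_pair => //; exact: orderfun_const. Qed.

Lemma orderfun_rv g : orderfun G g -> rvfun G (fun t => (0, g t)).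
Proof. by move=> da; apply: rvfun_pair => //; exact: leadfun_const. Qed.

Lemma rvfun_const (x : RV) : rvfun G (fun _ => x).
Proof.
by case: x => a n; apply: rvfun_pair; [exact: leadfun_const | exact: orderfun_const].
Qed.

Lemma leadfun3 a b f (F2 : F -> F -> F) : leadfun G a -> leadfun G b ->
  GRing.rformula f ->
  (forall x y z, GRing.holds [:: x; y; z] f <-> F2 x y = z) ->
  leadfun G (fun t => F2 (a t) (b t)).
Proof.
move=> /leadfun_rv/rvfun_fst da /leadfun_rv/rvfun_fst db rf fE.
have h : forall i, (i < 3)%N -> rvfun (rv_extend G) (nth snd
    [:: (fun t => (a t, 0)) \o fst; (fun t => (b t, 0)) \o fst; snd] i).
  by move=> [|[|[|]]] // _; exact: rvfun_snd.
apply: rvdef_eqv (@rvdef_box _ (rv_extend G) 3 _ f (fun _ => True) h rf) => z.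
by rewrite /= -fE; split=> [[]|].
Qed.

Lemma leadfunD a b : leadfun G a -> leadfun G b -> leadfun G (fun t => a t + b t).
Proof. by move=> da db; apply: (@leadfun3 _ _ ('X_0 + 'X_1 == 'X_2)%T +%R). Qed.

Lemma leadfunM a b : leadfun G a -> leadfun G b -> leadfun G (fun t => a t * b t).
Proof. by move=> da db; apply: (@leadfun3 _ _ ('X_0 * 'X_1 == 'X_2)%T *%R). Qed.

Lemma leadfunMn a k : leadfun G a -> leadfun G (fun t => a t *+ k).
Proof.
by move=> da; apply: (@leadfun3 a a ('X_0 *+ k == 'X_2)%T (fun x _ => x *+ k)).
Qed.

Lemma leadfunX a k : leadfun G a -> leadfun G (fun t => a t ^+ k).
Proof.
by move=> da; apply: (@leadfun3 a a ('X_0 ^+ k == 'X_2)%T (fun x _ => x ^+ k)).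
Qed.

Lemma leadfunV a : leadfun G a -> leadfun G (fun t => (a t)^-1).
Proof.
move=> da; apply: (@leadfun3 a a
  (('X_0 == 0%:R /\ 'X_2 == 0%:R) \/ 'X_0 * 'X_2 == 1%:R)%T (fun x _ => x^-1)) => //.
move=> x y z /=; split=> [[[-> ->]|xz]|<-]; first by rewrite invr0.
  have x0 : x != 0.
    by apply: contra_eq_neq xz => ->; rewrite mul0r eq_sym oner_eq0.
  by apply: (mulfI x0); rewrite mulfV.
have [->|x0] := eqVneq x 0; first by left; rewrite invr0.
by right; rewrite mulfV.
Qed.

Lemma leadfun_sum n (a : nat -> T -> F) : (forall k, leadfun G (a k)) ->
  leadfun G (fun t => \sum_(k < n) a k t).
Proof.
move=> da; elim: n => [|n IH].
  rewrite (_ : (fun t => _) = (fun _ => 0)); first exact: leadfun_const.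
  by apply/funext => t; rewrite big_ord0.
rewrite (_ : (fun t => _) = (fun t => \sum_(k < n) a k t + a n t)).
  exact: leadfunD.
by apply/funext => t; rewrite big_ord_recr.
Qed.

Lemma orderfun2 g h (H : int -> int -> int) : orderfun G g -> orderfun G h ->
  orderfun G (fun t => H (g t) (h t)).
Proof.
move=> /orderfun_rv/rvfun_fst dg /orderfun_rv/rvfun_fst dh.
have hw : forall i, (i < 3)%N -> rvfun (rv_extend G) (nth snd
    [:: (fun t => (0, g t)) \o fst; (fun t => (0, h t)) \o fst; snd] i).
  by move=> [|[|[|]]] // _; exact: rvfun_snd.
have b := @rvdef_box _ (rv_extend G) 3 _ (GRing.Bool true)
  (fun l => H l`_0 l`_1 = l`_2) hw isT.
by apply: rvdef_eqv b => z /=; split=> [[]|].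
Qed.

Lemma rvdef_lead_eq a b : leadfun G a -> leadfun G b -> rvdef G [set t | a t = b t].
Proof.
by move=> /leadfun_rv da /leadfun_rv db; apply: (rvdef_lead2 (f := ('X_0 == 'X_1)%T) da db).
Qed.

Lemma rvdef_lead0 a : leadfun G a -> rvdef G [set t | a t = 0].
Proof. by move=> da; apply: rvdef_lead_eq => //; exact: leadfun_const. Qed.

Lemma rvdef_lead_neq0 a : leadfun G a -> rvdef G [set t | a t != 0].
Proof.
move=> da; apply: rvdef_eqv (rvdef_not (rvdef_lead0 da)) => t.
by rewrite /setC /=; split=> [/eqP|/eqP].
Qed.

Lemma rvdef_order g h (B : int -> int -> Prop) : orderfun G g -> orderfun G h ->
  rvdef G [set t | B (g t) (h t)].
Proof.
by move=> /orderfun_rv dg /orderfun_rv dh; apply: (rvdef_order2 B dg dh).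
Qed.

Lemma rvdef_rv_eq r s : rvfun G r -> rvfun G s -> rvdef G [set t | r t = s t].
Proof.
move=> dr ds; have d1 := rvdef_lead_eq (leadfun_fst dr) (leadfun_fst ds).
have d2 := rvdef_order (fun x y => x = y) (orderfun_snd dr) (orderfun_snd ds).
apply: rvdef_eqv (rvdef_and d1 d2) => t; rewrite /setI /=.
by case: (r t) (s t) => [x n] [y m] /=; split=> [[-> ->]|[]].
Qed.

Lemma rvfun_if S0 r1 r2 r : rvdef G S0 -> rvfun G r1 -> rvfun G r2 ->
  (forall t, S0 t -> r t = r1 t) -> (forall t, ~ S0 t -> r t = r2 t) -> rvfun G r.
Proof.
move=> d0 d1 d2 e1 e2; apply: (rvdef_if (rvdef_fst d0) d1 d2) => -[t x] /= h.
  by rewrite e1.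
by rewrite e2.
Qed.

Lemma leadfun_if S0 a1 a2 a : rvdef G S0 -> leadfun G a1 -> leadfun G a2 ->
  (forall t, S0 t -> a t = a1 t) -> (forall t, ~ S0 t -> a t = a2 t) -> leadfun G a.
Proof.
move=> d0 d1 d2 e1 e2; apply: (rvdef_if (rvdef_fst d0) d1 d2) => -[t x] /= h.
  by rewrite e1.
by rewrite e2.
Qed.

Lemma rvfun_ifb (b : T -> bool) r1 r2 : rvdef G [set t | b t] ->
  rvfun G r1 -> rvfun G r2 -> rvfun G (fun t => if b t then r1 t else r2 t).
Proof.
move=> db d1 d2; apply: (rvfun_if db d1 d2) => [t /= ->//|t /= h].
by case: ifP.
Qed.

Lemma rvfun_cover N (M : nat -> set T) r (s : nat -> T -> RV) :
  (forall k, rvdef G (M k)) -> (forall k, (k < N)%N -> rvfun G (s k)) ->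
  (forall t, exists2 k, (k < N)%N & M k t) ->
  (forall k t, (k < N)%N -> M k t -> r t = s k t) -> rvfun G r.
Proof.
move=> dM ds cov e; apply: (@rvdef_cover _ _ N (fun k z => M k z.1) _
  (fun k z => s k z.1 = z.2)) => //.
- by move=> k; exact: rvdef_fst.
- by move=> k z kN Mz /=; rewrite (e k).
Qed.

Lemma rvfun_div r s : rvfun G r -> rvfun G s -> rvfun G (fun t => rv_div (r t) (s t)).
Proof.
move=> dr ds; have [dr1 ds1] := (leadfun_fst dr, leadfun_fst ds).
apply: (@rvfun_if [set t | (r t).1 * (s t).1 = 0] (fun _ => (0, 0))
  (fun t => ((r t).1 / (s t).1, (r t).2 - (s t).2))) => //.
- by apply/rvdef_lead0/leadfunM.
- exact: rvfun_const.
- apply: rvfun_pair; first by apply: leadfunM => //; exact: leadfunV.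
  by apply: (@orderfun2 _ _ (fun x y => x - y)); exact: orderfun_snd.
- by move=> t /= /eqP; rewrite mulf_eq0 /rv_div => ->.
- by move=> t /= /eqP; rewrite mulf_eq0 /rv_div => /negPf ->.
Qed.

Lemma rvfun_add r s : rvfun G r -> rvfun G s -> rvfun G (fun t => rv_add (r t) (s t)).
Proof.
move=> dr ds; have [dr1 ds1] := (leadfun_fst dr, leadfun_fst ds).
have [dr2 ds2] := (orderfun_snd dr, orderfun_snd ds).
have eq0 (a : T -> F) : leadfun G a -> rvdef G [set t | a t == 0].
  move=> /rvdef_lead0 da; apply: rvdef_eqv da => t /=.
  by split=> [->|/eqP].
apply: rvfun_ifb; [exact: eq0 | by [] |].
apply: rvfun_ifb; [exact: eq0 | by [] |].
apply: rvfun_ifb; [exact: (rvdef_order (fun x y => x < y) dr2 ds2) | by [] |].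
apply: rvfun_ifb; [exact: (rvdef_order (fun x y => x < y) ds2 dr2) | by [] |].
by apply: rvfun_pair => //; exact: leadfunD.
Qed.

Lemma rvdef_cancel r s : rvfun G r -> rvfun G s ->
  rvdef G [set t | rv_cancel (r t) (s t)].
Proof.
move=> dr ds; have [dr1 ds1] := (leadfun_fst dr, leadfun_fst ds).
have [dr2 ds2] := (orderfun_snd dr, orderfun_snd ds).
have d1 := rvdef_lead_neq0 dr1.
have d2 := rvdef_order (fun x y => x = y) dr2 ds2.
have d3 := rvdef_lead0 (leadfunD dr1 ds1).
apply: rvdef_eqv (rvdef_and d1 (rvdef_and d2 d3)) => t.
by rewrite /setI /= /rv_cancel; split=> [[? []]|[]].
Qed.

End LeadOrderFun.

End LeadingTermSets.

(** * Algebras of functions and trees of centers *)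

Section CenterTrees.
Variable F : fieldType.
Local Notation K := (laurent F).
Local Notation RV := (RV F).

Section Algebras.
Variable T : Type.
Implicit Types (G : set (T -> RV)) (A : set (T -> K)) (u v c : T -> K)
  (P : T -> {poly K}).

Definition function_algebra A : Prop := [/\ forall x, A (fun _ => x),
  forall u v, A u -> A v -> A (fun t => u t + v t) &
  forall u v, A u -> A v -> A (fun t => u t * v t)].

Definition tame G A : Prop := forall u, A u -> rvfun G (fun t => rv (u t)).

Definition polyfun A P : Prop :=
  (exists n, forall t, (size (P t) <= n)%N) /\ forall i, A (fun t => (P t)`_i).

Definition adjoin A c : set (T -> K) :=
  [set u | exists2 P, polyfun A P & u = fun t => (P t).[c t]].

(** The condition for [adjoin A c] to be tame: one may use [c] as if it were a
    polynomial, without leaving the sets definable from [G]. *)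
Definition good G A c : Prop :=
  forall P, polyfun A P -> rvfun G (fun t => rv (P t).[c t]).

Section Closure.
Variable A : set (T -> K).
Hypothesis algA : function_algebra A.

Lemma algebra_const x : A (fun _ => x). Proof. by case: algA. Qed.
Lemma algebraD u v : A u -> A v -> A (fun t => u t + v t).
Proof. by case: algA => _ h _; exact: h. Qed.
Lemma algebraM u v : A u -> A v -> A (fun t => u t * v t).
Proof. by case: algA => _ _ h; exact: h. Qed.

Lemma algebraN u : A u -> A (fun t => - u t).
Proof.
move=> Au; rewrite (_ : (fun t => _) = fun t => -1 * u t).
  by apply: algebraM => //; exact: algebra_const.
by apply/funext => t; rewrite mulN1r.
Qed.

Lemma algebraB u v : A u -> A v -> A (fun t => u t - v t).
Proof. by move=> Au Av; apply: algebraD => //; exact: algebraN. Qed.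

Lemma algebraMn u k : A u -> A (fun t => u t *+ k).
Proof.
move=> Au; rewrite (_ : (fun t => _) = fun t => u t * k%:R).
  by apply: algebraM => //; exact: algebra_const.
by apply/funext => t; rewrite mulr_natr.
Qed.

Lemma algebraX u k : A u -> A (fun t => u t ^+ k).
Proof.
move=> Au; elim: k => [|k IH]; first exact: algebra_const.
rewrite (_ : (fun t => _) = fun t => u t * u t ^+ k); first exact: algebraM.
by apply/funext => t; rewrite exprS.
Qed.

Lemma algebra_sum n (u : nat -> T -> K) : (forall k, A (u k)) ->
  A (fun t => \sum_(k < n) u k t).
Proof.
move=> Au; elim: n => [|n IH].
  rewrite (_ : (fun t => _) = fun _ => 0); first exact: algebra_const.
  by apply/funext => t; rewrite big_ord0.
rewrite (_ : (fun t => _) = fun t => \sum_(k < n) u k t + u n t); first exact: algebraD.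
by apply/funext => t; rewrite big_ord_recr.
Qed.

Lemma algebra_horner P c : polyfun A P -> A c -> A (fun t => (P t).[c t]).
Proof.
move=> [[n Pn] PA] Ac.
rewrite (_ : (fun t => _) = fun t => \sum_(k < n) (P t)`_k * c t ^+ k).
  apply: (algebra_sum _ (u := fun k t => (P t)`_k * c t ^+ k)) => k.
  by apply: algebraM => //; exact: algebraX.
by apply/funext => t; rewrite (horner_coef_wide _ (Pn t)).
Qed.

Lemma polyfunC u : A u -> polyfun A (fun t => (u t)%:P).
Proof.
move=> Au; split; first by exists 1%N => t; exact: size_polyC_leq1.
move=> [|i].
  rewrite (_ : (fun t => _) = u) //; apply/funext => t; by rewrite coefC.
rewrite (_ : (fun t => _) = fun _ => 0); first exact: algebra_const.
by apply/funext => t; rewrite coefC.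
Qed.

Lemma polyfun_const (p : {poly K}) : polyfun A (fun _ => p).
Proof. by split=> [|i]; [exists (size p) | exact: algebra_const]. Qed.

Lemma polyfunD P Q : polyfun A P -> polyfun A Q -> polyfun A (fun t => P t + Q t).
Proof.
move=> [[n Pn] PA] [[m Qm] QA]; split.
  exists (maxn n m) => t; apply: leq_trans (size_polyD _ _) _.
  by rewrite geq_max !leq_max Pn Qm orbT.
move=> i; rewrite (_ : (fun t => _) = fun t => (P t)`_i + (Q t)`_i).
  exact: algebraD.
by apply/funext => t; rewrite coefD.
Qed.

Lemma polyfunM P Q : polyfun A P -> polyfun A Q -> polyfun A (fun t => P t * Q t).
Proof.
move=> [[n Pn] PA] [[m Qm] QA]; split.
  exists (n + m)%N => t; apply: leq_trans (size_polyMleq _ _) _.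
  by have := Pn t; have := Qm t; lia.
move=> i; rewrite (_ : (fun t => _) = fun t => \sum_(k < i.+1) (P t)`_k * (Q t)`_(i - k)).
  apply: (algebra_sum _ (u := fun k t => (P t)`_k * (Q t)`_(i - k))) => k.
  exact: algebraM.
by apply/funext => t; rewrite coefM.
Qed.

Lemma polyfun_nderivn P k : polyfun A P -> polyfun A (fun t => (P t)^`N(k)).
Proof.
move=> [[n Pn] PA]; split.
  exists n => t; apply/leq_sizeP => i ni; rewrite coef_nderivn.
  by rewrite (leq_sizeP _ _ (Pn t)) ?mul0rn //; lia.
move=> i; rewrite (_ : (fun t => _) = fun t => (P t)`_(k + i) *+ 'C(k + i, k)).
  exact: algebraMn.
by apply/funext => t; rewrite coef_nderivn.
Qed.

Lemma polyfunB P Q : polyfun A P -> polyfun A Q -> polyfun A (fun t => P t - Q t).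
Proof.
move=> hP hQ; rewrite (_ : (fun t => _) = fun t => P t + (-1)%:P * Q t).
  by apply: polyfunD => //; apply: polyfunM => //; exact: polyfun_const.
by apply/funext => t; rewrite polyCN mulN1r.
Qed.

Lemma adjoin_incl c u : A u -> adjoin A c u.
Proof.
move=> Au; exists (fun t => (u t)%:P); first exact: polyfunC.
by apply/funext => t; rewrite hornerC.
Qed.

Lemma adjoin_gen c : adjoin A c c.
Proof.
exists (fun _ => 'X); first exact: polyfun_const.
by apply/funext => t; rewrite hornerX.
Qed.

Lemma adjoin_algebra c : function_algebra (adjoin A c).
Proof.
split=> [x|_ _ [P hP ->] [Q hQ ->]|_ _ [P hP ->] [Q hQ ->]].
- exact/adjoin_incl/algebra_const.
- exists (fun t => P t + Q t); first exact: polyfunD.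
  by apply/funext => t; rewrite hornerD.
- exists (fun t => P t * Q t); first exact: polyfunM.
  by apply/funext => t; rewrite hornerM.
Qed.

Lemma good_mem G c : tame G A -> A c -> good G A c.
Proof. by move=> tA Ac P hP; apply: tA; exact: algebra_horner. Qed.

Lemma good_cover G N (M : nat -> set T) c (s : nat -> T -> K) :
  (forall k, rvdef G (M k)) -> (forall k, (k < N)%N -> good G A (s k)) ->
  (forall t, exists2 k, (k < N)%N & M k t) ->
  (forall k t, (k < N)%N -> M k t -> c t = s k t) -> good G A c.
Proof.
move=> dM ds cov e P hP.
apply: (@rvfun_cover _ _ _ N M _ (fun k t => rv (P t).[s k t])) => //.
  by move=> k kN; exact: ds.
by move=> k t kN Mt; rewrite (e k).
Qed.

End Closure.

Lemma good_tame G A c : good G A c -> tame G (adjoin A c).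
Proof. by move=> gc _ [P hP ->]; exact: gc. Qed.

Lemma polyfun_sub A A' P : (forall u, A u -> A' u) -> polyfun A P -> polyfun A' P.
Proof. by move=> AA' [h1 h2]; split=> // i; exact: AA'. Qed.

(** The first set containing the point is a definable choice. *)
Lemma rvdef_choose G N (M : nat -> set T) : (forall k, rvdef G (M k)) ->
  (forall t, exists2 k, (k < N)%N & M k t) ->
  exists k : T -> nat, [/\ forall t, (k t < N)%N, forall t, M (k t) t &
    forall j, rvdef G [set t | k t = j]].
Proof.
move=> dM cov.
have ex t : exists k, `[< (k < N)%N /\ M k t >].
  by have [k kN Mk] := cov t; exists k; apply/asboolP.
exists (fun t => ex_minn (ex t)); split=> [t|t|j].
- by case: ex_minnP => k /asboolP[].
- by case: ex_minnP => k /asboolP[].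
- have d1 := rvdef_and (dM j) (rvdef_all j (fun i => rvdef_not (dM i))).
  have d2 := rvdef_and (rvdef_const G (j < N)%N) d1.
  apply: rvdef_eqv d2 => t; rewrite /setI /setC /=.
  case: ex_minnP => k /asboolP[kN Mk] kmin; split=> [[jN [Mj nMj]]|<-].
    apply/eqP; rewrite eqn_leq kmin ?andbT; last exact/asboolP.
    by rewrite leqNgt; apply/negP => jk; exact: nMj Mk.
  split=> //; split=> // i ik Mi.
  have /kmin : `[< (i < N)%N /\ M i t >].
    by apply/asboolP; split=> //; exact: ltn_trans kN.
  by rewrite leqNgt ik.
Qed.

End Algebras.

Definition pullback T T' (f : T' -> T) (A : set (T -> K)) : set (T' -> K) :=
  [set v | exists2 u, A u & v = u \o f].

Lemma pullback_mem T T' (f : T' -> T) (A : set (T -> K)) u : A u -> pullback f A (u \o f).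
Proof. by move=> Au; exists u. Qed.

Lemma pullback_algebra T T' (f : T' -> T) A : function_algebra A ->
  function_algebra (pullback f A).
Proof.
move=> algA; split=> [x|_ _ [u Au ->] [v Av ->]|_ _ [u Au ->] [v Av ->]].
- by exists (fun _ => x) => //; exact: algebra_const.
- by exists (fun t => u t + v t) => //; exact: algebraD.
- by exists (fun t => u t * v t) => //; exact: algebraM.
Qed.

Lemma pullback_tame T (G : set (T -> RV)) A : tame G A ->
  tame (rv_extend G) (pullback fst A).
Proof. by move=> tA _ [u Au ->]; apply: (rvfun_fst (tA _ Au)). Qed.

Lemma polyfun_comp T T' (f : T' -> T) (A : set (T -> K)) (A' : set (T' -> K)) P :
  (forall u, A u -> A' (u \o f)) -> polyfun A P -> polyfun A' (P \o f).
Proof.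
move=> fA [[n Pn] PA]; split; first by exists n => t; exact: Pn.
by move=> i; exact: (fA _ (PA i)).
Qed.

Lemma rvfun_pull_fun T1 T2 (G1 : set (T1 -> RV)) (G2 : set (T2 -> RV)) (f : T1 -> T2) r :
  (forall g, G2 g -> rvfun G1 (g \o f)) -> rvfun G2 r -> rvfun G1 (r \o f).
Proof.
move=> fG dr.
apply: (@rvdef_pull_fun _ _ _ (rv_extend G1) (rv_extend G2) (fun z => (f z.1, z.2)) _ _ dr).
move=> g [->|[g' Gg' ->]]; first exact: rvfun_snd.
exact: (rvfun_fst (fG _ Gg')).
Qed.

(** Membership of [(t, y)] in [S] is decided by reading the leading terms of
    the differences between [y] and finitely many centers, one after the other.
    Each center may depend on the leading terms read before, which are kept as
    additional parameters; later centers may be algebraic over earlier ones, so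
    the algebra grows as well. *)
Inductive center_tree : forall T : Type, set (T -> RV) -> set (T -> K) -> (T -> K -> Prop) -> Prop :=
| tree_base T G A S : rvdef G S -> @center_tree T G A (fun t _ => S t)
| tree_step T G A c (S : T * RV -> K -> Prop) : good G A c ->
    center_tree (rv_extend G) (pullback fst (adjoin A c)) S ->
    @center_tree T G A (fun t y => S (t, rv (y - c t)) y).

(** The conditions define balls, and balls are nested or disjoint. So there is
    a common point if and only if one of the balls is contained in all others,
    which can be expressed by the leading terms of the [c_i - c_j]. *)
Lemma rvdef_meet T (G : set (T -> RV)) A n (c : nat -> T -> K) (r : nat -> T -> RV) :
  function_algebra A -> tame G A ->
  (forall i, (i < n)%N -> A (c i)) -> (forall i, (i < n)%N -> rvfun G (r i)) ->
  rvdef G [set t | exists y, forall i, (i < n)%N -> rv (y - c i t) = r i t].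
Proof.
move=> algA tA Ac dr.
case: n Ac dr => [|n] Ac dr.
  by apply: rvdef_eqv (rvdef_const G True) => t /=; split=> // _; exists 0.
pose isrv (s : RV) := s.1 <> 0 \/ s = (0, 0).
pose E i j t := ~ rv_cancel (r i t) (rv (c i t - c j t)) /\
  rv_add (r i t) (rv (c i t - c j t)) = r j t.
pose r' i := if (i < n.+1)%N then r i else fun _ => (0, 0).
pose c' i := if (i < n.+1)%N then c i else fun _ => 0.
have dr' i : rvfun G (r' i).
  by rewrite /r'; case: ltnP => [/dr//|_]; exact: rvfun_const.
have Ac' i : A (c' i).
  by rewrite /c'; case: ltnP => [/Ac//|_]; exact: algebra_const.
pose E' i j t := ~ rv_cancel (r' i t) (rv (c' i t - c' j t)) /\
  rv_add (r' i t) (rv (c' i t - c' j t)) = r' j t.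
have dE i j : rvdef G (E' i j).
  have dcc : rvfun G (fun t => rv (c' i t - c' j t)).
    exact: (tA _ (algebraB algA (Ac' i) (Ac' j))).
  exact: rvdef_and (rvdef_not (rvdef_cancel (dr' i) dcc))
    (rvdef_rv_eq (rvfun_add (dr' i) dcc) (dr' j)).
have dI i : rvdef G [set t | isrv (r' i t)].
  apply: rvdef_or (rvdef_not (rvdef_lead0 (leadfun_fst (dr' i)))) _.
  exact: (rvdef_rv_eq (dr' i) (rvfun_const _ (0, 0))).
apply: rvdef_eqv (rvdef_some n.+1 (fun i => rvdef_and (dI i)
  (rvdef_all n.+1 (fun j => dE i j)))) => t; rewrite /setI /=; split.
  move=> [i i_n [Ii Ei]].
  have [z rz] : exists z : K, rv z = r' i t.
    case: Ii => [h|->]; last by exists 0; rewrite rv0.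
    by exists (monomial (r' i t).1 (r' i t).2); rewrite rv_monomial -?surjective_pairing //; apply/eqP.
  exists (c' i t + z) => j j_n; have [h1 h2] := Ei j j_n.
  have -> : c' i t + z - c j t = z + (c' i t - c' j t) by rewrite /c' j_n; ring.
  by rewrite rvD rz // h2 /r' j_n.
move=> [y hy].
have hy' i : (i < n.+1)%N -> rv (y - c' i t) = r' i t.
  by move=> i_n; rewrite /c' /r' i_n; exact: hy.
have [i i_n imax] : exists2 i, (i < n.+1)%N & forall j, (j < n.+1)%N ->
    (y - c' i t = 0) \/ (y - c' j t != 0 /\ lorder (y - c' j t) <= lorder (y - c' i t)).
  have [[i i_n yi]|none] := pselect (exists2 i, (i < n.+1)%N & y - c' i t = 0).
    by exists i => // j _; left.
  pose o (i : 'I_n.+1) : int := lorder (y - c' i t).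
  have [i _ imax] := @Order.TotalTheory.arg_maxP _ _ _ ord0 xpredT o isT.
  exists i => // j j_n; right; split; last exact: (imax (Ordinal j_n)).
  by apply/eqP => yj; apply: none; exists j.
exists i => //; split.
  rewrite -hy' //; have [->|nz] := eqVneq (y - c' i t) 0; first by right; rewrite rv0.
  by left; apply/eqP; rewrite lead_eq0.
move=> j j_n; rewrite /E' -!hy' //.
have e : y - c' j t = (y - c' i t) + (c' i t - c' j t) by ring.
suff nc : ~ rv_cancel (rv (y - c' i t)) (rv (c' i t - c' j t)).
  by split; [exact: nc | rewrite -rvD // -e].
move=> nc; have := rv_cancelP nc; case: nc => nz _ _.
have nz' := rv_neq0 nz.
case: (imax j j_n) => [yi|[yj jle]]; first by rewrite yi eqxx in nz'.
move=> rvc; have rvc' : rv (- (y - c' i t)) = ((rv (- (y - c' i t))).1, lorder (y - c' i t)).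
  by rewrite rvN.
have nzl : (rv (- (y - c' i t))).1 != 0 by rewrite lead_eq0 oppr_eq0.
have := (rv_eqP (c' i t - c' j t) nzl rvc').1; rewrite rvc => /(_ rvc').
rewrite opprK addrC -e => /ord_geP[yj0|]; first by rewrite yj0 eqxx in yj.
by lia.
Qed.

(** Reading a leading term is a quantifier over leading terms; what remains at
    the end is the compatibility of all the terms read. *)
Lemma rvdef_tree_ex T (G : set (T -> RV)) A S : center_tree G A S ->
  function_algebra A -> tame G A ->
  forall n (c : nat -> T -> K) (r : nat -> T -> RV),
  (forall i, (i < n)%N -> A (c i)) -> (forall i, (i < n)%N -> rvfun G (r i)) ->
  rvdef G [set t | exists2 y, forall i, (i < n)%N -> rv (y - c i t) = r i t & S t y].
Proof.
elim => {T G A S}.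
  move=> T G A S dS algA tA n c r Ac dr.
  apply: rvdef_eqv (rvdef_and (rvdef_meet algA tA Ac dr) dS) => t.
  by rewrite /setI /=; split=> [[[y hy] St]|[y hy St]]; [exists y | split=> //; exists y].
move=> T G A c0 S gc0 _ IH algA tA n c r Ac dr.
have algA1 := pullback_algebra (@fst T RV) (adjoin_algebra algA c0).
have tA' := pullback_tame (good_tame gc0).
pose c' i : T * RV -> K := (if i == n then c0 else c i) \o fst.
pose r' i : T * RV -> RV := if i == n then snd else r i \o fst.
have {}IH := IH algA1 tA' n.+1 c' r'.
have d : rvdef (rv_extend G) [set z | exists2 y,
    forall i, (i < n.+1)%N -> rv (y - c' i z) = r' i z & S z y].
  apply: IH => i; rewrite ltnS leq_eqVlt /c' /r'; case: eqP => [_ _|_ /= i_n].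
  - by apply: pullback_mem; exact: adjoin_gen.
  - by apply: pullback_mem; apply: adjoin_incl => //; exact: Ac.
  - exact: rvfun_snd.
  - by apply: rvfun_fst; exact: dr.
apply: rvdef_eqv (rvdef_ex d) => t /=; split=> [[s [y hy Sy]]|[y hy Sy]].
  exists y; last by have := hy n (ltnSn n); rewrite /c' /r' eqxx /= => ->.
  by move=> i i_n; have := hy i (ltnW i_n); rewrite /c' /r' ltn_eqF.
exists (rv (y - c0 t)), y => // i; rewrite ltnS leq_eqVlt /c' /r'.
by case: eqP => [->//|_ /= i_n]; exact: hy.
Qed.

End CenterTrees.

(** * Roots of polynomials as centers *)

Section RootsAreGood.
Variable F : fieldType.
Hypothesis char0 : [pchar F] =i pred0.
Local Notation K := (laurent F).
Local Notation RV := (RV F).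

(** [c'] is the root of [p] that Hensel's lemma finds among the points at
    leading distance [r] from [b]. *)
Definition newton_root (p : {poly K}) (b : K) (r : RV) (c' : K) : Prop :=
  [/\ p != 0, p.[c'] = 0, rv (c' - b) = r & forall u, rv (u - b) = r ->
    rv (c' - u) = rv_div (rv (- p.[u])) (rv p^`N(1).[u])].

Record root_on T (G : set (T -> RV)) (A : set (T -> K)) (S0 : set T) (b : T -> K)
    (f : T -> {poly K}) (r : T -> RV) (c' : T -> K) : Prop := RootOn {
  root_on_base : A b;
  root_on_poly : polyfun A f;
  root_on_rv : rvfun G r;
  root_on_def : rvdef G S0;
  root_onP : forall t, S0 t -> newton_root (f t) (b t) (r t) (c' t);
  root_offP : forall t, ~ S0 t -> c' t = b t }.

Lemma root_on_fst T (G : set (T -> RV)) A S0 b f r c' : root_on G A S0 b f r c' ->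
  root_on (rv_extend G) (pullback fst A) (fun z => S0 z.1)
    (b \o fst) (f \o fst) (r \o fst) (c' \o fst).
Proof.
case=> Ab hf dr dS on off; split.
- exact: pullback_mem.
- by apply: polyfun_comp hf => u; exact: pullback_mem.
- exact: rvfun_fst.
- exact: rvdef_fst.
- by move=> t; exact: on.
- by move=> t; exact: off.
Qed.

(** If [u] has leading distance [r] from [b], it is in the ball where Newton's
    formula applies; otherwise the differences [c' - b] and [b - u] cannot
    cancel. *)
Lemma rvfun_root_dist T (G : set (T -> RV)) A S0 b f r c' u :
  function_algebra A -> tame G A -> root_on G A S0 b f r c' -> A u ->
  rvfun G (fun t => rv (c' t - u t)).
Proof.
move=> algA tA [Ab hf dr dS on off] Au.
have dbu : rvfun G (fun t => rv (b t - u t)) by exact: (tA _ (algebraB algA Ab Au)).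
have dub : rvfun G (fun t => rv (u t - b t)) by apply: (tA _ (algebraB algA Au Ab)).
pose r1 t : RV := rv_add (r t) (rv (b t - u t)).
pose r2 t : RV := rv_div (rv (- (f t).[u t])) (rv (f t)^`N(1).[u t]).
have d1 : rvfun G r1 by exact: rvfun_add.
have d2 : rvfun G r2.
  apply: rvfun_div; apply: tA.
    exact: (algebraN algA (algebra_horner algA hf Au)).
  exact: (algebra_horner algA (polyfun_nderivn algA 1 hf) Au).
pose Sc t := rv_cancel (r t) (rv (b t - u t)).
have dSc : rvdef G Sc by exact: rvdef_cancel.
pose r12 t := if pselect (Sc t) then r2 t else r1 t.
have d12 : rvfun G r12.
  by apply: (rvfun_if dSc d2 d1) => t St; rewrite /r12; case: pselect.
apply: (rvfun_if dS d12 dbu) => t St; last by rewrite off.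
have [_ _ rb near] := on _ St; rewrite /r12; case: pselect => /= nc.
  move: nc; rewrite /Sc -{1}rb => /rv_cancelP e.
  by rewrite near // -opprB rvN e -rvN opprK.
by rewrite /r1 -rb -rvD ?rb //; congr rv; ring.
Qed.

(** Instead of quantifying [y], substitute a root for it: then all leading
    terms that are read can be computed. *)
Lemma rvdef_tree_root T (G : set (T -> RV)) A S : center_tree G A S ->
  function_algebra A -> tame G A -> forall S0 b f r c', root_on G A S0 b f r c' ->
  rvdef G [set t | S t (c' t)].
Proof.
elim => {T G A S}; first by move=> T G A S dS *; exact: dS.
move=> T G A c0 S gc0 _ IH algA tA S0 b f r c' hr.
have algA1 := adjoin_algebra algA c0; have tA1 := good_tame gc0.
have algA2 := pullback_algebra (@fst T RV) algA1; have tA2 := pullback_tame tA1.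
have hr1 : root_on G (adjoin A c0) S0 b f r c'.
  case: hr => Ab hf dr dS on off; split=> //; first exact: adjoin_incl.
  exact: (polyfun_sub (adjoin_incl algA c0)).
have hr2 := root_on_fst hr1.
have d := IH algA2 tA2 _ _ _ _ _ hr2.
exact: (rvdef_subst (rvfun_root_dist algA1 tA1 hr1 (adjoin_gen algA c0)) d).
Qed.

(** A tree remains a tree over an extension [A'] of [A] only if its centers
    stay good over [A']. Requiring it for all extensions allows to read the
    leading terms of several polynomials one after the other, the centers for
    one being adjoined before those for the next are chosen. *)
Definition stable_tree T (G : set (T -> RV)) (A : set (T -> K)) (S : T -> K -> Prop) : Prop :=
  forall T' (G' : set (T' -> RV)) (A' : set (T' -> K)) (f : T' -> T),
    function_algebra A' -> tame G' A' ->
    (forall u, A u -> A' (u \o f)) -> (forall g, G g -> rvfun G' (g \o f)) ->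
    center_tree G' A' (fun t y => S (f t) y).

Lemma tree_of_stable T (G : set (T -> RV)) A S : function_algebra A -> tame G A ->
  stable_tree G A S -> center_tree G A S.
Proof.
move=> algA tA hp; apply: (hp _ _ _ id) => // g; exact: rvfun_gen.
Qed.

Lemma stable_tree_base T (G : set (T -> RV)) A S : rvdef G S -> stable_tree G A (fun t _ => S t).
Proof.
move=> dS T' G' A' f algA tA fA fG; apply: tree_base.
exact: rvdef_pull_fun dS.
Qed.

Lemma stable_tree_pull T T' (G : set (T -> RV)) A S (G' : set (T' -> RV)) A' (f : T' -> T) :
  (forall u, A u -> A' (u \o f)) -> (forall g, G g -> rvfun G' (g \o f)) ->
  stable_tree G A S -> stable_tree G' A' (fun t y => S (f t) y).
Proof.
move=> fA fG hp T2 G2 A2 f2 algA2 tA2 f2A f2G.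
apply: (hp _ _ _ (f \o f2)) => // [u Au|g Gg].
  exact: (f2A _ (fA _ Au)).
exact: (rvfun_pull_fun f2G (fG _ Gg)).
Qed.

Lemma stable_tree_extend T T' (G : set (T -> RV)) A S (G' : set (T' -> RV)) A' (f : T' -> T) :
  (forall u, A u -> A' (u \o f)) -> (forall g, G g -> rvfun G' (g \o f)) ->
  stable_tree (rv_extend G) (pullback fst A) S ->
  stable_tree (rv_extend G') (pullback fst A') (fun z y => S (f z.1, z.2) y).
Proof.
move=> fA fG; apply: (@stable_tree_pull _ _ _ _ _ _ _ (fun z => (f z.1, z.2))).
  by move=> _ [u Au ->]; apply: (pullback_mem _ (fA _ Au)).
move=> g [->|[g' Gg' ->]]; first exact: rvfun_snd.
exact: (rvfun_fst (fG _ Gg')).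
Qed.

(** The two statements proved together by induction on [n]. *)
Definition computable_poly n : Prop :=
  forall T (G : set (T -> RV)) A (f : T -> {poly K}) S, function_algebra A -> tame G A ->
  polyfun A f -> (forall t, (size (f t) <= n)%N) ->
  stable_tree (rv_extend G) (pullback fst A) S ->
  center_tree G A (fun t y => S (t, rv (f t).[y]) y).

Definition good_roots n : Prop :=
  forall T (G : set (T -> RV)) A S0 b (f : T -> {poly K}) r c', function_algebra A -> tame G A ->
  (forall t, (size (f t) <= n)%N) -> root_on G A S0 b f r c' -> good G A c'.

(** A polynomial at a root of [f] can be replaced by its remainder modulo [f],
    whose degree is small enough for the centers of the remainder to be
    available; the leading distances between these and the root are known. *)
Lemma good_roots_of_computable n : computable_poly n -> good_roots n.+1.
Proof.
move=> Pn T G A.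
suff main d : (d <= n.+1)%N -> forall S0 b (f : T -> {poly K}) r c', function_algebra A -> tame G A ->
    (forall t, (size (f t) <= d)%N) -> root_on G A S0 b f r c' -> good G A c'.
  exact: main.
elim: d => [|d IH] dn S0 b f r c' algA tA fd hr.
  have -> : c' = b.
    apply/funext => t; case: hr => _ _ _ _ on off.
    have [St|/off//] := pselect (S0 t).
    by have [f0 _ _ _] := on _ St; have := fd t; rewrite leqn0 size_poly_eq0 (negPf f0).
  by apply: good_mem => //; case: hr.
case: (hr) => Ab hf dr dS on off.
pose a t := (f t)`_d.
have Aa : A a by case: hf => _; exact.
have da : rvdef G [set t | a t = 0].
  apply: rvdef_eqv (rvdef_lead0 (leadfun_fst (tA _ Aa))) => t /=.
  by split=> [/rv_eq0//|->]; rewrite lead0.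
(* where the leading coefficient vanishes the degree drops *)
pose S1 := S0 `&` [set t | a t = 0]; pose S2 := S0 `&` ~` [set t | a t = 0].
pose c1 t := if pselect (S1 t) then c' t else b t.
pose c2 t := if pselect (S2 t) then c' t else b t.
have c1E t : S1 t -> c1 t = c' t by rewrite /c1; case: pselect.
have c1N t : ~ S1 t -> c1 t = b t by rewrite /c1; case: pselect.
have c2E t : S2 t -> c2 t = c' t by rewrite /c2; case: pselect.
have c2N t : ~ S2 t -> c2 t = b t by rewrite /c2; case: pselect.
have dS1 : rvdef G S1 by exact: rvdef_and.
have dS2 : rvdef G S2 by apply: rvdef_and => //; exact: rvdef_not.
have g1 : good G A c1.
  pose f1 t := \poly_(i < d) (f t)`_i.
  apply: (IH (ltnW dn) S1 b f1 r) => //; first by move=> t; exact: size_poly.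
  split=> //.
    split; first by exists d => t; exact: size_poly.
    move=> i; rewrite (_ : (fun t => _) = fun t => if (i < d)%N then (f t)`_i else 0).
      by case: ltnP => _; [case: hf => _; exact | exact: algebra_const].
    by apply/funext => t; rewrite coef_poly.
  move=> t St; rewrite c1E //; case: St => St at0; rewrite (_ : f1 t = f t); first exact: on.
  apply/polyP => i; rewrite coef_poly; case: ltnP => // di.
  have [->|ne] := eqVneq i d; first by rewrite -/(a t) at0.
  by rewrite (leq_sizeP _ _ (fd t)) //; lia.
have hr2 : root_on G A S2 b f r c2.
  by split=> // t St; rewrite c2E //; case: St => St _; exact: on.
have g2 : good G A c2.
  move=> h hh; have [[N hN] _] := hh.
  elim: N h hh hN => [|N IHN] h hh hN.
    rewrite (_ : (fun t => _) = fun _ => (0, 0)); first exact: rvfun_const.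
    by apply/funext => t; have := hN t; rewrite leqn0 size_poly_eq0 => /eqP->;
      rewrite horner0 rv0.
  have [Nd|dN] := ltnP N d.
    (* the remainder has smaller degree: apply the hypothesis to it *)
    have hpb : stable_tree (rv_extend (rv_extend G)) (pullback fst (pullback fst A))
        (fun z (_ : K) => z.1.2 = z.2).
      apply: stable_tree_base; apply: rvdef_rv_eq; last exact: rvfun_snd.
      exact: (rvfun_fst (rvfun_snd G)).
    have hh1 : polyfun (pullback fst A) (h \o (@fst T RV)).
      by apply: polyfun_comp hh => u; exact: pullback_mem.
    have := Pn _ _ _ _ _ (pullback_algebra (@fst T RV) algA) (pullback_tame tA) hh1 _ hpb.
    move=> /(_ (fun t => leq_trans (hN t.1) _)) hH.
    have {}hH : center_tree (rv_extend G) (pullback fst A) (fun z y => z.2 = rv (h z.1).[y]).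
      by apply: hH; lia.
    have d0 := rvdef_tree_root hH (pullback_algebra _ algA) (pullback_tame tA) (root_on_fst hr2).
    by apply: rvdef_eqv d0 => z /=; split=> ->.
  (* one step of the division of h by f *)
  pose l t := (h t)`_N.
  pose h2 t := (a t)%:P * h t - (l t)%:P * ('X^(N - d) * f t).
  have hh2 : polyfun A h2.
    apply: polyfunB => //; first by apply: polyfunM => //; exact: polyfunC.
    apply: polyfunM => //; first by apply: polyfunC => //; case: hh => _; exact.
    by apply: polyfunM => //; exact: polyfun_const.
  have h2N t : (size (h2 t) <= N)%N.
    apply/leq_sizeP => i Ni; rewrite coefB !coefCM coefXnM.
    have -> : (i < N - d)%N = false by lia.
    have [->|ne] := eqVneq i N.
      by rewrite (_ : N - (N - d) = d)%N ?/l ?/a 1?mulrC ?subrr //; lia.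
    rewrite (leq_sizeP _ _ (hN t)) ?(leq_sizeP _ _ (fd t)) ?mulr0 ?subrr //; lia.
  have d2 := IHN _ hh2 h2N.
  apply: (rvfun_if dS2 (rvfun_div d2 (tA _ Aa)) (tA _ (algebra_horner algA hh Ab))).
    move=> t St; have [_ r0 _ _] := root_onP hr2 St.
    rewrite /h2 hornerD hornerN !hornerM !hornerC r0 !mulr0 subr0 rv_divM //.
    by apply/eqP => at0; case: St.
  by move=> t St; rewrite c2N.
apply: (@good_cover _ _ A G 2 (fun k => if k == 0%N then S1 else ~` S1) c'
  (fun k => if k == 0%N then c1 else c2)).
- by move=> k; case: ifP => _ //; exact: rvdef_not.
- by move=> k _; case: ifP.
- move=> t; have [St|St] := pselect (S1 t); first by exists 0%N.
  by exists 1%N.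
- move=> [|k] t _ /= St; first by rewrite c1E.
  have [St2|St2] := pselect (S2 t); first by rewrite c2E.
  rewrite c2N // off // => St0; have [at0|at0] := pselect (a t = 0).
    by apply: St.
  by apply: St2.
Qed.

End RootsAreGood.

(** * Residue polynomials with parameters *)

Section ResiduePolynomials.
Variable F : fieldType.
Hypothesis char0 : [pchar F] =i pred0.
Local Notation K := (laurent F).
Local Notation RV := (RV F).

Lemma nderivn_all0 (Q : {poly F}) a : (forall k, Q^`N(k).[a] = 0) -> Q = 0.
Proof.
move=> Qa; apply/polyP => j; rewrite coef0 -nderivn_at0 -[X in _.[X]](subrr a).
rewrite (taylor_wide _ _ (leqnn _)) big1 // => k _.
by rewrite nderivn_nderivn hornerMn Qa mul0rn mul0r.
Qed.

(** A smaller order [m] would make all coefficients vanish. *)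
Lemma residue_uniq (p : {poly K}) c m m' g Q Q' :
  residue_poly p c m g Q -> Q != 0 -> residue_poly p c m' g Q' -> Q' != 0 ->
  m = m' /\ Q = Q'.
Proof.
suff le m1 m2 Q1 Q2 : residue_poly p c m1 g Q1 -> Q1 != 0 ->
    residue_poly p c m2 g Q2 -> m2 <= m1.
  move=> r1 n1 r2 n2; have e : m = m'.
    by apply/eqP; rewrite eq_le (le _ _ _ _ r1 n1 r2) (le _ _ _ _ r2 n2 r1).
  split=> //; apply/polyP => k; have [_ <-] := r1 k; have [_ <-] := r2 k.
  by rewrite e.
move=> r1 n1 r2; rewrite leNgt; apply/negP => lt.
case/eqP: n1; apply/polyP => k; rewrite coef0.
by have [_ <-] := r1 k; have [h _] := r2 k; apply: h; lia.
Qed.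

(** A root of multiplicity [e + 1] is a simple root of the derivative of order
    [e], to which Hensel's lemma and Newton's formula apply. *)
Lemma newton_root_exists (p : {poly K}) c m g Q a e : residue_poly p c m g Q -> a != 0 ->
  (forall k, (k <= e)%N -> Q^`N(k).[a] = 0) -> Q^`N(e.+1).[a] != 0 ->
  exists c', newton_root p^`N(e) c (a, g) c'.
Proof.
move=> res a0 Qk Qe; have rese := residue_nderivn e res.
have Q1 : (Q^`N(e))^`N(1).[a] != 0.
  rewrite nderivn_nderivn addn1 hornerMn binSn -mulr_natr mulf_neq0 //.
  by move/pcharf0P: char0 => ->.
have [c' pc' [cg ca]] := hensel rese (Qk e (leqnn e)) Q1.
exists c'; have rc : rv (c' - c) = (a, g) by exact: rvE.
split=> //.
  apply: contra_neq Q1 => p0.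
  have -> : Q^`N(e) = 0.
    apply/polyP => k; have [_ <-] := rese k.
    by rewrite p0 nderivn0 coef0 || rewrite p0 linear0 horner0 coef0.
  by rewrite linear0 horner0.
move=> u ru; have [ug ua] := rv_ord ru a0.
have := residue_shift rese ug; rewrite addrC subrK ua => resu.
apply: (newton_rv resu).
- by rewrite coef_taylor_poly.
- have := (rv_eqP (c' - c) a0 ru).1 rc.
  by rewrite opprB addrACA addNr addr0 || (rewrite (_ : c' - c - (u - c) = c' - u) //; ring).
- by rewrite addrC subrK.
Qed.

(** The multiplicity of [r.1] as a root of the residue polynomial at
    order [r.2] is at most [e]. *)
Definition multiplicity_le e (p : {poly K}) (c : K) (r : RV) : Prop :=
  r.1 != 0 -> forall m Q, residue_poly p c m r.2 Q -> Q != 0 ->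
  exists2 k, (k <= e)%N & Q^`N(k).[r.1] != 0.

Lemma multiplicity_le_size e (p : {poly K}) c r : (size p <= e)%N -> multiplicity_le e p c r.
Proof.
move=> pe r0 m Q res Q0; apply: contrapT => none.
case/eqP: Q0; apply: (@nderivn_all0 _ r.1) => k.
have [ke|ek] := leqP k e; last first.
  rewrite nderivn_poly0 ?horner0 //.
  exact: leq_trans (leq_trans (size_residue res) pe) (ltnW ek).
by apply/eqP; apply/negPn/negP => nz; apply: none; exists k.
Qed.

Section ResidueData.
Variables (T : Type) (G : set (T -> RV)) (n : nat).
Variables (p : T -> {poly K}) (c : T -> K) (r : T -> RV).
Hypothesis size_p : forall t, (size (p t) <= n)%N.
Hypothesis dp : forall k, rvfun G (fun t => rv (p t)^`N(k).[c t]).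
Hypothesis dr : rvfun G r.

Let f k t : K := (p t)^`N(k).[c t].
Let m k t : int := lorder (f k t) + k%:Z * (r t).2.
Let q k0 k t : F := if (f k t != 0) && (m k t == m k0 t) then lead (f k t) else 0.
Let Q k0 t : {poly F} := \poly_(k < n) q k0 k t.
Let M k0 t : Prop :=
  if (k0 < n)%N then f k0 t != 0 /\ forall k, (k < n)%N -> f k t = 0 \/ m k0 t <= m k t
  else forall k, (k < n)%N -> f k t = 0.

Lemma residue_min k0 t : (k0 < n)%N -> M k0 t ->
  residue_poly (p t) (c t) (m k0 t) (r t).2 (Q k0 t) /\ Q k0 t != 0.
Proof.
move=> k0n; rewrite /M k0n => -[f0 min]; split.
  move=> k; rewrite coef_poly; case: ltnP => kn; last first.
    by rewrite nderivn_poly0 ?horner0 // (leq_trans (size_p t)).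
  rewrite -/(f k t) /q; have [->|fk] := eqVneq (f k t) 0; first by [].
  have [fn fl] := lorderP fk.
  have mk : m k0 t <= m k t by case: (min k kn) => // fk0; rewrite fk0 eqxx in fk.
  split; first by apply: ord_geW fn; rewrite /m in mk *; lia.
  rewrite /= eq_sym; case: eqP => e.
    by rewrite /lead; congr (lcoef _ _); rewrite /m in e *; lia.
  by apply: fn; rewrite /m in mk e *; lia.
apply/eqP => Q0; have : (Q k0 t)`_k0 = 0 by rewrite Q0 coef0.
by rewrite coef_poly k0n /q f0 eqxx => /eqP; rewrite lead_eq0 (negPf f0).
Qed.

(** A coefficient dominates if it minimizes [m]; the index [n] stands for the
    case where all coefficients vanish. *)
Lemma residue_min_cover t : exists2 k0, (k0 < n.+1)%N & M k0 t.
Proof.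
have [[k kn fk]|none] := pselect (exists2 k, (k < n)%N & f k t != 0); last first.
  exists n => //; rewrite /M ltnn => k kn.
  by apply/eqP; apply/negPn/negP => nz; apply: none; exists k.
pose o (i : 'I_n) : int := m i t.
have [i fi imin] := @Order.TotalTheory.arg_minP _ _ _ (Ordinal kn) (fun i => f i t != 0) o fk.
exists i; first exact: leq_trans (ltn_ord i) (leqnSn n).
rewrite /M ltn_ord; split=> // j jn; have [->|fj] := eqVneq (f j t) 0; first by left.
by right; exact: (imin (Ordinal jn) fj).
Qed.

Lemma orderfun_m k : orderfun G (m k).
Proof.
exact: (orderfun2 (fun x y => x + k%:Z * y) (orderfun_snd (dp k)) (orderfun_snd dr)).
Qed.

Lemma rvdef_f0 k : rvdef G [set t | f k t = 0].
Proof.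
apply: rvdef_eqv (rvdef_lead0 (leadfun_fst (dp k))) => t /=.
by split=> [/rv_eq0//|]; rewrite -/(f k t) => ->; rewrite lead0.
Qed.

Lemma rvdef_fn0 k : rvdef G [set t | f k t != 0].
Proof.
by apply: rvdef_eqv (rvdef_not (rvdef_f0 k)) => t; rewrite /setC /=; split=> /eqP.
Qed.

Lemma rvdef_M k0 : rvdef G (M k0).
Proof.
have d k : rvdef G [set t | f k t = 0 \/ m k0 t <= m k t].
  exact: (rvdef_or (rvdef_f0 k)
    (rvdef_order (fun x y => x <= y) (orderfun_m k0) (orderfun_m k))).
have [k0n|k0n] := boolP (k0 < n)%N.
  by apply: rvdef_eqv (rvdef_and (rvdef_fn0 k0) (rvdef_all n d)) => t; rewrite /M k0n.
by apply: rvdef_eqv (rvdef_all n rvdef_f0) => t; rewrite /M (negPf k0n).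
Qed.

Lemma leadfun_q k0 k : leadfun G (q k0 k).
Proof.
have d : rvdef G [set t | (f k t != 0) && (m k t == m k0 t)].
  have de : rvdef G [set t | m k t = m k0 t].
    exact: (rvdef_order (fun x y => x = y) (orderfun_m k) (orderfun_m k0)).
  apply: rvdef_eqv (rvdef_and (rvdef_fn0 k) de) => t; rewrite /setI /=.
  by split=> [[-> ->]|/andP[? /eqP]] //; rewrite eqxx.
apply: (leadfun_if d (leadfun_fst (dp k)) (leadfun_const _ 0)) => t /=.
  by rewrite /q => ->.
by rewrite /q => /negP/negPf ->.
Qed.

Lemma leadfun_Q k0 j : leadfun G (fun t => (Q k0 t)^`N(j).[(r t).1]).
Proof.
pose q' i : T -> F := if (i < n)%N then q k0 i else fun _ => 0.
have dq' i : leadfun G (q' i).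
  by rewrite /q'; case: ifP => _; [exact: leadfun_q | exact: leadfun_const].
pose term k t := q' (j + k)%N t *+ 'C(j + k, j) * (r t).1 ^+ k.
have dterm k : leadfun G (term k).
  by apply: leadfunM; [exact: leadfunMn | exact/leadfunX/leadfun_fst].
rewrite (_ : (fun t => _) = fun t => \sum_(k < n) term k t).
  exact: leadfun_sum.
apply/funext => t; rewrite (@horner_coef_wide _ n).
  apply: eq_bigr => k _; rewrite coef_nderivn coef_poly /term /q'.
  by case: ifP.
apply/leq_sizeP => i ni; rewrite coef_nderivn coef_poly.
by rewrite ifN ?mul0rn //; lia.
Qed.

(** The residue polynomial is determined by the index [k] of a dominating Taylor
    coefficient, and the condition that [k] dominates is definable. Hence its
    values and its multiplicities are definable, and so is the leading term of
    [p y] where it does not vanish. *)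
Lemma residue_data : exists (k : T -> nat) (mm : T -> int) (QQ : T -> {poly F})
    (comp : T -> RV),
  [/\ forall t, (k t < n)%N -> residue_poly (p t) (c t) (mm t) (r t).2 (QQ t) /\ QQ t != 0,
    forall t, ~ (k t < n)%N -> forall j, (p t)^`N(j).[c t] = 0,
    forall e, rvdef G [set t | [/\ (k t < n)%N, (r t).1 != 0,
      forall j, (j < e.+1)%N -> (QQ t)^`N(j).[(r t).1] = 0 &
      (QQ t)^`N(e.+1).[(r t).1] != 0]],
    rvfun G comp &
    forall t y, rv (y - c t) = r t ->
      ((r t).1 != 0 -> (k t < n)%N -> (QQ t).[(r t).1] != 0) ->
      rv (p t).[y] = comp t].
Proof.
have [k [kN Mk dk]] := rvdef_choose rvdef_M residue_min_cover.
pose mm t := m (k t) t; pose QQ t := Q (k t) t.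
pose comp t : RV := if (r t).1 == 0 then rv (f 0 t) else
  if (k t < n)%N then ((QQ t).[(r t).1], mm t) else (0, 0).
have dk' : rvdef G [set t | (k t < n)%N].
  apply: rvdef_eqv (rvdef_some n dk) => t /=; split=> [[j jn ->]//|h].
  by exists (k t).
have dQQ j : leadfun G (fun t => (QQ t)^`N(j).[(r t).1]).
  apply: (@rvdef_cover _ _ _ n.+1 (fun i z => k z.1 = i) _
    (fun i z => (Q i z.1)^`N(j).[(r z.1).1] = z.2.1)).
  - by move=> i; exact: (rvdef_fst (dk i)).
  - by move=> i _; exact: leadfun_Q.
  - by move=> z; exists (k z.1).
  - by move=> i z _ <-.
exists k, mm, QQ, comp; split.
- by move=> t kt; exact: residue_min.
- move=> t kt j; have := Mk t; rewrite /M ifN; last exact/negP.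
  move=> f0; have [/f0 //|nj] := ltnP j n.
  by rewrite nderivn_poly0 ?horner0 // (leq_trans (size_p t)).
- move=> e; apply: rvdef_eqv (rvdef_and dk' (rvdef_and
    (rvdef_lead_neq0 (leadfun_fst dr)) (rvdef_and
    (rvdef_all e.+1 (fun j => rvdef_lead0 (dQQ j)))
    (rvdef_lead_neq0 (dQQ e.+1))))) => t.
  by rewrite /setI /=; split=> [[? [? []]]|[]].
- apply: rvfun_ifb.
  + apply: rvdef_eqv (rvdef_lead0 (leadfun_fst dr)) => t /=.
    by split=> [->|/eqP].
  + exact: dp.
  + apply: rvfun_ifb => //; last exact: rvfun_const.
    apply: rvfun_pair; first by have := dQQ 0%N; rewrite /=; under eq_fun do rewrite nderivn0.
    apply: (@rvdef_cover _ _ _ n.+1 (fun i z => k z.1 = i) _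
      (fun i z => m i z.1 = z.2.2)).
    * by move=> i; exact: (rvdef_fst (dk i)).
    * by move=> i _; exact: orderfun_m.
    * by move=> z; exists (k z.1).
    * by move=> i z _ <-.
- move=> t y ry h; rewrite /comp; have [r0|r0] := eqVneq (r t).1 0.
    have /subr0_eq -> : y - c t = 0 by apply: rv_eq0; rewrite ry.
    by rewrite /f nderivn0.
  case: ifP => kt.
    have [res Q0] := residue_min kt (Mk t).
    rewrite -(subrK (c t) y) addrC.
    apply: (residue_rv res _ r0 (h r0 kt)).
    by rewrite ry -surjective_pairing.
  have := Mk t; rewrite /M kt => f0.
  rewrite -(subrK (c t) y) addrC (taylor_wide _ _ (size_p t)) big1 ?rv0 // => i _.
  by rewrite -/(f i t) f0 ?mul0r.
Qed.

End ResidueData.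

End ResiduePolynomials.

(** * Elimination of a quantifier over the field *)

Section EliminationTheorem.
Variable F : fieldType.
Hypothesis char0 : [pchar F] =i pred0.
Local Notation K := (laurent F).
Local Notation RV := (RV F).

Section Step.
Variables (T : Type) (G : set (T -> RV)) (A : set (T -> K)) (n : nat)
  (f : T -> {poly K}) (c : T -> K).
Hypotheses (algA : function_algebra A) (tA : tame G A) (hf : polyfun A f)
  (size_f : forall t, (size (f t) <= n)%N) (gc : good G A c).

Let p (z : T * RV) := f z.1.
Let cz (z : T * RV) := c z.1.

Let dp k : rvfun (rv_extend G) (fun z => rv (p z)^`N(k).[cz z]).
Proof. exact: (rvfun_fst (gc (polyfun_nderivn algA k hf))). Qed.

Lemma eval_simple_residue : exists2 comp : T * RV -> RV, rvfun (rv_extend G) comp &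
  forall t y, multiplicity_le 0 (f t) (c t) (rv (y - c t)) ->
    rv (f t).[y] = comp (t, rv (y - c t)).
Proof.
have [k [mm [QQ [comp [h1 h2 h3 h4 h5]]]]] :=
  residue_data (fun z => size_f z.1) dp (rvfun_snd G).
exists comp => // t y mult; apply: (h5 (t, rv (y - c t))) => //= r0 kt.
have [res Q0] := h1 _ kt.
by have [j] := mult r0 _ _ res Q0; rewrite leqn0 => /eqP ->; rewrite nderivn0.
Qed.

(** The new center is a Hensel root of the derivative selected by the
    multiplicity, or [c] itself where the multiplicity is already small. *)
Lemma better_center e : good_roots F n -> exists2 c' : T * RV -> K,
  good (rv_extend G) (pullback fst (adjoin A c)) c' &
  forall t y, multiplicity_le e.+1 (f t) (c t) (rv (y - c t)) ->
    multiplicity_le e (f t) (c' (t, rv (y - c t))) (rv (y - c' (t, rv (y - c t)))).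
Proof.
move=> roots.
have algA1 := adjoin_algebra algA c; have tA1 := good_tame gc.
have algA2 := pullback_algebra (@fst T RV) algA1; have tA2 := pullback_tame tA1.
have [k [mm [QQ [comp [h1 h2 h3 h4 h5]]]]] :=
  residue_data (fun z => size_f z.1) dp (rvfun_snd G).
pose S0 j (z : T * RV) := [/\ (k z < n)%N, z.2.1 != 0,
  forall i, (i < j.+1)%N -> (QQ z)^`N(i).[z.2.1] = 0 & (QQ z)^`N(j.+1).[z.2.1] != 0].
have dS0 j : rvdef (rv_extend G) (S0 j) by exact: h3.
have rootS j z : S0 j z -> exists c', newton_root (p z)^`N(j) (cz z) z.2 c'.
  move=> [kz r0 Q0 Q1]; have [res _] := h1 _ kz.
  rewrite [z.2]surjective_pairing.
  exact: (newton_root_exists char0 res r0 Q0 Q1).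
pose root j z := if pselect (S0 j z) is left h then sval (cid (rootS j z h)) else cz z.
have rootP j z : S0 j z -> newton_root (p z)^`N(j) (cz z) z.2 (root j z).
  by rewrite /root; case: pselect => // h _; case: cid.
have rootN j z : ~ S0 j z -> root j z = cz z by rewrite /root; case: pselect.
have Acz : pullback fst (adjoin A c) cz by apply: pullback_mem; exact: adjoin_gen.
have hp : polyfun (pullback fst (adjoin A c)) p.
  by apply: polyfun_comp hf => u Au; apply: pullback_mem; exact: adjoin_incl.
have groot j : good (rv_extend G) (pullback fst (adjoin A c)) (root j).
  apply: (roots _ _ _ (S0 j) cz (fun z => (p z)^`N(j)) snd) => //.
    move=> z; apply/leq_sizeP => i ni; rewrite coef_nderivn.
    by rewrite (leq_sizeP _ _ (size_f z.1)) ?mul0rn //; lia.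
  split=> //; first exact: polyfun_nderivn.
  - exact: rvfun_snd.
  - by move=> z; exact: rootP.
  - by move=> z; exact: rootN.
pose N j z := if (j < e.+1)%N then S0 j z else forall i, (i < e.+1)%N -> ~ S0 i z.
have dN l : rvdef (rv_extend G) (N l).
  have [le|le] := boolP (l < e.+1)%N.
    by apply: rvdef_eqv (dS0 l) => z; rewrite /N le.
  apply: rvdef_eqv (rvdef_all e.+1 (fun i => rvdef_not (dS0 i))) => z.
  by rewrite /N (negPf le).
have covN z : exists2 j, (j < e.+2)%N & N j z.
  have [[j je Sj]|none] := pselect (exists2 j, (j < e.+1)%N & S0 j z).
    by exists j; [exact: leqW | rewrite /N je].
  exists e.+1 => //; rewrite /N ltnn => i ie Si.
  by apply: none; exists i.
have [i [iN Ni di]] := rvdef_choose dN covN.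
pose c' z := if (i z < e.+1)%N then root (i z) z else cz z.
exists c'.
  apply: (@good_cover _ _ _ _ e.+2 (fun j z => i z = j) c'
    (fun j => if (j < e.+1)%N then root j else cz)) => //.
  - by move=> j _; case: ifP => _ //; exact: good_mem.
  - by move=> z; exists (i z).
  - by move=> j z _ ij; rewrite /c' ij; case: ifP.
move=> t y mult; set z := (t, rv (y - c t)).
have := Ni z; rewrite /N /c'; case: ltnP => [ie Si|ie none].
  have [_ rp rc _] := rootP _ _ Si; have [kz r0 Q0 Q1] := Si.
  have [res _] := h1 _ kz.
  move=> b0 m' R res' R0.
  have rz : rv (y - c t) = (z.2.1, z.2.2) by rewrite /z -surjective_pairing.
  have [cg ca] := rv_ord (etrans rc (surjective_pairing _)) r0.
  have gt : z.2.2 < lorder (y - root (i z) z).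
    have rc' : rv (root (i z) z - c t) = (z.2.1, z.2.2) by rewrite -surjective_pairing.
    have := (rv_eqP (y - c t) r0 rc').1 rz.
    rewrite (_ : y - c t - _ = y - root (i z) z); last by ring.
    case/ord_geP => [y0|]; last by lia.
    by move: b0; rewrite y0 rv0 /= eqxx.
  have [j ji Rj] := recenter char0 res Q0 Q1 rp cg ca gt res' R0 b0.
  by exists j => //; lia.
move=> r0 m Q res Q0.
have kz : (k z < n)%N.
  apply/negPn/negP => /negP kz; case/eqP: Q0; apply/polyP => j.
  by have [_ <-] := res j; rewrite (h2 _ kz) coef0.
have [res' Q0'] := h1 _ kz.
have [_ eQ] := residue_uniq res Q0 res' Q0'.
have ex : exists j, Q^`N(j).[z.2.1] != 0.
  by have [j _ Qj] := mult r0 m Q res Q0; exists j.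
case: (ex_minnP ex) => j Qj jmin.
have je1 : (j <= e.+1)%N.
  by have [j' j'e Qj'] := mult r0 m Q res Q0; exact: leq_trans (jmin _ Qj') j'e.
have [je|ej] := leqP j e; first by exists j.
have je : j = e.+1 by lia.
case: (none e) => //; split=> // [l le|]; last by rewrite -eQ -je.
rewrite -eQ; apply/eqP/negPn/negP => /jmin; lia.
Qed.

End Step.

(** By induction on [e]: where the multiplicity vanishes one reads the leading
    term off [y - c], and otherwise one more center lowers the multiplicity. *)
Lemma stable_tree_center e : forall n, good_roots F n -> forall T (G : set (T -> RV)) A
    (f : T -> {poly K}) c S, function_algebra A -> tame G A -> polyfun A f ->
  (forall t, (size (f t) <= n)%N) -> good G A c ->
  stable_tree (rv_extend G) (pullback fst A) S ->
  exists2 S' : T -> K -> Prop, center_tree G A S' &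
    forall t y, multiplicity_le e (f t) (c t) (rv (y - c t)) ->
      (S' t y <-> S (t, rv (f t).[y]) y).
Proof.
elim: e => [|e IH] n roots T G A f c S algA tA hf fn gc hS.
  have [comp dcomp compE] := eval_simple_residue algA hf fn gc.
  exists (fun t y => S (t, comp (t, rv (y - c t))) y); last first.
    by move=> t y mult; rewrite -compE.
  apply: (tree_step (S := fun z y => S (z.1, comp z) y) gc).
  apply: (hS _ _ _ (fun z => (z.1, comp z))).
  - exact/pullback_algebra/adjoin_algebra.
  - exact/pullback_tame/good_tame.
  - move=> _ [u Au ->]; exact: (pullback_mem _ (adjoin_incl algA c Au)).
  - move=> g [->|[g' Gg' ->]]; first exact: dcomp.
    exact: (rvfun_fst (rvfun_gen Gg')).
have [c' gc' cE] := better_center algA hf fn gc e roots.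
have algA1 := adjoin_algebra algA c; have tA1 := good_tame gc.
have algA2 := pullback_algebra (@fst T RV) algA1; have tA2 := pullback_tame tA1.
have hf2 : polyfun (pullback fst (adjoin A c)) (f \o (@fst T RV)).
  by apply: polyfun_comp hf => u Au; apply: pullback_mem; exact: adjoin_incl.
have hS2 := stable_tree_extend (fun u Au => pullback_mem (@fst T RV) (adjoin_incl algA c Au))
  (fun g Gg => rvfun_fst (rvfun_gen Gg)) hS.
have [S' HS' S'E] := IH n roots _ _ _ _ c' _ algA2 tA2 hf2 (fun z => fn z.1) gc' hS2.
exists (fun t y => S' (t, rv (y - c t)) y); first exact: tree_step gc HS'.
move=> t y mult; apply: (S'E (t, rv (y - c t))); exact: cE.
Qed.

Lemma computable_poly_all n : computable_poly F n.
Proof.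
elim: n => [|n IH] T G A f S algA tA hf fn hS.
  rewrite (_ : (fun t y => _) = fun t y => S (t, (0, 0)) y); last first.
    apply/funext => t; apply/funext => y.
    by have := fn t; rewrite leqn0 size_poly_eq0 => /eqP ->; rewrite horner0 rv0.
  apply: (hS _ _ _ (fun t => (t, (0, 0)))) => //.
    by move=> _ [u Au ->].
  move=> g [->|[g' Gg' ->]]; first exact: rvfun_const.
  exact: rvfun_gen.
have roots := good_roots_of_computable IH.
have g0 : good G A (fun _ => 0) by apply: good_mem => //; exact: algebra_const.
have [S' HS' S'E] := stable_tree_center n.+1 roots algA tA hf fn g0 hS.
rewrite (_ : (fun t y => _) = S') //.
apply/funext => t; apply/funext => y; apply/propext; apply: iff_sym.
by apply: S'E; exact: multiplicity_le_size.
Qed.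

Lemma stable_tree_horner T (G : set (T -> RV)) A (f : T -> {poly K}) S : polyfun A f ->
  stable_tree (rv_extend G) (pullback fst A) S ->
  stable_tree G A (fun t y => S (t, rv (f t).[y]) y).
Proof.
move=> hf hS T' G' A' g algA' tA' gA gG.
have hf' : polyfun A' (f \o g) by exact: polyfun_comp hf.
have [[n fn] _] := hf.
exact: (computable_poly_all algA' tA' hf' (fun t => fn (g t)) (stable_tree_extend gA gG hS)).
Qed.

Definition field_extend T (G : set (T -> RV)) (A : set (T -> K)) : set (T * K -> RV) :=
  [set r | (exists2 g, G g & r = g \o fst) \/
    exists2 f, polyfun A f & r = fun z => rv (f z.1).[z.2]].

(** Read the leading terms of all polynomials in [y] that occur, one after the
    other. *)
Theorem rvdef_field_ex T (G : set (T -> RV)) A S : function_algebra A -> tame G A ->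
  rvdef (field_extend G A) S -> rvdef G [set t | exists y, S (t, y)].
Proof.
move=> algA tA [N [u [uG /based_values[V bV eV]]]].
suff hp : stable_tree G A (fun t y => S (t, y)).
  have d := rvdef_tree_ex (tree_of_stable algA tA hp) algA tA.
  have := d 0%N (fun _ _ => 0) (fun _ _ => (0, 0)).
  move=> /(_ ltac:(done) ltac:(done)); apply: rvdef_eqv => t /=.
  by split=> [[y _ Sy]|[y Sy]]; exists y.
suff main M : (M <= N)%N -> forall (T : Type) (G : set (T -> RV)) (A : set (T -> K))
    (b : nat -> bool) (w : nat -> T -> RV) (f : nat -> T -> {poly K}),
    (forall i, (i < N)%N -> if b i && (i < M)%N then polyfun A (f i) else rvfun G (w i)) ->
    stable_tree G A (fun t y => V (fun i => if b i && (i < M)%N then rv (f i t).[y] else w i t)).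
  have wit i : exists (x : bool * (T -> RV) * (T -> {poly K})), (i < N)%N ->
      (if x.1.1 then polyfun A x.2 else rvfun G x.1.2) /\
      forall t y, u i (t, y) = if x.1.1 then rv (x.2 t).[y] else x.1.2 t.
    have [iN|Ni] := ltnP i N; last by exists (true, (fun _ => (0, 0)), fun _ => 0).
    case: (uG i iN) => [[g Gg ui]|[f hf ui]].
      exists (false, g, fun _ => 0) => _ /=; split; first exact: rvfun_gen.
      by move=> t y; rewrite ui.
    exists (true, (fun _ => (0, 0)), f) => _ /=; split=> // t y; by rewrite ui.
  pose x i := sval (cid (wit i)).
  have xP i : (i < N)%N -> (if (x i).1.1 then polyfun A (x i).2 else rvfun G (x i).1.2) /\
      forall t y, u i (t, y) = if (x i).1.1 then rv ((x i).2 t).[y] else (x i).1.2 t.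
    by rewrite /x; case: cid.
  have := main N (leqnn N) T G A (fun i => (x i).1.1) (fun i => (x i).1.2) (fun i => (x i).2).
  have cond i : (i < N)%N -> if (x i).1.1 && (i < N)%N then polyfun A (x i).2
      else rvfun G (x i).1.2 by move=> iN; rewrite iN andbT; case: (xP i iN).
  move=> /(_ cond).
  rewrite (_ : (fun t y => _) = fun t y => S (t, y)) //.
  apply/funext => t; apply/funext => y; apply/propext.
  apply: iff_trans (iff_sym (eV _)); apply: (based_local bV) => i iN.
  by rewrite iN andbT; have [_ ->] := xP i iN.
elim: M => [|M IH] MN {}T {}G {}A b w f {algA tA u uG eV S} cond.
  rewrite (_ : (fun t y => _) = fun t (_ : K) => V (fun i => w i t)).
    apply: stable_tree_base; apply: rvdef_values bV _ => i iN.
    by have := cond i iN; rewrite andbF.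
  apply/funext => t; apply/funext => y; congr V; apply/funext => i.
  by rewrite andbF.
have condM i : (i < N)%N -> i != M -> if b i && (i < M)%N then polyfun A (f i)
    else rvfun G (w i).
  by move=> iN iM; have := cond i iN; rewrite ltnS leq_eqVlt (negPf iM).
have [bM|bM] := boolP (b M); last first.
  have := IH (ltnW MN) T G A b w f; rewrite (_ : (fun t y => _) = (fun t y => V
      (fun i => if b i && (i < M.+1)%N then rv (f i t).[y] else w i t))).
    apply=> i iN; have [->|] := eqVneq i M; last exact: condM.
    by have := cond M MN; rewrite (negPf bM).
  apply/funext => t; apply/funext => y; congr V; apply/funext => i.
  by rewrite ltnS (leq_eqVlt i M); case: eqP => [->|//]; rewrite (negPf bM).
have hfM : polyfun A (f M) by have := cond M MN; rewrite bM ltnSn.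
pose w' i : T * RV -> RV := if i == M then snd else w i \o fst.
have := IH (ltnW MN) _ (rv_extend G) (pullback fst A) b w' (fun i => f i \o fst).
move=> /(_ _)/(stable_tree_horner hfM).
rewrite (_ : (fun t y => _) = (fun t y => V
      (fun i => if b i && (i < M.+1)%N then rv (f i t).[y] else w i t))); last first.
  apply/funext => t; apply/funext => y; congr V; apply/funext => i.
  rewrite /= /w' ltnS (leq_eqVlt i M); case: eqP => [->|_] //=.
  by rewrite ltnn andbF bM.
apply=> i iN; rewrite /w'; case: eqP => [->|/eqP iM].
  by rewrite ltnn andbF; exact: rvfun_snd.
have := condM i iN iM; case: ifP => _ h; last exact: rvfun_fst.
by apply: polyfun_comp h => u; exact: pullback_mem.
Qed.

End EliminationTheorem.

(** * First-order definable sets *)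

Section FirstOrder.
Variable F : fieldType.
Hypothesis char0 : [pchar F] =i pred0.
Local Notation K := (laurent F).
Local Notation RV := (RV F).

Definition poly_algebra T (A : set (T -> K)) : set (T * K -> K) :=
  [set u | exists2 f, polyfun A f & u = fun z => (f z.1).[z.2]].

Lemma poly_algebraP T (A : set (T -> K)) : function_algebra A ->
  function_algebra (poly_algebra A).
Proof.
move=> algA; split=> [x|_ _ [P hP ->] [Q hQ ->]|_ _ [P hP ->] [Q hQ ->]].
- exists (fun _ => x%:P); first exact: polyfun_const.
  by apply/funext => z; rewrite hornerC.
- exists (fun t => P t + Q t); first exact: polyfunD.
  by apply/funext => z; rewrite hornerD.
- exists (fun t => P t * Q t); first exact: polyfunM.
  by apply/funext => z; rewrite hornerM.
Qed.

Lemma poly_algebra_tame T (G : set (T -> RV)) A : tame (field_extend G A) (poly_algebra A).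
Proof. by move=> _ [f hf ->]; apply: rvfun_gen; right; exists f. Qed.

Lemma poly_algebra_fst T (A : set (T -> K)) u : function_algebra A -> A u ->
  poly_algebra A (u \o fst).
Proof.
move=> algA Au; exists (fun t => (u t)%:P); first exact: polyfunC.
by apply/funext => z; rewrite hornerC.
Qed.

Lemma poly_algebra_snd T (A : set (T -> K)) : function_algebra A -> poly_algebra A snd.
Proof.
move=> algA; exists (fun _ => 'X); first exact: polyfun_const.
by apply/funext => z; rewrite hornerX.
Qed.

Lemma algebra_eval T (A : set (T -> K)) (E : T -> seq K) u : function_algebra A ->
  (forall i, A (fun t => (E t)`_i)) -> GRing.rterm u -> A (fun t => GRing.eval (E t) u).
Proof.
move=> algA EA; elim: u => //=.
- by move=> x _; exact: algebra_const.
- by move=> x _; exact: algebra_const.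
- by move=> u1 IH1 u2 IH2 /andP[r1 r2]; apply: algebraD; [| exact: IH1 | exact: IH2].
- by move=> u1 IH1 r1; apply: algebraN => //; exact: IH1.
- by move=> u1 IH1 n r1; apply: algebraMn => //; exact: IH1.
- by move=> u1 IH1 u2 IH2 /andP[r1 r2]; apply: algebraM; [| exact: IH1 | exact: IH2].
- by move=> u1 IH1 n r1; apply: algebraX => //; exact: IH1.
Qed.

(** Quantifier elimination for the field of Laurent series, relative to leading
    terms. *)
Theorem rvdef_holds f : GRing.rformula f -> forall T (G : set (T -> RV)) A (E : T -> seq K),
  function_algebra A -> tame G A -> (forall i, A (fun t => (E t)`_i)) ->
  rvdef G [set t | GRing.holds (E t) f].
Proof.
have ex i f1 : (forall T (G : set (T -> RV)) A (E : T -> seq K),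
      function_algebra A -> tame G A -> (forall i, A (fun t => (E t)`_i)) ->
      rvdef G [set t | GRing.holds (E t) f1]) ->
    forall T (G : set (T -> RV)) A (E : T -> seq K),
      function_algebra A -> tame G A -> (forall i, A (fun t => (E t)`_i)) ->
      rvdef G [set t | exists x, GRing.holds (set_nth 0 (E t) i x) f1].
  move=> IH T G A E algA tA EA.
  apply: (rvdef_field_ex char0 (S := fun z => GRing.holds (set_nth 0 (E z.1) i z.2) f1) algA tA).
  apply: IH (poly_algebraP algA) (@poly_algebra_tame _ _ _) _ => j.
  rewrite (_ : (fun t => _) = if j == i then snd else (fun t => (E t)`_j) \o fst).
    by case: eqP => _; [exact: poly_algebra_snd | exact: poly_algebra_fst].
  by apply/funext => z; rewrite nth_set_nth /=; case: eqP.
elim: f => //=.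
- by move=> b _ T G A E *; exact: rvdef_const.
- move=> u1 u2 /andP[r1 r2] T G A E algA tA EA.
  have d : rvfun G (fun t => rv (GRing.eval (E t) u1 - GRing.eval (E t) u2)).
    by apply: (tA _ (algebraB algA (algebra_eval algA EA r1) (algebra_eval algA EA r2))).
  apply: rvdef_eqv (rvdef_lead0 (leadfun_fst d)) => t.
  rewrite /mkset; split=> [h|->]; last by rewrite subrr rv0.
  by apply/subr0_eq/rv_eq0.
- move=> f1 IH1 f2 IH2 /andP[r1 r2] T G A E algA tA EA.
  exact: (rvdef_and (IH1 r1 _ _ _ _ algA tA EA) (IH2 r2 _ _ _ _ algA tA EA)).
- move=> f1 IH1 f2 IH2 /andP[r1 r2] T G A E algA tA EA.
  exact: (rvdef_or (IH1 r1 _ _ _ _ algA tA EA) (IH2 r2 _ _ _ _ algA tA EA)).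
- move=> f1 IH1 f2 IH2 /andP[r1 r2] T G A E algA tA EA.
  exact: (rvdef_imp (IH1 r1 _ _ _ _ algA tA EA) (IH2 r2 _ _ _ _ algA tA EA)).
- move=> f1 IH1 r1 T G A E algA tA EA.
  exact: (rvdef_not (IH1 r1 _ _ _ _ algA tA EA)).
- by move=> i f1 IH1 r1; apply: ex; exact: IH1.
- move=> i f1 IH1 r1 T G A E algA tA EA.
  have h := ex i (GRing.Not f1) (fun T G A E a b c => rvdef_not (IH1 r1 T G A E a b c)).
  apply: rvdef_eqv (rvdef_not (h _ _ _ _ algA tA EA)) => t; rewrite /setC /=.
  by split=> [no x|al [x]]; [apply: contrapT => nx; apply: no; exists x | apply].
Qed.

(** The conditions [W] on single coordinates are not first-order: they will
    compare digits of the coordinates with points of the residue field. *)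
Lemma rvdef_block n : forall T (G : set (T -> RV)) A (E : T -> seq K) N f
    (W : nat -> T -> K -> Prop), GRing.rformula f ->
  function_algebra A -> tame G A -> (forall t, size (E t) = N) ->
  (forall i, A (fun t => (E t)`_i)) ->
  (forall i, rvdef (field_extend G A) [set z | W i z.1 z.2]) ->
  rvdef G [set t | exists ys, [/\ size ys = n, GRing.holds (E t ++ ys) f &
    forall i, (i < n)%N -> W i t ys`_i]].
Proof.
elim: n => [|n IH] T G A E N f W rf algA tA EN EA dW.
  apply: rvdef_eqv (rvdef_holds rf algA tA EA) => t /=.
  split=> [h|[ys [/size0nil-> ]]]; last by rewrite cats0.
  by exists [::]; rewrite cats0.
have algA1 := poly_algebraP algA; have tA1 := @poly_algebra_tame T G A.
pose E1 (z : T * K) := rcons (E z.1) z.2.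
pose W1 i (z : T * K) y := W i.+1 z.1 y.
have E1A i : poly_algebra A (fun z => (E1 z)`_i).
  rewrite (_ : (fun z => _) = if (i < N)%N then (fun t => (E t)`_i) \o fst
      else if i == N then snd else fun _ => 0).
    case: ifP => _; first exact: poly_algebra_fst.
    by case: eqP => _; [exact: poly_algebra_snd | exact: algebra_const].
  by apply/funext => z; rewrite /E1 nth_rcons EN; case: ltnP => // _; case: eqP.
have dW1 i : rvdef (field_extend (field_extend G A) (poly_algebra A))
    [set z | W1 i z.1 z.2].
  apply: (rvdef_pull (f := fun z => (z.1.1, z.2)) _ (dW i.+1)) => r.
  case=> [[g Gg ->]|[h hh ->]].
    by left; exists (g \o fst) => //; left; exists g.
  right; exists (h \o fst) => //; apply: polyfun_comp hh => u.
  exact: poly_algebra_fst.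
have E1N z : size (E1 z) = N.+1 by rewrite size_rcons EN.
have d := rvdef_and (dW 0%N) (IH _ _ _ E1 N.+1 f W1 rf algA1 tA1 E1N E1A dW1).
apply: rvdef_eqv (rvdef_field_ex char0 algA tA d) => t; rewrite /setI /=.
split=> [[y [W0 [ys [sy h Wy]]]]|[ys [+ + +]]].
  exists (y :: ys); split=> //=; first by rewrite sy.
    by rewrite -cat_rcons.
  by move=> [|i] i_n; [exact: W0 | exact: Wy].
case: ys => [//|y ys] [sy] h Wy.
exists y; split; first exact: (Wy 0%N).
by exists ys; split=> //; [rewrite /E1 cat_rcons | move=> i i_n; exact: (Wy i.+1)].
Qed.

End FirstOrder.

(** * Stability of the residue field *)

Section DoubleLimits.
Variable (U : set_system nat).
Hypothesis ultraU : UltraFilter U.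
Let properU : ProperFilter U. Proof. exact: ultra_proper. Qed.
Let nonempty : ~ U set0. Proof. exact: filter_not_empty. Qed.

(** Grothendieck's criterion for stability. *)
Definition limits_commute (R : nat -> nat -> Prop) : Prop :=
  U [set i | U [set j | R i j]] <-> U [set j | U [set i | R i j]].

Lemma ultra_not (P : set nat) : U [set i | ~ P i] <-> ~ U P.
Proof.
split=> [h1 h2|h]; last by have [] := in_ultra_setVsetC P ultraU.
have e : [set i | ~ P i] `&` P = set0 by apply/seteqP; split=> // i [].
by apply: nonempty; rewrite -e; exact: filterI.
Qed.

Lemma ultra_and (P Q : set nat) : U [set i | P i /\ Q i] <-> U P /\ U Q.
Proof.
split=> [h|[h1 h2]]; last exact: filterI.
by split; apply: filterS h => i [].
Qed.

Lemma commute_eqv R R' : (forall i j, R i j <-> R' i j) ->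
  limits_commute R -> limits_commute R'.
Proof.
by move=> e; rewrite (_ : R = R') //; apply/funext => i; apply/funext => j; exact/propext.
Qed.

Lemma commute_not R : limits_commute R -> limits_commute (fun i j => ~ R i j).
Proof.
move=> c; rewrite /limits_commute.
have -> : [set i | U [set j | ~ R i j]] = [set i | ~ U [set j | R i j]].
  by apply/seteqP; split=> i /=; rewrite ultra_not.
have -> : [set j | U [set i | ~ R i j]] = [set j | ~ U [set i | R i j]].
  by apply/seteqP; split=> i /=; rewrite ultra_not.
by rewrite !ultra_not; move: c; rewrite /limits_commute; tauto.
Qed.

Lemma commute_and R1 R2 : limits_commute R1 -> limits_commute R2 ->
  limits_commute (fun i j => R1 i j /\ R2 i j).
Proof.
move=> c1 c2; rewrite /limits_commute.
have -> : [set i | U [set j | R1 i j /\ R2 i j]] =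
    [set i | U [set j | R1 i j] /\ U [set j | R2 i j]].
  by apply/seteqP; split=> i /=; rewrite ultra_and.
have -> : [set j | U [set i | R1 i j /\ R2 i j]] =
    [set j | U [set i | R1 i j] /\ U [set i | R2 i j]].
  by apply/seteqP; split=> i /=; rewrite ultra_and.
by rewrite !ultra_and; move: c1 c2; rewrite /limits_commute; tauto.
Qed.

Lemma commute_or R1 R2 : limits_commute R1 -> limits_commute R2 ->
  limits_commute (fun i j => R1 i j \/ R2 i j).
Proof.
move=> c1 c2; apply: commute_eqv (commute_not (commute_and (commute_not c1) (commute_not c2))).
by move=> i j; have [h|h] := pselect (R1 i j); have [h'|h'] := pselect (R2 i j); tauto.
Qed.

Lemma commute_right (P : nat -> Prop) : limits_commute (fun _ j => P j).
Proof.
rewrite /limits_commute.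
have c (Q : Prop) : U [set _ | Q] <-> Q.
  split=> [h|q]; last by apply: filterS filterT => i.
  by apply: contrapT => nq; apply: nonempty; apply: filterS h.
by rewrite c (_ : [set j | U [set _ | P j]] = P) //; apply/seteqP; split=> j /=; rewrite c.
Qed.

Section Separable.
Variable F : fieldType.

(** A polynomial in entries depending on [i] only or on [j] only becomes such a
    scalar product when its monomials are collected. *)
Definition separable (g : nat -> nat -> F) : Prop :=
  exists n (a : nat -> 'rV[F]_n) (b : nat -> 'cV[F]_n),
    forall i j, g i j = (a i *m b j) 0 0.

Lemma separable_eq g g' : (forall i j, g i j = g' i j) -> separable g -> separable g'.
Proof. by move=> e [n [a [b gE]]]; exists n, a, b => i j; rewrite -e. Qed.

Lemma separable_prod (x y : nat -> F) : separable (fun i j => x i * y j).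
Proof.
exists 1%N, (fun i => (x i)%:M), (fun j => (y j)%:M) => i j.
by rewrite -scalar_mxM mxE eqxx mulr1n.
Qed.

Lemma separable_left (x : nat -> F) : separable (fun i _ => x i).
Proof. by apply: separable_eq (separable_prod x (fun _ => 1)) => i j; rewrite mulr1. Qed.

Lemma separable_right (x : nat -> F) : separable (fun _ j => x j).
Proof. by apply: separable_eq (separable_prod (fun _ => 1) x) => i j; rewrite mul1r. Qed.

Lemma separableD g h : separable g -> separable h -> separable (fun i j => g i j + h i j).
Proof.
move=> [n [a [b gE]]] [m [c [d hE]]].
exists (n + m)%N, (fun i => row_mx (a i) (c i)), (fun j => col_mx (b j) (d j)) => i j.
by rewrite gE hE (mul_row_col (a i) (c i) (b j) (d j)) [RHS]mxE.
Qed.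

Lemma separableM g h : separable g -> separable h -> separable (fun i j => g i j * h i j).
Proof.
move=> [n [a [b gE]]] [m [c [d hE]]].
suff sum k (s : nat -> nat -> nat -> F) : (forall l, separable (s l)) ->
    separable (fun i j => \sum_(l < k) s l i j).
  pose sa l i : F := if insub l is Some l' then a i 0 (l' : 'I_n) else 0.
  pose sb l j : F := if insub l is Some l' then b j (l' : 'I_n) 0 else 0.
  pose sc l i : F := if insub l is Some l' then c i 0 (l' : 'I_m) else 0.
  pose sd l j : F := if insub l is Some l' then d j (l' : 'I_m) 0 else 0.
  have := sum n (fun l i j => \sum_(l' < m) (sa l i * sc l' i) * (sb l j * sd l' j)).
  move=> /(_ _)/separable_eq; apply.
    move=> i j; rewrite gE hE !mxE mulr_suml; apply: eq_bigr => l _.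
    rewrite mulr_sumr; apply: eq_bigr => l' _.
    by rewrite /sa /sb /sc /sd !valK; ring.
  move=> l; apply: (sum m (fun l' i j => (sa l i * sc l' i) * (sb l j * sd l' j))) => l'.
  exact: (separable_prod (fun i => sa l i * sc l' i) (fun j => sb l j * sd l' j)).
move=> ss; elim: k => [|k IH].
  by apply: separable_eq (separable_left (fun _ => 0)) => i j; rewrite big_ord0.
by apply: separable_eq (separableD IH (ss k)) => i j; rewrite big_ord_recr.
Qed.

End Separable.
End DoubleLimits.

Section Stability.
Variables (U : set_system nat) (F : fieldType).
Hypothesis ultraU : UltraFilter U.
Let properU : ProperFilter U. Proof. exact: ultra_proper. Qed.

(** The vectors orthogonal to [b j] for almost all [j] form a subspace [V]; since
    it is finite-dimensional, almost all [b j] are orthogonal to the whole of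
    [V], hence to all the [a i] that belong to it. *)
Lemma separable_limit (g : nat -> nat -> F) : separable g ->
  U [set i | U [set j | g i j = 0]] -> U [set j | U [set i | g i j = 0]].
Proof.
move=> [n [a [b gE]]] h.
pose V (k : nat) (A : 'M[F]_(k, n)) := U [set j | A *m b j = 0].
have ex : exists r, `[< exists2 A : 'M[F]_n, \rank A = r & V n A >].
  exists 0%N; apply/asboolP; exists 0; first exact: mxrank0.
  by rewrite /V; apply: filterS filterT => j _ /=; rewrite mul0mx.
have bd r : `[< exists2 A : 'M[F]_n, \rank A = r & V n A >] -> (r <= n)%N.
  by move/asboolP => [A <- _]; exact: rank_leq_row.
case: (ex_maxnP ex bd) => r /asboolP[A rA VA] rmax.
have inA (w : 'rV[F]_n) : V 1%N w -> (w <= A)%MS.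
  move=> Vw; have le : (\rank (A + w)%MS <= \rank A)%N.
    rewrite rA; apply: rmax; apply/asboolP; exists (A + w)%MS => //.
    rewrite /V; apply: filterS (filterI VA Vw) => j /= [Aj wj].
    have /submxP[D ->] : ((A + w)%MS <= col_mx A w)%MS by rewrite addsmxE.
    by rewrite -mulmxA mul_col_mx Aj wj col_mx0 mulmx0.
  have sub : (A <= A + w)%MS by exact: addsmxSl.
  have := mxrank_leqif_sup sub => -[_ e].
  apply: submx_trans (addsmxSr A w) _; rewrite -e eqn_leq le andbT.
  exact: mxrankS.
apply: filterS VA => j /= Aj; apply: filterS h => i /= hi.
have /inA/submxP[D aD] : V 1%N (a i).
  rewrite /V; apply: filterS hi => j' /=; rewrite gE => h0.
  by apply/rowP => l; rewrite ord1 h0 mxE.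
by rewrite gE aD -mulmxA Aj mulmx0 mxE.
Qed.

Lemma commute_separable (g : nat -> nat -> F) : separable g ->
  limits_commute U (fun i j => g i j = 0).
Proof.
move=> sg; split; first exact: separable_limit.
apply: (@separable_limit (fun i j => g j i)).
case: sg => n [a [b gE]]; exists n, (fun j => (b j)^T), (fun i => (a i)^T) => i j.
by rewrite gE -trmx_mul [RHS]mxE.
Qed.

Lemma separable_eval (e : nat -> nat -> seq F) u : GRing.rterm u ->
  (forall l, separable (fun i j => (e i j)`_l)) ->
  separable (fun i j => GRing.eval (e i j) u).
Proof.
move=> + se; elim: u => //=.
- by move=> x _; exact: (separable_left (fun _ => x)).
- by move=> x _; exact: (separable_left (fun _ => x%:R)).
- by move=> u1 IH1 u2 IH2 /andP[/IH1 s1 /IH2 s2]; exact: separableD.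
- move=> u1 IH1 /IH1 s1.
  by apply: separable_eq (separableM (separable_left (fun _ => -1)) s1) => i j; rewrite mulN1r.
- move=> u1 IH1 k /IH1 s1.
  by apply: separable_eq (separableM (separable_left (fun _ => k%:R)) s1) => i j; rewrite mulr_natl.
- by move=> u1 IH1 u2 IH2 /andP[/IH1 s1 /IH2 s2]; exact: separableM.
- move=> u1 IH1 k /IH1 s1; elim: k => [|k IH].
    by apply: separable_eq (separable_left (fun _ => 1)) => i j; rewrite expr0.
  by apply: separable_eq (separableM s1 IH) => i j; rewrite exprS.
Qed.

Lemma commute_qf (e : nat -> nat -> seq F) f : GRing.qf_form f -> GRing.rformula f ->
  (forall l, separable (fun i j => (e i j)`_l)) ->
  limits_commute U (fun i j => GRing.holds (e i j) f).
Proof.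
move=> + + se; elim: f => //=.
- move=> u1 u2 _ /andP[r1 r2].
  have s := separableD (separable_eval r1 se)
    (separableM (separable_left (fun _ => -1)) (separable_eval r2 se)).
  apply: commute_eqv (commute_separable s) => i j; rewrite mulN1r.
  by split=> [/subr0_eq|->]; rewrite ?subrr.
- by move=> f1 IH1 f2 IH2 /andP[q1 q2] /andP[r1 r2]; apply: commute_and; [exact: IH1 | exact: IH2].
- by move=> f1 IH1 f2 IH2 /andP[q1 q2] /andP[r1 r2]; apply: commute_or; [exact: IH1 | exact: IH2].
- move=> f1 IH1 f2 IH2 /andP[q1 q2] /andP[r1 r2].
  apply: commute_eqv (commute_or ultraU (commute_not ultraU (IH1 q1 r1)) (IH2 q2 r2)) => i j.
  by have [h|h] := pselect (GRing.holds (e i j) f1); tauto.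
- by move=> f1 IH1 q1 r1; apply: commute_not => //; exact: IH1.
Qed.

Hypothesis closedF : GRing.closed_field_axiom F.

(** Algebraically closed fields eliminate quantifiers, and quantifier-free
    formulas are Boolean combinations of polynomial equations. *)
Lemma commute_holds (e : nat -> nat -> seq F) f : GRing.rformula f ->
  (forall l, separable (fun i j => (e i j)`_l)) ->
  limits_commute U (fun i j => GRing.holds (e i j) f).
Proof.
move=> rf se.
pose wf := @ClosedFieldQE.wf_ex_elim F.
pose ok := ClosedFieldQE.holds_ex_elim closedF.
have /andP[qf' rf'] := GRing.quantifier_elim_wf wf rf.
apply: commute_eqv (commute_qf qf' rf' se) => i j.
split=> [/(GRing.qf_evalP _ qf') h|/(GRing.quantifier_elim_rformP wf ok _ rf) h].
  exact/(GRing.quantifier_elim_rformP wf ok _ rf).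
exact/(GRing.qf_evalP _ qf').
Qed.

(** Orders depend on the second variable only, hence limits commute trivially
    for the conditions on orders. *)
Lemma commute_rvdef X P (G : set (X * P -> RV F)) S (x : nat -> X) (p : nat -> P) :
  (forall r, G r -> (exists g, r = g \o snd) \/ (exists a, r = fun t => (a t.1, 0))) ->
  rvdef G S -> limits_commute U (fun i j => S (x i, p j)).
Proof.
move=> GE [N [u [uG b]]]; elim: b => {S}.
- move=> f B rf; apply: commute_and => //.
    apply: commute_holds => // l.
    have [lN|Nl] := ltnP l N; last first.
      apply: separable_eq (separable_left (fun _ => 0)) => i j.
      by rewrite nth_default // size_mkseq.
    case: (GE _ (uG l lN)) => -[g gE].
      by apply: separable_eq (separable_right (fun j => (g (p j)).1)) => i j; rewrite nth_mkseq // gE.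
    by apply: separable_eq (separable_left (fun i => g (x i))) => i j; rewrite nth_mkseq // gE.
  apply: (@commute_eqv U (fun _ j => B (orders N u (x 0%N, p j)))); last exact: commute_right.
  move=> i j; rewrite (_ : orders N u (x i, p j) = orders N u (x 0%N, p j)) //.
  apply: (@eq_from_nth _ 0); rewrite !size_mkseq // => l lN; rewrite !nth_mkseq //.
  by case: (GE _ (uG l lN)) => -[g ->].
- by move=> S1 S2 _ c1 _ c2; apply: commute_or.
- by move=> S1 S2 e _; apply: commute_eqv => i j; exact: e.
Qed.

End Stability.

Lemma ultrafilter_nat : exists U : set_system nat, UltraFilter U /\
  forall n, U [set m | (n <= m)%N].
Proof.
have [U [ultraU le]] := ultraFilterLemma (eventually_filter).
by exists U; split=> // n; apply: le; exists n.
Qed.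

(** A directed family of non-empty sets definable from leading terms, on the
    side of the residue field, has a common point: otherwise choosing points
    and members of the family in turn would order them like the integers. *)
Lemma residue_compact (F : fieldType) (closedF : GRing.closed_field_axiom F)
    X P (G : set (X * P -> RV F)) S (P0 : set P) :
  (forall r, G r -> (exists g, r = g \o snd) \/ (exists a, r = fun t => (a t.1, 0))) ->
  rvdef G S -> P0 !=set0 -> (forall p, P0 p -> exists x, S (x, p)) ->
  (forall p p', P0 p -> P0 p' -> exists2 p'', P0 p'' &
    forall x, S (x, p'') -> S (x, p) /\ S (x, p')) ->
  exists x, forall p, P0 p -> S (x, p).
Proof.
move=> GE dS [p0 P0p0] ne dir; apply: contrapT => none.
have step (q : X * P) : exists q' : X * P, P0 q.2 -> [/\ P0 q'.2, S q',
    forall x, S (x, q'.2) -> S (x, q.2) & ~ S (q.1, q'.2)].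
  have [P0q|nP] := pselect (P0 q.2); last by exists q.
  have [p' P0p' nS] : exists2 p', P0 p' & ~ S (q.1, p').
    apply: contrapT => al; apply: none; exists q.1 => p' P0p'.
    by apply: contrapT => nS; apply: al; exists p'.
  have [p'' P0p'' sub] := dir _ _ P0q P0p'.
  have [x Sx] := ne _ P0p''.
  exists (x, p'') => _; split=> // [y /sub[]//|/sub[]//].
pose next q := sval (cid (step q)).
have nextP q : P0 q.2 -> [/\ P0 (next q).2, S (next q),
    forall x, S (x, (next q).2) -> S (x, q.2) & ~ S (q.1, (next q).2)].
  by rewrite /next; case: cid.
have [x0 Sx0] := ne _ P0p0.
pose q k := iter k next (x0, p0).
have P0q k : P0 (q k).2 by elim: k => //= k /nextP[].
have Sq k : S (q k) by case: k => [//|k]; have [] := nextP _ (P0q k).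
have dec j i x : (j <= i)%N -> S (x, (q i).2) -> S (x, (q j).2).
  move=> /subnK <-; elim: (i - j)%N => // d IH; rewrite addSn => h.
  by apply: IH; have [_ _ sub _] := nextP _ (P0q (d + j)%N); exact: sub.
have [U [ultraU Uge]] := ultrafilter_nat.
have properU : ProperFilter U by exact: ultra_proper.
have c := @commute_rvdef U F ultraU closedF X P G S (fun i => (q i).1) (fun j => (q j).2) GE dS.
have h1 : U [set j | U [set i | S ((q i).1, (q j).2)]].
  apply: filterS filterT => j _ /=; apply: filterS (Uge j) => i /= ji.
  by apply: (dec j i) => //; rewrite -surjective_pairing.
have {c h1} /c h2 := h1.
have := filter_not_empty U; apply.
apply: filterS h2 => i /= h2.
have [j [ij Sij]] := filter_ex (filterI (Uge i.+1) h2).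
by have [_ _ _ nS] := nextP _ (P0q i); apply: nS; exact: dec ij Sij.
Qed.

(** * Compactness in the field of Laurent series *)

Section BaseCompactness.
Variable F : fieldType.
Hypotheses (char0 : [pchar F] =i pred0) (closedF : GRing.closed_field_axiom F).
Local Notation K := (laurent F).

Lemma ord_ge_coefP (u : K) k a : ord_ge u k /\ u k = a <->
  (lead u = 0 /\ a = 0) \/ (lead u != 0 /\
    ((k < lorder u /\ a = 0) \/ (k = lorder u /\ lead u = a))).
Proof.
have [->|u0] := eqVneq u 0.
  rewrite lead0 eqxx; split=> [[_ <-]|[[_ ->]|[]]]; by [left | split |].
have lu : lead u <> 0 by move=> /eqP; rewrite lead_eq0 (negPf u0).
have [un _] := lorderP u0; split.
  move=> [uk <-]; right; split; first by apply/eqP.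
  have le : k <= lorder u by case/ord_geP: uk => // e; rewrite e eqxx in u0.
  by case: ltgtP le => // [lt|->] _; [left; split=> //; exact: un | right].
move=> [[]//|[_ [[lt ->]|[-> <-]]]]; last by split.
by split; [exact: ord_geW (ltW lt) un | exact: un].
Qed.

Section Family.
Variables (P : Type) (P0 : set P) (N n : nat) (E : P -> seq K) (f : GRing.formula K).
Hypotheses (rf : GRing.rformula f) (EN : forall p, size (E p) = N).

Definition fiber (p : P) (ys : seq K) : Prop :=
  size ys = n /\ GRing.holds (E p ++ ys) f.

Hypothesis inhabited : P0 !=set0.
Hypothesis directed : forall p p', P0 p -> P0 p' -> exists2 p'', P0 p'' &
  forall ys, fiber p'' ys -> fiber p ys /\ fiber p' ys.

Definition near_fiber (c : nat -> K) k p := exists2 ys, fiber p ys &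
  forall i, (i < n)%N -> ord_ge (ys`_i - c i) k.

(** The digits of order [k] of the points near [c] form a directed family of
    subsets of the residue field. *)
Lemma next_digit (c : nat -> K) k : (forall p, P0 p -> near_fiber c k p) ->
  exists2 c' : nat -> K, forall i, ord_ge (c' i - c i) k &
    forall p, P0 p -> near_fiber c' (k + 1) p.
Proof.
move=> near.
pose X := nat -> F.
pose A : set (X * P -> K) := fun u => exists g : P -> K, u = g \o snd.
pose G : set (X * P -> RV F) := fun r => (exists g : P -> RV F, r = g \o snd) \/
  (exists a : X -> F, r = fun t => (a t.1, 0)).
have algA : function_algebra A.
  split=> [x|_ _ [u ->] [v ->]|_ _ [u ->] [v ->]]; first by exists (fun _ => x).
    by exists (fun p => u p + v p).
  by exists (fun p => u p * v p).
have tA : tame G A.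
  by move=> _ [g ->]; apply: rvfun_gen; left; exists (fun p => rv (g p)).
pose W i (t : X * P) (y : K) := ord_ge (y - c i) k /\ (y - c i) k = t.1 i.
have dW i : rvdef (field_extend G A) [set z | W i z.1 z.2].
  have algA1 := poly_algebraP algA; have tA1 := @poly_algebra_tame F _ G A.
  have dy : rvfun (field_extend G A) (fun z : X * P * K => rv (z.2 - c i)).
    exact: (tA1 _ (algebraB algA1 (poly_algebra_snd algA) (algebra_const algA1 (c i)))).
  have da : leadfun (field_extend G A) (fun z => z.1.1 i).
    apply: (@leadfun_fst _ _ _ (fun z : X * P * K => (z.1.1 i, 0))).
    apply: rvfun_gen; left; exists (fun t : X * P => (t.1 i, 0)) => //.
    by right; exists (fun x : X => x i).
  have dl := leadfun_fst dy; have dord := orderfun_snd dy.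
  have dk := orderfun_const (field_extend G A) k.
  have d1 := rvdef_and (rvdef_lead0 dl) (rvdef_lead0 da).
  have d2 := rvdef_and (rvdef_order (fun x y => x < y) dk dord) (rvdef_lead0 da).
  have d3 := rvdef_and (rvdef_order (fun x y => x = y) dk dord) (rvdef_lead_eq dl da).
  have d := rvdef_or d1 (rvdef_and (rvdef_lead_neq0 dl) (rvdef_or d2 d3)).
  by apply: rvdef_eqv d => z; apply: iff_sym; exact: ord_ge_coefP.
have EA i : A (fun t => (E t.2)`_i) by exists (fun p => (E p)`_i).
have dS := rvdef_block char0 n rf algA tA (fun t => EN t.2) EA dW.
have GE r : G r -> (exists g, r = g \o snd) \/ (exists a, r = fun t => (a t.1, 0)) by [].
have [||a aP] := residue_compact closedF GE dS inhabited.
- move=> p /near[ys [sy hy] yc]; exists (fun i => (ys`_i - c i) k), ys; split=> //.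
  by move=> i i_n; split=> //; exact: yc.
- move=> p p' P0p P0p'; have [p'' P0p'' sub] := directed P0p P0p'.
  exists p'' => // x [ys [sy hy Wy]].
  have [[_ h1] [_ h2]] := sub ys (conj sy hy).
  by split; exists ys.
exists (fun i => c i + monomial (a i) k).
  by move=> i; rewrite addrC addKr; exact: ord_ge_monomial.
move=> p /aP[ys [sy hy Wy]]; exists ys => // i i_n; have [h1 h2] := Wy i i_n.
rewrite opprD addrA; apply: ord_geS; first by apply: ord_geB => //; exact: ord_ge_monomial.
by rewrite coefB_laurent monomial_coef h2 subrr.
Qed.

Theorem laurent_compact k0 :
  (forall p, P0 p -> exists ys, fiber p ys) ->
  (forall p ys, P0 p -> fiber p ys -> forall i, (i < n)%N -> ord_ge ys`_i k0) ->
  (forall p xs, P0 p -> size xs = n -> (forall k, near_fiber (nth 0 xs) k p) ->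
    fiber p xs) ->
  exists xs, forall p, P0 p -> fiber p xs.
Proof.
move=> ne bd cl.
pose good_approx j c := forall p, P0 p -> near_fiber c (k0 + j%:Z) p.
have step j (c : nat -> K) : exists c' : nat -> K, good_approx j c ->
    (forall i, ord_ge (c' i - c i) (k0 + j%:Z)) /\ good_approx j.+1 c'.
  have [h|h] := pselect (good_approx j c); last by exists c.
  have [c' c1 c2] := next_digit h; exists c' => _; split=> // p /c2.
  by rewrite (_ : k0 + j%:Z + 1 = k0 + j.+1%:Z) //; lia.
pose fix u j := if j is j'.+1 then sval (cid (step j' (u j'))) else fun _ => 0.
have uS j : good_approx j (u j) ->
    (forall i, ord_ge (u j.+1 i - u j i) (k0 + j%:Z)) /\ good_approx j.+1 (u j.+1).
  by rewrite /=; case: cid.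
have ug j : good_approx j (u j).
  elim: j => [p P0p|j /uS[]//]; have [ys hy] := ne p P0p.
  exists ys => // i i_n; rewrite addr0 subr0; exact: bd hy i i_n.
have lim i : exists x, forall j, ord_ge (x - u j i) (k0 + j%:Z).
  by apply: (@laurent_complete _ (fun j => u j i)) => j; have [h _] := uS j (ug j).
pose x i := sval (cid (lim i)).
have xP i j : ord_ge (x i - u j i) (k0 + j%:Z) by rewrite /x; case: cid.
exists (mkseq x n) => p P0p; apply: cl => //; first by rewrite size_mkseq.
move=> k; have [ys hy yu] := ug `|k - k0|%N p P0p.
exists ys => // i i_n; rewrite nth_mkseq // -(subrKA (u `|k - k0|%N i)).
have le : k <= k0 + `|k - k0|%N%:Z by lia.
apply: ord_geD; first exact: ord_geW le (yu i i_n).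
by rewrite -opprB; apply: ord_geN; exact: ord_geW le (xP i _).
Qed.

End Family.
End BaseCompactness.

(** * Uniform definability *)

Lemma size_point_env (K : fieldType) n (x : 'rV[K]_n) : size (point_env x) = n.
Proof. by rewrite size_map size_enum_ord. Qed.

Lemma nth_point_env (K : fieldType) n (x : 'rV[K]_n) (i : 'I_n) : (point_env x)`_i = x 0 i.
Proof. by rewrite (nth_map i) ?size_enum_ord // nth_ord_enum. Qed.

Lemma point_envP (K : fieldType) n (e : seq K) : size e = n ->
  point_env (\row_(i < n) e`_i) = e.
Proof.
move=> en; apply: (@eq_from_nth _ 0); rewrite size_point_env // => i i_n.
by rewrite (nth_point_env _ (Ordinal i_n)) mxE.
Qed.

Lemma point_env_row (K : fieldType) m n (x : 'rV[K]_m) (y : 'rV[K]_n) :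
  point_env (row_mx x y) = point_env x ++ point_env y.
Proof.
apply: (@eq_from_nth _ 0); rewrite ?size_cat !size_point_env // => i i_mn.
rewrite (nth_point_env _ (Ordinal i_mn)) mxE nth_cat size_point_env.
case: splitP => j /= ->; first by rewrite ltn_ord nth_point_env.
by rewrite ifN ?addKn ?nth_point_env // -leqNgt leq_addr.
Qed.

Section UniformDefinability.
Variable L : fieldType.

(** The type of the free variables of a relation, as a tuple over [K] rather
    than as a list; [env] lists them for the semantics of formulas. *)
Record context := Context {
  carrier : fieldType -> Type;
  env : forall K : fieldType, carrier K -> seq K;
  arity : nat;
  size_env : forall (K : fieldType) x, size (@env K x) = arity }.

Implicit Type C : context.

Definition uprop C := forall K : fieldType, (L -> K) -> carrier C K -> Prop.
Definition ufun C := forall K : fieldType, (L -> K) -> carrier C K -> K.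

(** A relation is given at once on all fields [K] with a map [L -> K], so that
    one formula can be evaluated in [L] and in [K]. *)
Definition udef C (P : uprop C) : Prop :=
  exists2 f : GRing.formula L, GRing.rformula f &
    forall (K : fieldType) (h : L -> K) x,
      P K h x <-> GRing.holds (env x) (map_formula h f).

Definition uterm C (u : ufun C) : Prop :=
  exists t : GRing.term L, [/\ GRing.rterm t,
    forall (K : fieldType) (h : L -> K), depends_below h (arity C) t &
    forall (K : fieldType) (h : L -> K) x, u K h x = GRing.eval (env x) (map_term h t)].

Definition empty_context :=
  @Context (fun _ => unit) (fun _ _ => [::]) 0 (fun _ _ => erefl).

Fact size_ext C (K : fieldType) (z : carrier C K * K) :
  size (rcons (env z.1) z.2) = (arity C).+1.
Proof. by rewrite size_rcons size_env. Qed.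
Definition ext_context C := Context (@size_ext C).

Fact size_block C n (K : fieldType) (z : carrier C K * 'rV[K]_n) :
  size (env z.1 ++ point_env z.2) = (arity C + n)%N.
Proof. by rewrite size_cat size_env size_point_env. Qed.
Definition block_context C n := Context (@size_block C n).

Section Terms.
Variable C : context.

Lemma uterm_const c : uterm (fun K h (x : carrier C K) => h c).
Proof. by exists (GRing.Const c); split. Qed.

Lemma uterm_nat n : uterm (fun K h (x : carrier C K) => n%:R).
Proof. by exists (GRing.NatConst L n); split. Qed.

Lemma utermD (u v : ufun C) : uterm u -> uterm v -> uterm (fun K h x => u K h x + v K h x).
Proof.
move=> [t [rt dt tE]] [s [rs ds sE]]; exists (GRing.Add t s); split=> /=.
- by rewrite rt.
- by move=> K h e e' ee /=; rewrite (dt _ _ e e') // (ds _ _ e e').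
- by move=> K h x; rewrite tE sE.
Qed.

Lemma utermM (u v : ufun C) : uterm u -> uterm v -> uterm (fun K h x => u K h x * v K h x).
Proof.
move=> [t [rt dt tE]] [s [rs ds sE]]; exists (GRing.Mul t s); split=> /=.
- by rewrite rt.
- by move=> K h e e' ee /=; rewrite (dt _ _ e e') // (ds _ _ e e').
- by move=> K h x; rewrite tE sE.
Qed.

Lemma utermN (u : ufun C) : uterm u -> uterm (fun K h x => - u K h x).
Proof.
move=> [t [rt dt tE]]; exists (GRing.Opp t); split=> //=.
- by move=> K h e e' ee /=; rewrite (dt _ _ e e').
- by move=> K h x; rewrite tE.
Qed.

Lemma uterm_ext (u : ufun C) : uterm u -> @uterm (ext_context C) (fun K h z => u K h z.1).
Proof.
move=> [t [rt dt tE]]; exists t; split=> //.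
  by move=> K h; apply: depends_belowW (dt K h).
move=> K h [x y] /=; rewrite tE; apply: dt => i iN.
by rewrite nth_rcons size_env iN.
Qed.

Lemma uterm_last : @uterm (ext_context C) (fun K h z => z.2).
Proof.
exists (GRing.Var L (arity C)); split=> //.
  by move=> K h e e' ee /=; exact: ee.
by move=> K h [x y] /=; rewrite nth_rcons size_env ltnn eqxx.
Qed.

Lemma uterm_block n (u : ufun C) : uterm u ->
  @uterm (block_context C n) (fun K h z => u K h z.1).
Proof.
move=> [t [rt dt tE]]; exists t; split=> //.
  by move=> K h; apply: depends_belowW (dt K h); exact: leq_addr.
move=> K h [x y] /=; rewrite tE; apply: dt => i iN.
by rewrite nth_cat size_env iN.
Qed.

Lemma uterm_coord n (i : 'I_n) : @uterm (block_context C n) (fun K h z => z.2 0 i).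
Proof.
exists (GRing.Var L (arity C + i)%N); split=> //.
  by move=> K h e e' ee /=; apply: ee; rewrite ltn_add2l.
move=> K h [x y] /=.
by rewrite nth_cat size_env ltnNge leq_addr /= addKn nth_point_env.
Qed.

End Terms.

Definition uenv C k (e : forall K : fieldType, (L -> K) -> carrier C K -> seq K) : Prop :=
  (forall K h x, size (e K h x) = k) /\
  forall i, (i < k)%N -> uterm (fun K h x => (e K h x)`_i).

Section Formulas.
Variable C : context.

Lemma uenv1 (u : ufun C) : uterm u -> @uenv C 1 (fun K h x => [:: u K h x]).
Proof. by move=> tu; split=> // -[|//] _. Qed.

Lemma uenv_cat k1 k2 e1 e2 : @uenv C k1 e1 -> @uenv C k2 e2 ->
  @uenv C (k1 + k2) (fun K h x => e1 K h x ++ e2 K h x).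
Proof.
move=> [s1 t1] [s2 t2]; split=> [K h x|i ik]; first by rewrite size_cat s1 s2.
have [ik1|ki] := ltnP i k1.
  have [t [rt dt tE]] := t1 i ik1; exists t; split=> // K h x.
  by rewrite nth_cat s1 ik1.
have [|t [rt dt tE]] := t2 (i - k1)%N; first by lia.
by exists t; split=> // K h x; rewrite nth_cat s1 ltnNge ki /=; exact: tE.
Qed.

Lemma uenv_row n (v : forall K : fieldType, (L -> K) -> carrier C K -> 'rV[K]_n) :
  (forall i, uterm (fun K h x => v K h x 0 i)) ->
  @uenv C n (fun K h x => point_env (v K h x)).
Proof.
move=> tv; split=> [K h x|i i_n]; first exact: size_point_env.
have [t [rt dt tE]] := tv (Ordinal i_n); exists t; split=> // K h x.
by rewrite (nth_point_env _ (Ordinal i_n)).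
Qed.

Lemma udef_holds f k e : GRing.rformula f -> @uenv C k e ->
  udef (fun K h x => GRing.holds (e K h x) (map_formula h f)).
Proof.
move=> rf [se te].
have ex i : exists t : GRing.term L, [/\ GRing.rterm t,
    forall (K : fieldType) (h : L -> K), depends_below h (arity C) t &
    forall (K : fieldType) (h : L -> K) x, (e K h x)`_i = GRing.eval (env x) (map_term h t)].
  have [/te//|ki] := ltnP i k.
  by exists (GRing.NatConst L 0); split=> // K h x; rewrite nth_default ?se.
pose s i := sval (cid (ex i)).
have sP i : [/\ GRing.rterm (s i),
    forall (K : fieldType) (h : L -> K), depends_below h (arity C) (s i) &
    forall (K : fieldType) (h : L -> K) x, (e K h x)`_i = GRing.eval (env x) (map_term h (s i))].
  by rewrite /s; case: cid.
exists (formula_sub s (@GRing.Const L) (arity C) f).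
  by apply: rformula_sub => // i; have [] := sP i.
move=> K h x; apply: (@holds_formula_sub L K L h h _ _ s _ _ setT) => //.
- by move=> i; have [_ d _] := sP i.
- by move=> i; have [_ _ ->] := sP i.
- exact: formula_overT.
Qed.

Lemma udef_eq (u v : ufun C) : uterm u -> uterm v -> udef (fun K h x => u K h x = v K h x).
Proof.
move=> [t [rt dt tE]] [s [rs ds sE]]; exists (GRing.Equal t s) => /=; first by rewrite rt.
by move=> K h x; rewrite tE sE.
Qed.

Lemma udef_and (P Q : uprop C) : udef P -> udef Q -> udef (fun K h x => P K h x /\ Q K h x).
Proof.
move=> [f rf fE] [g rg gE]; exists (GRing.And f g) => /=; first by rewrite rf.
by move=> K h x; rewrite fE gE.
Qed.

Lemma udef_imp (P Q : uprop C) : udef P -> udef Q -> udef (fun K h x => P K h x -> Q K h x).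
Proof.
move=> [f rf fE] [g rg gE]; exists (GRing.Implies f g) => /=; first by rewrite rf.
by move=> K h x; rewrite fE gE.
Qed.

Lemma udef_or (P Q : uprop C) : udef P -> udef Q -> udef (fun K h x => P K h x \/ Q K h x).
Proof.
move=> [f rf fE] [g rg gE]; exists (GRing.Or f g) => /=; first by rewrite rf.
by move=> K h x; rewrite fE gE.
Qed.

Lemma udef_not (P : uprop C) : udef P -> udef (fun K h x => ~ P K h x).
Proof.
move=> [f rf fE]; exists (GRing.Not f) => //=.
by move=> K h x; rewrite fE.
Qed.

Lemma udef_eqv (P Q : uprop C) : (forall K h x, P K h x <-> Q K h x) -> udef P -> udef Q.
Proof.
by move=> e [f rf fE]; exists f => // K h x; rewrite -fE; exact: iff_sym (e K h x).
Qed.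

Lemma udef_neq0 (u : ufun C) : uterm u -> udef (fun K h x => u K h x != 0).
Proof.
move=> tu; apply: udef_eqv (udef_not (udef_eq tu (uterm_nat C 0))) => K h x.
by split=> /eqP.
Qed.

Lemma udef_ex (P : forall K : fieldType, (L -> K) -> carrier C K -> K -> Prop) :
  @udef (ext_context C) (fun K h z => P K h z.1 z.2) ->
  udef (fun K h x => exists y, P K h x y).
Proof.
move=> [f rf fE]; exists (GRing.Exists (arity C) f) => //= K h x.
have sE y : set_nth 0 (env x) (arity C) y = rcons (env x) y.
  by rewrite set_nthE size_env ltnn subnn cats1.
by split=> -[y]; [rewrite (fE K h (x, y)) | rewrite sE -(fE K h (x, y))] => hy;
  exists y => //; rewrite sE.
Qed.

Lemma udef_all (P : forall K : fieldType, (L -> K) -> carrier C K -> K -> Prop) :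
  @udef (ext_context C) (fun K h z => P K h z.1 z.2) ->
  udef (fun K h x => forall y, P K h x y).
Proof.
move=> [f rf fE]; exists (GRing.Forall (arity C) f) => //= K h x.
have sE y : set_nth 0 (env x) (arity C) y = rcons (env x) y.
  by rewrite set_nthE size_env ltnn subnn cats1.
split=> hy y; first by rewrite sE; apply/(fE K h (x, y)).
by apply/(fE K h (x, y)); rewrite /= -sE.
Qed.

Lemma udef_all_ord n (P : 'I_n -> uprop C) : (forall i, udef (P i)) ->
  udef (fun K h x => forall i, P i K h x).
Proof.
move=> dP.
suff d (s : seq 'I_n) : udef (fun K h x => forall i, i \in s -> P i K h x).
  apply: udef_eqv (d (enum 'I_n)) => K h x; split=> hi i; last by move=> _.
  by apply: hi; rewrite mem_enum.
elim: s => [|j s IH].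
  by exists (GRing.Bool true).
apply: udef_eqv (udef_and (dP j) IH) => K h x; split=> [[hj hs] i|hi].
  by rewrite inE => /predU1P[->|/hs].
by split=> [|i is_]; apply: hi; rewrite inE ?eqxx // is_ orbT.
Qed.

End Formulas.

Fixpoint exists_block (N n : nat) (f : GRing.formula L) : GRing.formula L :=
  if n is n'.+1 then GRing.Exists N (exists_block N.+1 n' f) else f.

Lemma rformula_exists_block N n f : GRing.rformula (exists_block N n f) = GRing.rformula f.
Proof. by elim: n N => //= n IH N. Qed.

Lemma holds_exists_block (K : fieldType) (h : L -> K) N n f (e : seq K) : size e = N ->
  GRing.holds e (map_formula h (exists_block N n f)) <->
  exists2 ys, size ys = n & GRing.holds (e ++ ys) (map_formula h f).
Proof.
elim: n N e => [|n IH] N e eN /=.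
  split=> [hf|[ys /size0nil-> ]]; last by rewrite cats0.
  by exists [::]; rewrite ?cats0.
have sE y : set_nth 0 e N y = rcons e y by rewrite -eN set_nthE ltnn subnn cats1.
have {}IH y := IH N.+1 (rcons e y) (etrans (size_rcons _ _) (congr1 S eN)).
split=> [[y]|[[//|y ys] /= [sy] hy]].
  by rewrite sE => /IH[ys sy hy]; exists (y :: ys); rewrite /= ?sy // -cat_rcons.
by exists y; rewrite sE; apply/IH; exists ys => //; rewrite cat_rcons.
Qed.

Lemma udef_ex_block C n (P : forall K : fieldType, (L -> K) -> carrier C K -> 'rV[K]_n -> Prop) :
  @udef (block_context C n) (fun K h z => P K h z.1 z.2) ->
  udef (fun K h x => exists y, P K h x y).
Proof.
move=> [f rf fE]; exists (exists_block (arity C) n f).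
  by rewrite rformula_exists_block.
move=> K h x; apply: iff_trans (iff_sym (holds_exists_block h _ _ (size_env x))).
split=> [[y hy]|[ys sy hy]].
  exists (point_env y); first exact: size_point_env.
  exact/(fE K h (x, y)).
exists (\row_i ys`_i); apply/(fE K h (x, _)) => /=.
by rewrite point_envP.
Qed.

Lemma udef_all_block C n (P : forall K : fieldType, (L -> K) -> carrier C K -> 'rV[K]_n -> Prop) :
  @udef (block_context C n) (fun K h z => P K h z.1 z.2) ->
  udef (fun K h x => forall y, P K h x y).
Proof.
move=> dP.
have d := udef_not (udef_ex_block (P := fun K h x y => ~ P K h x y) (udef_not dP)).
apply: udef_eqv d => K h x; split=> [no y|al [y]]; last by apply.
by apply: contrapT => ny; apply: no; exists y.
Qed.

Lemma udef_transfer (P : uprop empty_context) (K : fieldType) (h : L -> K) :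
  udef P -> elementary_on h setT -> P L id tt <-> P K h tt.
Proof.
move=> [f rf fE] el; rewrite !fE map_formula_id; apply: el => //.
exact: formula_overT.
Qed.

End UniformDefinability.

(** * The valuation ring *)

Section PowerSeries.
Variable F : fieldType.
Hypothesis char0 : [pchar F] =i pred0.
Local Notation K := (laurent F).

Lemma sqrt_one_plus (a : K) : ord_ge (a - 1) 1 -> exists y, y ^+ 2 = a.
Proof.
move=> a1.
have a0 : ord_ge a 0.
  by rewrite -(subrK 1 a); apply: ord_geD; [exact: ord_geW a1 | exact: ord_ge1].
have ca : a 0 = 1 by rewrite -(subrK 1 a) coefD_laurent a1 // add0r coef1_laurent.
have res : residue_poly ('X^2 - a%:P) 0 0 0 ('X^2 - 1%:P).
  move=> k; rewrite nderivn_at0 mulr0 subr0 !coefB !coefXn !coefC.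
  case: k => [|[|[|k]]] /=; rewrite ?subr0 ?sub0r; split=> //.
  - exact: ord_geN.
  - by rewrite ca.
  - exact: ord_ge1.
have [||y] := hensel res (a := 1).
- by rewrite !hornerE expr1n subrr.
- rewrite nderivn1.
  rewrite derivB derivXn derivC subr0 hornerMn hornerXn expr1n.
  by move/pcharf0P: char0 => ->.
rewrite !hornerE => /subr0_eq ya _; by exists y.
Qed.

Definition power_series_formula : GRing.formula K :=
  ('exists 'X_1, 'X_1 * 'X_1 == 1%:R + GRing.Const (monomial 1 1 : K) * ('X_0 * 'X_0))%T.

(** [x] is integral exactly when [1 + t x^2] is a square: its order would be
    odd otherwise. *)
Lemma power_seriesP (x : K) : GRing.holds [:: x] power_series_formula <-> power_series x.
Proof.
rewrite /power_series_formula /=; set t := monomial 1 1.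
have rt : rv t = (1, 1) by rewrite rv_monomial ?oner_eq0.
split=> [[y yx]|Ox].
  apply/ord_geP; have [->|x0] := eqVneq x 0; [by left | right].
  have t0 : t != 0 by rewrite -lead_eq0 [lead t](congr1 fst rt) oner_eq0.
  have otx : lorder (t * (x * x)) = 1 + (lorder x + lorder x).
    by rewrite !lorderM ?mulf_neq0 // [lorder t](congr1 snd rt).
  rewrite leNgt; apply/negP => x_neg.
  have tx0 : t * (x * x) != 0 by rewrite !mulf_neq0.
  have [h1 h2] := lorderP tx0.
  have oa : lorder (1 + t * (x * x)) = 1 + (lorder x + lorder x).
    rewrite -otx; apply: lorderE.
      by apply: ord_geD => //; apply: ord_geW (@ord_ge1 F); lia.
    by rewrite coefD_laurent coef1_laurent lt_eqF ?add0r // otx; lia.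
  have y0 : y != 0.
    apply/eqP => y0; move: oa; rewrite -yx y0 mul0r lorder0; lia.
  by move: oa; rewrite -yx lorderM //; lia.
have [|y yE] := @sqrt_one_plus (1 + t * (x * x)); last by exists y; rewrite -expr2.
rewrite addrAC subrr add0r -[1]addr0; apply: ord_geM; first exact: ord_ge_monomial.
by rewrite -[0]addr0; exact: ord_geM.
Qed.

End PowerSeries.

Record is_valuation_ring (K : fieldType) (O : set K) : Prop := IsValuationRing {
  valuation1 : O 1;
  valuationD : forall x y, O x -> O y -> O (x + y);
  valuationM : forall x y, O x -> O y -> O (x * y);
  valuationN : forall x, O x -> O (- x);
  valuation_total : forall x, O x \/ O x^-1;
  valuation_nontrivial : exists x, [/\ x != 0, O x & ~ O x^-1] }.

Section ElementaryValuation.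
Variable F : fieldType.
Hypothesis char0 : [pchar F] =i pred0.
Local Notation L := (laurent F).
Local Notation f0 := (power_series_formula F).

Definition is_integral (K : fieldType) (h : L -> K) (x : K) : Prop :=
  GRing.holds [:: x] (map_formula h f0).

Lemma udef_integral (C : context) (u : ufun L C) : uterm u ->
  udef (fun K h x => is_integral h (u K h x)).
Proof. by move=> tu; apply: udef_holds; [|exact: uenv1]. Qed.

Lemma is_integral_id (x : L) : is_integral id x <-> power_series x.
Proof. by rewrite /is_integral map_formula_id; exact: power_seriesP. Qed.

(** All formulas defining the power series in [L] are equivalent in [L], hence
    in [K]. *)
Lemma valuation_ringE (K : fieldType) (h : L -> K) : elementary_on h setT ->
  valuation_ring h = is_integral h.
Proof.
move=> el; apply/funext => x; apply/propext; split=> [[f [rf fE hx]]|hx].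
  have d : @udef L empty_context (fun K h _ => forall y : K,
      GRing.holds [:: y] (map_formula h f) -> is_integral h y).
    apply: udef_all; apply: udef_imp.
      by apply: udef_holds => //; apply: uenv1; exact: uterm_last.
    by apply: udef_integral; exact: uterm_last.
  apply: (udef_transfer d el).1 hx => y; rewrite map_formula_id fE.
  by move/is_integral_id.
by exists f0; split=> // y; exact: power_seriesP.
Qed.

Lemma valuation_ring_elementary (K : fieldType) (h : L -> K) :
  elementary_on h setT -> is_valuation_ring (is_integral h).
Proof.
move=> el.
have last (C : context) := @uterm_last L C.
have prev (C : context) := @uterm_ext L C.
have ring_ops : forall x y : K, is_integral h x -> is_integral h y ->
    [/\ is_integral h (x + y), is_integral h (x * y) & is_integral h (- x)].
  suff ops : forall x y : K, is_integral h x -> is_integral h y -> is_integral h (x + y) /\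
      (is_integral h (x * y) /\ is_integral h (- x)).
    by move=> x y Ox Oy; have [? []] := ops x y Ox Oy.
  have d : @udef L empty_context (fun K h _ => forall x y : K, is_integral h x ->
      is_integral h y -> is_integral h (x + y) /\
      (is_integral h (x * y) /\ is_integral h (- x))).
    apply: udef_all; apply: udef_all; apply: udef_imp; last apply: udef_imp.
    + by apply: udef_integral; exact: (prev _ _ (last _)).
    + by apply: udef_integral; exact: last.
    apply: udef_and; last apply: udef_and; apply: udef_integral.
    + by apply: utermD; [exact: (prev _ _ (last _)) | exact: last].
    + by apply: utermM; [exact: (prev _ _ (last _)) | exact: last].
    + by apply: utermN; exact: (prev _ _ (last _)).
  apply/(udef_transfer d el) => x y /is_integral_id Ox /is_integral_id Oy.
  split; first by apply/is_integral_id; exact: ord_geD.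
  split; apply/is_integral_id; last exact: ord_geN.
  by rewrite /power_series /= -[0]addr0; exact: ord_geM.
split.
- have d : @udef L empty_context (fun K h _ => is_integral h 1).
    by apply: udef_integral; exact: (uterm_nat L _ 1).
  by apply/(udef_transfer d el)/is_integral_id; exact: ord_ge1.
- by move=> x y Ox Oy; have [] := ring_ops x y Ox Oy.
- by move=> x y Ox Oy; have [] := ring_ops x y Ox Oy.
- by move=> x Ox; have [] := ring_ops x x Ox Ox.
- have d : @udef L empty_context (fun K h _ => forall x : K,
      is_integral h x \/ exists y : K, x * y = 1 /\ is_integral h y).
    apply: udef_all; apply: udef_or; first by apply: udef_integral; exact: last.
    apply: udef_ex; apply: udef_and; last by apply: udef_integral; exact: last.
    apply: udef_eq; last exact: (uterm_nat L _ 1).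
    by apply: utermM; [exact: (prev _ _ (last _)) | exact: last].
  move=> x; suff [|[y [xy Oy]]] : is_integral h x \/ exists y : K, x * y = 1 /\ is_integral h y.
  + by left.
  + right; have x0 : x != 0 by apply: contra_eq_neq xy => ->; rewrite mul0r eq_sym oner_eq0.
    by rewrite (_ : x^-1 = y) //; apply: (mulfI x0); rewrite mulfV.
  move: x; apply/(udef_transfer d el) => x.
  have [x0|x0] := eqVneq x 0; first by left; apply/is_integral_id; rewrite x0.
  have [le|lt] := leP 0 (lorder x).
    by left; apply/is_integral_id/ord_geP; right.
  right; exists x^-1; rewrite mulfV //; split=> //; apply/is_integral_id/ord_geP; right.
  have := lorderM x0 (invr_neq0 x0); rewrite mulfV // (lorderE (@ord_ge1 F)); first lia.
  by rewrite coef1_laurent eqxx oner_eq0.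
- have d : @udef L empty_context (fun K h _ => exists x : K,
      x != 0 /\ (is_integral h x /\ forall y : K, x * y = 1 -> ~ is_integral h y)).
    apply: udef_ex; apply: udef_and; first by apply: udef_neq0; exact: last.
    apply: udef_and; first by apply: udef_integral; exact: last.
    apply: udef_all; apply: udef_imp.
      apply: udef_eq; last exact: (uterm_nat L _ 1).
      by apply: utermM; [exact: (prev _ _ (last _)) | exact: last].
    by apply: udef_not; apply: udef_integral; exact: last.
  have [|x [x0 [Ox nO]]] := (udef_transfer d el).1; last first.
    by exists x; split=> //; apply: nO; rewrite mulfV.
  have o1 : (1 : F) != 0 by exact: oner_neq0.
  have rt := @rv_monomial F 1 1 o1.
  have t0 : monomial (1 : F) 1 != 0 by rewrite -lead_eq0 [lead _](congr1 fst rt).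
  exists (monomial 1 1); split=> //; split.
    by apply/is_integral_id; apply: ord_geW (@ord_ge_monomial F 1 1).
  move=> y ty /is_integral_id/ord_geP[y0|oy].
    by move: ty; rewrite y0 mulr0 => /eqP; rewrite eq_sym oner_eq0.
  have y0 : y != 0 by apply: contra_eq_neq ty => ->; rewrite mulr0 eq_sym oner_eq0.
  have := lorderM t0 y0; rewrite ty (lorderE (@ord_ge1 F)) ?coef1_laurent ?eqxx ?oner_eq0 //.
  by rewrite [lorder (monomial _ _)](congr1 snd rt) /=; lia.
Qed.

End ElementaryValuation.

(** * The valuation topology *)

Section ValuationTopology.
Variables (K : fieldType) (O : set K).
Hypothesis vO : is_valuation_ring O.
Implicit Types (a s x y : K).

Lemma valuation0 : O 0.
Proof. by rewrite -(subrr 1); apply: valuationD (valuation1 vO) (valuationN vO (valuation1 vO)). Qed.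

Lemma val_units1 : val_units O 1.
Proof. by split; rewrite ?oner_neq0 ?invr1 //; exact: (valuation1 vO). Qed.

Lemma val_leE s x : s != 0 -> val_le O (value O s) (value O x) <-> O (x / s).
Proof.
move=> s0; split.
  move=> [_ [_ [[u [u0 Ou _] <-] [w [w0 _ Ow'] <-] [z Oz e]]]].
  have -> : x / s = u * z * w^-1.
    by apply: (mulIf w0); rewrite mulfVK // mulrAC e; field.
  exact: valuationM (valuationM vO Ou Oz) Ow'.
move=> Oxs; exists s, x; split.
- by exists 1; [exact: val_units1 | rewrite mulr1].
- by exists 1; [exact: val_units1 | rewrite mulr1].
- by exists (x / s) => //; rewrite mulrC divfK.
Qed.

Lemma ball_sym s x y : O ((x - y) / s) -> O ((y - x) / s).
Proof. by move=> h; rewrite -opprB mulNr; exact: (valuationN vO). Qed.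

Lemma ball_trans s x y z : O ((x - y) / s) -> O ((y - z) / s) -> O ((x - z) / s).
Proof.
move=> h1 h2; rewrite (_ : (x - z) / s = (x - y) / s + (y - z) / s); last by ring.
exact: (valuationD vO).
Qed.

Lemma ball_larger s s' x : s' != 0 -> O (s' / s) -> O (x / s') -> O (x / s).
Proof.
move=> s0 h1 h2; rewrite (_ : x / s = (x / s') * (s' / s)).
  exact: (valuationM vO h2 h1).
by rewrite mulrA divfK.
Qed.

Lemma smaller_ball s s' : s != 0 -> s' != 0 ->
  exists2 s'', s'' != 0 & O (s'' / s) /\ O (s'' / s').
Proof.
move=> s0 s'0; have [h|h] := valuation_total vO (s' / s).
  by exists s' => //; split=> //; rewrite divff //; exact: (valuation1 vO).
exists s => //; split; first by rewrite divff //; exact: (valuation1 vO).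
by rewrite -invf_div.
Qed.

Lemma larger_ball s s' : s != 0 -> s' != 0 ->
  exists2 s'', s'' != 0 & O (s / s'') /\ O (s' / s'').
Proof.
move=> s0 s'0; have [h|h] := valuation_total vO (s' / s).
  by exists s => //; split=> //; rewrite divff //; exact: (valuation1 vO).
exists s' => //; split; last by rewrite divff //; exact: (valuation1 vO).
by rewrite -invf_div.
Qed.

(** The topology is only given by a subbase, but any point of a ball is a
    center of it, and of two balls with the same center one contains the
    other. *)
Lemma nbhs_vtopP (a : K) (A : set K) : nbhs (a : vtop O) (A : set (vtop O)) <->
  exists2 s, s != 0 & forall x, O ((x - a) / s) -> A x.
Proof.
rewrite nbhsE; split.
  move=> [B [[D' sD' <-] [C D'C Ca]] BA].
  have [E sE CE] := sD' _ D'C.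
  have small (b : set K) : b \in E -> exists2 s, s != 0 & forall x, O ((x - a) / s) -> b x.
    move=> bE; have := sE b bE; rewrite inE => -[c _ [_ [s s0 <-]] bc].
    have : b a by have := Ca; rewrite -CE; apply.
    rewrite -bc => /(val_leE _ s0) h; exists s => // x hx.
    by apply/val_leE => //; exact: ball_trans hx h.
  have [s s0 sP] : exists2 s, s != 0 & forall b, b \in E -> forall x, O ((x - a) / s) -> b x.
    have : forall b, b \in enum_fset E -> exists2 s, s != 0 & forall x, O ((x - a) / s) -> b x.
      by move=> b bE; exact: small.
    have -> : (fun s => forall b, b \in E -> forall x, O ((x - a) / s) -> b x) =
        (fun s => forall b, b \in enum_fset E -> forall x, O ((x - a) / s) -> b x) by [].
    elim: (enum_fset E) => [|b l IH] lP.
      by exists 1; rewrite ?oner_neq0.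
    have [s1 s10 h1] := lP b (mem_head _ _).
    have [s2 s20 h2] := IH (fun b' b'l => lP b' (mem_behead (s := b :: l) b'l)).
    have [s s0 [le1 le2]] := smaller_ball s10 s20.
    exists s => // b'; rewrite inE => /predU1P[->|b'l] x hx.
      by apply: h1; exact: ball_larger hx.
    by apply: (h2 _ b'l); exact: ball_larger hx.
  exists s => // x hx; apply: BA; exists C => //; change (C x); rewrite -CE => b bE.
  exact: sP.
move=> [s s0 sA].
exists (val_ball O a (value O s)); last by move=> x /(val_leE _ s0); exact: sA.
split; last by apply/(val_leE _ s0); rewrite subrr mul0r; exact: valuation0.
exists [set val_ball O a (value O s)]; last by rewrite bigcup_set1.
move=> _ ->; apply: finI_from1; exists a => //; exists (value O s) => //.
by exists s.
Qed.

(** Applied to balls getting smaller as well as to balls getting larger. *)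
Lemma common_scale (R : K -> K -> Prop) n (Q : 'I_n -> K -> Prop) :
  (forall s s', s != 0 -> s' != 0 -> exists2 s'', s'' != 0 & R s s'' /\ R s' s'') ->
  (forall i s s', s != 0 -> s' != 0 -> R s s' -> Q i s -> Q i s') ->
  (forall i, exists2 s, s != 0 & Q i s) -> exists2 s, s != 0 & forall i, Q i s.
Proof.
move=> dir mono ex.
suff [s s0 sQ] : exists2 s, s != 0 & forall i, i \in enum 'I_n -> Q i s.
  by exists s => // i; apply: sQ; rewrite mem_enum.
elim: (enum 'I_n) => [|i l [s1 s10 h1]]; first by exists 1; rewrite ?oner_neq0.
have [s2 s20 h2] := ex i; have [s s0 [le1 le2]] := dir _ _ s10 s20.
exists s => // j; rewrite inE => /predU1P[->|jl]; first exact: mono h2.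
by apply: mono (h1 j jl).
Qed.

Definition close_rows n s (x y : 'rV[K]_n) : Prop := forall i, O ((x 0 i - y 0 i) / s).

Lemma val_closedP n (X : set 'rV[K]_n) : val_closed O X <->
  forall a : 'rV[K]_n,
    (forall s, s != 0 -> exists2 x, X x & close_rows s x a) -> X a.
Proof.
split=> [cX a lim|cl a cla].
  apply: cX => B [P Pa PB].
  have [s s0 sP] : exists2 s, s != 0 & forall i x, O ((x - a 0 i) / s) -> P 0 i x.
    apply: (@common_scale (fun s s' => O (s' / s))).
    - by move=> s s' s0 s'0; have [s'' ? ?] := smaller_ball s0 s'0; exists s''.
    - by move=> i s s' s0 s'0 le h x hx; apply: h; exact: ball_larger hx.
    - by move=> i; apply/nbhs_vtopP; exact: Pa.
  have [x Xx xa] := lim s s0; exists x; split=> //; apply: PB => i j.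
  by rewrite !ord1; apply: sP; exact: xa.
apply: cl => s s0.
have [|x [Xx xa]] := cla [set x | close_rows s x a]; last by exists x.
exists (fun _ j => [set x | O ((x - a 0 j) / s)]); last by move=> x hx i; exact: hx.
by move=> i j; rewrite !ord1; apply/nbhs_vtopP; exists s.
Qed.

Lemma val_boundedP n (X : set 'rV[K]_n) : val_bounded O X <->
  exists2 s, s != 0 & forall x : 'rV[K]_n, X x -> forall i, O (x 0 i / s).
Proof.
split=> [[_ [s s0 <-] h]|[s s0 h]].
  by exists s => // x Xx i; apply/(val_leE _ s0); exact: h.
exists (value O s); first by exists s.
by move=> x Xx i; apply/(val_leE _ s0); exact: h.
Qed.

Lemma row_bounded n (x : 'rV[K]_n) : exists2 s, s != 0 & forall i, O (x 0 i / s).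
Proof.
apply: (@common_scale (fun s s' => O (s / s'))).
- exact: larger_ball.
- by move=> i s s' s0 s'0 le h; exact: ball_larger h.
- move=> i; have [->|xi] := eqVneq (x 0 i) 0.
    by exists 1; rewrite ?oner_neq0 // mul0r; exact: valuation0.
  by exists (x 0 i) => //; rewrite divff //; exact: (valuation1 vO).
Qed.

Lemma val_closed_in_self n (X Y : set 'rV[K]_n) : val_closed O X ->
  val_closed_in O X Y -> val_closed O Y.
Proof.
move=> /val_closedP cX [Z /val_closedP cZ ->]; apply/val_closedP => a lim; split.
  by apply: cX => s /lim[x [Xx _] xa]; exists x.
by apply: cZ => s /lim[x [_ Zx] xa]; exists x.
Qed.

End ValuationTopology.

(** * Definably compact sets are closed and bounded *)

Section CompactClosedBounded.
Variables (K : fieldType) (O : set K) (fO : GRing.formula K).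
Hypotheses (vO : is_valuation_ring O) (rfO : GRing.rformula fO).
Hypothesis OE : forall x, O x <-> GRing.holds [:: x] fO.
Variables (n : nat) (X : set 'rV[K]_n).
Hypotheses (dX : definable X) (cX : definably_compact O X).

Let row_context m := block_context empty_context m.

Lemma udef_definable m (P : uprop K (row_context m)) : udef P ->
  definable [set x : 'rV[K]_m | P K id (tt, x)].
Proof.
move=> [f rf fE]; exists f => //; apply/seteqP; split=> x /=.
  by move=> /(fE K id (tt, x)); rewrite map_formula_id.
by move=> h; apply/(fE K id (tt, x)); rewrite map_formula_id.
Qed.

Lemma compact_family (Y : K -> set 'rV[K]_n)
    (P : uprop K (row_context (1 + n))) : udef P ->
  (forall z : 'rV[K]_(1 + n), lsubmx z 0 0 != 0 ->
    (P K id (tt, z) <-> Y (lsubmx z 0 0) (rsubmx z))) ->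
  (forall s, s != 0 -> Y s !=set0 /\ val_closed_in O X (Y s)) ->
  (forall s s', s != 0 -> s' != 0 -> exists2 s'', s'' != 0 & Y s'' `<=` Y s `&` Y s') ->
  exists x, forall s, s != 0 -> Y s x.
Proof.
move=> dP PE ne dir.
pose S : set 'rV[K]_1 := [set s | s 0 0 != 0].
have last m (i : 'I_m) := @uterm_coord K empty_context m i.
have dS : definable S.
  exact: (@udef_definable 1 (fun K h x => x.2 0 0 != 0) (udef_neq0 (last _ _))).
have coordS (z : 'rV[K]_(1 + n)) : (lsubmx z) 0 0 = z 0 (lshift n 0) by rewrite mxE.
have dY : definable [set z : 'rV[K]_(1 + n) | S (lsubmx z) /\ Y (lsubmx z 0 0) (rsubmx z)].
  have := udef_definable (udef_and (udef_neq0 (last _ (lshift n 0))) dP).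
  congr definable; apply/seteqP; split=> z /=.
    by rewrite -coordS => -[h1 h2]; split=> //; apply/PE.
  by move=> [h1 h2]; rewrite -coordS; split=> //; apply/PE.
have [|||x xP] := cX _ (conj dS dY : @definable_family K 1 n S (fun s => Y (s 0 0))).
- by exists (const_mx 1); rewrite /S /= mxE oner_neq0.
- by move=> s; exact: ne.
- move=> s s' Ss Ss'; have [s'' s0 sub] := dir _ _ Ss Ss'.
  by exists (const_mx s''); rewrite /S /= mxE.
exists x => s s0; have := xP (const_mx s); rewrite mxE; apply.
by rewrite /S /= mxE.
Qed.

Let integralP (C : context) (u : ufun K C) : uterm u ->
  udef (fun K' h x => GRing.holds [:: u K' h x] (map_formula h fO)).
Proof. by move=> tu; apply: udef_holds => //; exact: uenv1. Qed.

(** [x / s] is in [O], expressed in the language of rings. *)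
Let divO C (u v : ufun K C) : uterm u -> uterm v ->
  udef (fun K' h x => exists w, GRing.holds [:: w] (map_formula h fO) /\
    u K' h x = v K' h x * w).
Proof.
move=> tu tv; apply: udef_ex; apply: udef_and.
  by apply: integralP; exact: uterm_last.
apply: udef_eq; first exact: uterm_ext.
by apply: utermM; [exact: uterm_ext | exact: uterm_last].
Qed.

Let divOE (x s : K) : s != 0 ->
  (exists w, GRing.holds [:: w] (map_formula id fO) /\ x = s * w) <-> O (x / s).
Proof.
move=> s0; rewrite OE map_formula_id; split=> [[w [Ow ->]]|h].
  by rewrite mulrAC divff // mul1r.
by exists (x / s); split=> //; rewrite mulrCA mulfV ?mulr1.
Qed.

(** The family of the points of [X] outside the balls around 0. *)
Lemma definably_compact_bounded : val_bounded O X.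
Proof.
apply/(val_boundedP vO); apply: contrapT => nb.
have [fX rfX XE] := dX.
pose Y s : set 'rV[K]_n := [set x | X x /\ ~ forall i, O (x 0 i / s)].
have coord m (i : 'I_m) := @uterm_coord K empty_context m i.
have [||||x xY] := @compact_family Y (fun K' h z =>
  GRing.holds (point_env (rsubmx z.2)) (map_formula h fX) /\
   ~ forall i : 'I_n, exists w, GRing.holds [:: w] (map_formula h fO) /\
        z.2 0 (rshift 1 i) = z.2 0 (lshift n 0) * w).
- apply: udef_and.
    apply: udef_holds => //; apply: uenv_row => i.
    have [t [rt dt tE]] := coord _ (rshift 1 i).
    by exists t; split=> // K' h z; rewrite mxE.
  by apply: udef_not; apply: udef_all_ord => i; apply: divO; exact: coord.
- move=> z s0; rewrite /Y /= map_formula_id XE /=.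
  have e i : (exists w, GRing.holds [:: w] (map_formula id fO) /\
      z 0 (rshift 1 i) = z 0 (lshift n 0) * w) <-> O (rsubmx z 0 i / lsubmx z 0 0).
    by rewrite !mxE; apply: divOE; move: s0; rewrite mxE.
  by split=> -[h1 h2]; split=> // h; apply: h2 => i; apply/e.
- move=> s s0; split.
    apply: contrapT => Y0; apply: nb; exists s => // x Xx; apply: contrapT => nx.
    by apply: Y0; exists x.
  exists [set x | ~ forall i, O (x 0 i / s)]; last by [].
  apply/(val_closedP vO) => a lim /= ha.
  have [x nx xa] := lim s s0; apply: nx => i.
  rewrite -(subrK (a 0 i) (x 0 i)) mulrDl; exact: (valuationD vO) (xa i) (ha i).
- move=> s s' s0 s'0; have [s'' s''0 [le1 le2]] := larger_ball vO s0 s'0.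
  exists s'' => // x [Xx nx]; split; split=> // h; apply: nx => i.
    exact: (ball_larger vO s0 le1 (h i)).
  exact: (ball_larger vO s'0 le2 (h i)).
have [s s0 sx] := row_bounded vO x.
by have [_] := xY s s0.
Qed.

(** The family of the traces on [X] of the balls around a limit point [a]; a
    common point at a nonzero distance [d] from [a] is excluded by the ball of
    radius [d p], where [p] is not invertible in [O]. *)
Lemma definably_compact_closed : val_closed O X.
Proof.
apply/(val_closedP vO) => a lim; apply: contrapT => nXa.
have [fX rfX XE] := dX.
pose Y s : set 'rV[K]_n := [set x | X x /\ close_rows O s x a].
have coord m (i : 'I_m) := @uterm_coord K empty_context m i.
have [||||x xY] := @compact_family Y (fun K' h z =>
  GRing.holds (point_env (rsubmx z.2)) (map_formula h fX) /\
   forall i : 'I_n, exists w, GRing.holds [:: w] (map_formula h fO) /\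
        z.2 0 (rshift 1 i) - h (a 0 i) = z.2 0 (lshift n 0) * w).
- apply: udef_and.
    apply: udef_holds => //; apply: uenv_row => i.
    have [t [rt dt tE]] := coord _ (rshift 1 i).
    by exists t; split=> // K' h z; rewrite mxE.
  apply: udef_all_ord => i; apply: divO; last exact: coord.
  by apply: utermD; [exact: coord | apply: utermN; exact: uterm_const].
- move=> z s0; rewrite /Y /= map_formula_id XE /=.
  have e i : (exists w, GRing.holds [:: w] (map_formula id fO) /\
      z 0 (rshift 1 i) - a 0 i = z 0 (lshift n 0) * w) <->
      O ((rsubmx z 0 i - a 0 i) / lsubmx z 0 0).
    by rewrite !mxE; apply: divOE; move: s0; rewrite mxE.
  by split=> -[h1 h2]; split=> // i; apply/e; exact: h2.
- move=> s s0; split; first by have [x Xx xa] := lim s s0; exists x.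
  exists [set x | close_rows O s x a]; last by [].
  apply/(val_closedP vO) => b limb i /=.
  have [x xa xb] := limb s s0.
  exact: (ball_trans vO (ball_sym vO (xb i)) (xa i)).
- move=> s s' s0 s'0; have [s'' s''0 [le1 le2]] := smaller_ball vO s0 s'0.
  exists s'' => // x [Xx nx]; split; split=> // i.
    exact: (ball_larger vO s''0 le1 (nx i)).
  exact: (ball_larger vO s''0 le2 (nx i)).
have [Xx _] := xY 1 (oner_neq0 _).
apply: nXa; rewrite (_ : a = x) //; apply/rowP => i.
apply/eqP; rewrite eq_sym -subr_eq0; apply/negPn/negP => d0.
have [p [p0 Op nOp]] := valuation_nontrivial vO.
have [_ h] := xY ((x 0 i - a 0 i) * p) (mulf_neq0 d0 p0).
apply: nOp; rewrite (_ : p^-1 = (x 0 i - a 0 i) / ((x 0 i - a 0 i) * p)) //.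
by rewrite invfM mulrA divff // mul1r.
Qed.

End CompactClosedBounded.

(** * Formulas without constants *)

Section Constants.
Variable K : fieldType.

Lemma term_over_mono (A B : set K) u : A `<=` B -> term_over A u -> term_over B u.
Proof.
move=> AB; elim: u => //=.
- by move=> u1 IH1 u2 IH2 [/IH1 ? /IH2 ?].
- by move=> u1 IH1 u2 IH2 [/IH1 ? /IH2 ?].
Qed.

Lemma formula_over_mono (A B : set K) f : A `<=` B -> formula_over A f -> formula_over B f.
Proof.
move=> AB; have tm u := @term_over_mono A B u AB.
elim: f => //=.
- by move=> u1 u2 [/tm ? /tm ?].
- by move=> f1 IH1 f2 IH2 [/IH1 ? /IH2 ?].
- by move=> f1 IH1 f2 IH2 [/IH1 ? /IH2 ?].
- by move=> f1 IH1 f2 IH2 [/IH1 ? /IH2 ?].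
Qed.

Lemma common_constants (P Q : set K -> Prop) :
  (forall A B, A `<=` B -> P A -> P B) -> (forall A B, A `<=` B -> Q A -> Q B) ->
  (exists cs : seq K, P [set x | x \in cs]) -> (exists cs : seq K, Q [set x | x \in cs]) ->
  exists cs : seq K, P [set x | x \in cs] /\ Q [set x | x \in cs].
Proof.
move=> mP mQ [c1 h1] [c2 h2]; exists (c1 ++ c2).
by split; [apply: mP h1 | apply: mQ h2] => x /= xc; rewrite mem_cat xc ?orbT.
Qed.

Lemma term_constants (u : GRing.term K) : exists cs : seq K, term_over [set x | x \in cs] u.
Proof.
have m v A B := @term_over_mono A B v.
elim: u => //=; try by exists [::].
- by move=> x; exists [:: x]; rewrite mem_head.
- by move=> u1 IH1 u2 IH2; exact: (common_constants (m u1) (m u2) IH1 IH2).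
- by move=> u1 IH1 u2 IH2; exact: (common_constants (m u1) (m u2) IH1 IH2).
Qed.

Lemma formula_constants (f : GRing.formula K) :
  exists cs : seq K, formula_over [set x | x \in cs] f.
Proof.
have m v A B := @term_over_mono A B v; have mf g A B := @formula_over_mono A B g.
elim: f => //=; try by [exists [::] | exact: term_constants].
- move=> u1 u2.
  exact: (common_constants (m u1) (m u2) (term_constants u1) (term_constants u2)).
- by move=> f1 IH1 f2 IH2; exact: (common_constants (mf f1) (mf f2) IH1 IH2).
- by move=> f1 IH1 f2 IH2; exact: (common_constants (mf f1) (mf f2) IH1 IH2).
- by move=> f1 IH1 f2 IH2; exact: (common_constants (mf f1) (mf f2) IH1 IH2).
Qed.

(** The constants of a formula become the values [p] of new variables, placed
    before the others. What is left has no constants, so it makes sense over any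
    field. *)
Lemma separate_parameters (L : fieldType) (h : L -> K) (f : GRing.formula K) n :
  GRing.rformula f -> exists (B : nat) (p : 'rV[K]_B), exists2 g : GRing.formula L,
    GRing.rformula g & forall e : seq K, size e = n ->
      GRing.holds e f <-> GRing.holds (point_env p ++ e) (map_formula h g).
Proof.
move=> rf; have [cs fcs] := formula_constants f.
exists (size cs), (\row_i cs`_i).
pose s i := if (i < n)%N then GRing.Var L (size cs + i) else GRing.NatConst L 0.
pose k (c : K) := if c \in cs then GRing.Var L (index c cs) else GRing.NatConst L 0.
exists (formula_sub s k (size cs + n) f).
  by apply: rformula_sub => // x; rewrite /s /k; case: ifP.
move=> e en; rewrite point_envP // -{1}[f]map_formula_id.
apply: (@holds_formula_sub K K L id h e (cs ++ e) s k _ [set x | x \in cs]) => //.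
- move=> i; rewrite /s; case: ifP => // i_n e1 e2 ee /=; apply: ee; lia.
- move=> c; rewrite /k; case: ifP => // cc e1 e2 ee /=; apply: ee.
  by rewrite ltn_addr // index_mem.
- move=> i; rewrite /s; case: ltnP => i_n /=; last by rewrite nth_default ?en.
  by rewrite nth_cat ltnNge leq_addr /= addKn.
- by move=> c /= cc; rewrite /k cc /= nth_cat index_mem cc nth_index.
Qed.

End Constants.

(** * Compactness as a first-order sentence *)

Section CompactnessSentence.
Variable F : fieldType.
Local Notation L := (laurent F).
Variables (B m n : nat) (f : GRing.formula L).
Hypothesis rf : GRing.rformula f.

Definition urow C k (v : forall K : fieldType, (L -> K) -> carrier C K -> 'rV[K]_k) :=
  forall i, uterm (fun K h z => v K h z 0 i).

Lemma urow_last C k : @urow (block_context C k) k (fun K h z => z.2).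
Proof. by move=> i; exact: uterm_coord. Qed.

Lemma urow_block C k l v : @urow C k v -> @urow (block_context C l) k (fun K h z => v K h z.1).
Proof. by move=> hv i; exact: (uterm_block l (hv i)). Qed.

Lemma urow_ext C k v : @urow C k v -> @urow (ext_context C) k (fun K h z => v K h z.1).
Proof. by move=> hv i; exact: (uterm_ext (hv i)). Qed.

Section Field.
Variables (K : fieldType) (h : L -> K).
Implicit Types (p : 'rV[K]_B) (s : 'rV[K]_m) (x a : 'rV[K]_n).

Definition member p s x : Prop :=
  GRing.holds (point_env p ++ (point_env s ++ point_env x)) (map_formula h f).

Definition divides_integral (u v : K) : Prop := exists w, is_integral h w /\ u = v * w.

Definition family_bounded p (r : K) : Prop :=
  forall s x, member p s x -> forall i, divides_integral (x 0 i) r.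

Definition family_directed p : Prop :=
  forall s s', (exists y, member p s y) -> (exists y, member p s' y) ->
  exists s'', (exists y, member p s'' y) /\
    forall x, member p s'' x -> member p s x /\ member p s' x.

Definition family_closed p : Prop :=
  forall s a, (exists y, member p s y) ->
  (forall e : K, e != 0 -> exists x, member p s x /\
    forall i, divides_integral (x 0 i - a 0 i) e) -> member p s a.

(** The index set is not a separate formula: it consists of the [s] with a
    nonempty fiber. *)
Definition family_compact : Prop := forall p (r : K), r != 0 ->
  (exists s, exists x, member p s x) -> family_bounded p r -> family_directed p ->
  family_closed p -> exists x, forall s, (exists y, member p s y) -> member p s x.

End Field.

Section Definability.
Variable C : context.
Variables (p : forall K : fieldType, (L -> K) -> carrier C K -> 'rV[K]_B)
  (s : forall K : fieldType, (L -> K) -> carrier C K -> 'rV[K]_m)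
  (x : forall K : fieldType, (L -> K) -> carrier C K -> 'rV[K]_n).
Hypotheses (hp : urow p) (hs : urow s) (hx : urow x).

Lemma udef_member : udef (fun K h z => member h (@p K h z) (@s K h z) (@x K h z)).
Proof.
by apply: udef_holds => //; apply: uenv_cat; [|apply: uenv_cat]; exact: uenv_row.
Qed.

Lemma udef_divides (u v : ufun L C) : uterm u -> uterm v ->
  udef (fun K h z => divides_integral h (u K h z) (v K h z)).
Proof.
move=> tu tv; apply: udef_ex; apply: udef_and.
  by apply: udef_integral; exact: uterm_last.
apply: udef_eq; first exact: (uterm_ext tu).
by apply: utermM; [exact: (uterm_ext tv) | exact: uterm_last].
Qed.

End Definability.

Lemma udef_nonempty C p s : @urow C B p -> @urow C m s ->
  udef (fun K h z => exists y, member h (p K h z) (s K h z) y).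
Proof.
move=> hp hs; apply: udef_ex_block.
exact: (udef_member (urow_block n hp) (urow_block n hs) (@urow_last C n)).
Qed.

Lemma udef_family_compact : udef (fun K h (_ : carrier empty_context K) => family_compact h).
Proof.
apply: udef_all_block; apply: udef_all.
set C := ext_context _.
have hp : @urow C B (fun K h z => z.1.2) := urow_ext (@urow_last empty_context B).
have hr : @uterm L C (fun K h z => z.2) := @uterm_last L _.
apply: udef_imp; first exact: udef_neq0.
apply: udef_imp.
  apply: udef_ex_block; exact: (udef_nonempty (urow_block m hp) (@urow_last C m)).
apply: udef_imp.
  apply: udef_all_block; apply: udef_all_block; apply: udef_imp.
    exact: (udef_member (urow_block n (urow_block m hp)) (urow_block n (@urow_last C m))
      (@urow_last _ n)).
  apply: udef_all_ord => i; apply: udef_divides; first exact: uterm_coord.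
  exact: (uterm_block n (uterm_block m hr)).
apply: udef_imp.
  apply: udef_all_block; apply: udef_all_block.
  set C2 := block_context (block_context C m) m.
  have hp2 : @urow C2 B _ := urow_block m (urow_block m hp).
  have hs2 : @urow C2 m _ := urow_block m (@urow_last C m).
  have hs2' : @urow C2 m _ := @urow_last _ m.
  apply: udef_imp; first exact: (udef_nonempty hp2 hs2).
  apply: udef_imp; first exact: (udef_nonempty hp2 hs2').
  apply: udef_ex_block; apply: udef_and.
    exact: (udef_nonempty (urow_block m hp2) (@urow_last _ m)).
  have hp3 := urow_block n (urow_block m hp2).
  apply: udef_all_block; apply: udef_imp; last apply: udef_and.
  - exact: (udef_member hp3 (urow_block n (@urow_last C2 m)) (@urow_last _ n)).
  - exact: (udef_member hp3 (urow_block n (urow_block m hs2)) (@urow_last _ n)).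
  - exact: (udef_member hp3 (urow_block n (urow_block m hs2')) (@urow_last _ n)).
apply: udef_imp.
  apply: udef_all_block; apply: udef_all_block.
  set C2 := block_context (block_context C m) n.
  have hp2 : @urow C2 B _ := urow_block n (urow_block m hp).
  have hs2 : @urow C2 m _ := urow_block n (@urow_last C m).
  have ha2 : @urow C2 n _ := @urow_last _ n.
  apply: udef_imp; first exact: (udef_nonempty hp2 hs2).
  apply: udef_imp; last exact: (udef_member hp2 hs2 ha2).
  apply: udef_all; apply: udef_imp; first by apply: udef_neq0; exact: uterm_last.
  apply: udef_ex_block; apply: udef_and.
    exact: (udef_member (urow_block n (urow_ext hp2)) (urow_block n (urow_ext hs2))
      (@urow_last _ n)).
  apply: udef_all_ord => i; apply: udef_divides.
    apply: utermD; first exact: uterm_coord.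
    by apply: utermN; exact: (urow_block n (urow_ext ha2) i).
  exact: (uterm_block n (@uterm_last L _)).
apply: udef_ex_block; apply: udef_all_block; apply: udef_imp.
  exact: (udef_nonempty (urow_block m (urow_block n hp)) (@urow_last _ m)).
exact: (udef_member (urow_block m (urow_block n hp)) (@urow_last _ m)
  (urow_block m (@urow_last C n))).
Qed.

Hypotheses (char0 : [pchar F] =i pred0) (closedF : GRing.closed_field_axiom F).

Lemma laurent_family_compact : @family_compact L id.
Proof.
move=> p r r0 [s0 [x0 sx0]] bd dir cl.
have div_ord (u v : L) : v != 0 -> divides_integral id u v <-> ord_ge u (lorder v).
  move=> v0; split=> [[w [/(is_integral_id char0) Ow ->]]|uv].
    rewrite -[lorder v]addr0; apply: ord_geM; last exact: Ow.
    by have [] := lorderP v0.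
  exists (u / v); split; last by rewrite mulrC divfK.
  apply/(is_integral_id char0)/ord_geP; have [->|u0] := eqVneq u 0; first by left; rewrite mul0r.
  right; have w0 : u / v != 0 by rewrite mulf_neq0 // invr_neq0.
  have := lorderM w0 v0; rewrite divfK // => e.
  by case/ord_geP: uv => [uz|]; [case/eqP: u0 | lia].
pose P0 : set 'rV[L]_m := [set s | exists y, member id p s y].
pose E (s : 'rV[L]_m) := point_env p ++ point_env s.
have EN s : size (E s) = (B + m)%N by rewrite size_cat !size_point_env.
have fibP s (x : 'rV[L]_n) : fiber n E f s (point_env x) <-> member id p s x.
  rewrite /fiber /member size_point_env map_formula_id /E -catA.
  by split=> [[]|].
have fibE s ys : fiber n E f s ys -> ys = point_env (\row_(i < n) ys`_i).
  by move=> [sy _]; rewrite point_envP.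
have inh : P0 !=set0 by exists s0, x0.
have dirP s s' : P0 s -> P0 s' -> exists2 s'', P0 s'' &
    forall ys, fiber n E f s'' ys -> fiber n E f s ys /\ fiber n E f s' ys.
  move=> Ps Ps'; have [s'' [Ps'' sub]] := dir s s' Ps Ps'; exists s'' => // ys hy.
  move: (hy); rewrite (fibE _ _ hy) => /fibP/sub[h1 h2].
  by split; apply/fibP.
have [|||xs xsP] := @laurent_compact F char0 closedF _ P0 (B + m) n E f rf EN inh dirP (lorder r).
- by move=> s [y hy]; exists (point_env y); apply/fibP.
- move=> s ys Ps hy i i_n; move: (hy); rewrite (fibE _ _ hy) => /fibP h1.
  by have /(div_ord _ _ r0) := bd s _ h1 (Ordinal i_n); rewrite mxE (nth_point_env _ (Ordinal i_n)) mxE.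
- move=> s xs Ps sxs lim; rewrite -(point_envP sxs); apply/fibP.
  apply: cl => // e e0; have [ys hy yx] := lim (lorder e).
  exists (\row_i ys`_i); split.
    by apply/fibP; rewrite -(fibE _ _ hy).
  by move=> i; apply/(div_ord _ _ e0); rewrite !mxE; exact: yx.
have sx : size xs = n by have [] := xsP s0 (ex_intro _ x0 sx0).
exists (\row_i xs`_i) => s Ps; apply/fibP; rewrite point_envP //.
exact: xsP.
Qed.

End CompactnessSentence.

(** Both models of the theorem are elementary extensions of the field of Laurent
    series. *)
Theorem definably_compactP (F : fieldType) (char0 : [pchar F] =i pred0)
    (closedF : GRing.closed_field_axiom F) (K : fieldType) (iota : laurent F -> K) :
  elementary_on iota setT -> forall (n : nat) (X : set 'rV[K]_n), definable X ->
  definably_compact (valuation_ring iota) X <->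
  val_closed (valuation_ring iota) X /\ val_bounded (valuation_ring iota) X.
Proof.
move=> el n X dX; rewrite (valuation_ringE char0 el).
have vO := valuation_ring_elementary char0 el.
split=> [cX|[clX bdX] m S Y [s0 Ss0] [_ [f rf YE]] Yne dir].
  pose fO := map_formula iota (power_series_formula F).
  have rfO : GRing.rformula fO by [].
  have OE x : is_integral iota x <-> GRing.holds [:: x] fO by [].
  split; first exact: (definably_compact_closed vO rfO OE dX cX).
  exact: (definably_compact_bounded vO rfO OE dX cX).
have [B [p [g rg gE]]] := separate_parameters iota (m + n) rf.
have [r r0 bd] := (val_boundedP vO X).1 bdX.
have memE s x : member g iota p s x <-> S s /\ Y s x.
  rewrite /member -point_env_row -gE ?size_point_env //.
  have := congr1 (fun Z : set 'rV[K]_(m + n) => Z (row_mx s x)) YE.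
  by rewrite /= row_mxKl row_mxKr => ->.
have div (u v : K) : v != 0 -> divides_integral iota u v <-> is_integral iota (u / v).
  move=> v0; split=> [[w [Ow ->]]|h]; first by rewrite mulrAC divff // mul1r.
  by exists (u / v); split=> //; rewrite mulrCA mulfV ?mulr1.
have P0E s : (exists y : 'rV[K]_n, member g iota p s y) <-> S s.
  split=> [[y hy]|Ss]; first by have [] := (memE s y).1 hy.
  have [[y Yy] _] := Yne s Ss.
  by exists y; apply/memE.
have comp := (udef_transfer (udef_family_compact B m n rg) el).1
  (laurent_family_compact (B := B) (m := m) (n := n) rg char0 closedF).
have [||||x xP] := comp p r r0 _.
- by exists s0; apply/P0E.
- move=> s x /memE[Ss Yx] i; apply/(div _ _ r0); apply: bd.
  by have [_ [Z _ YZ]] := Yne s Ss; move: Yx; rewrite YZ => -[].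
- move=> s s' /P0E Ss /P0E Ss'; have [s'' Ss'' sub] := dir s s' Ss Ss'.
  exists s''; split; first exact/P0E.
  by move=> x /memE[_ /sub[h1 h2]]; split; apply/memE.
- move=> s a /P0E Ss lim; apply/memE; split=> //.
  have [_ Ycl] := Yne s Ss.
  apply: ((val_closedP vO (Y s)).1 (val_closed_in_self vO clX Ycl)) => e e0.
  have [x [/memE[_ Yx] xa]] := lim e e0; exists x => // i.
  exact/(div _ _ e0).
by exists x => s Ss; have /memE[] := xP s ((P0E s).2 Ss).
Qed.

Theorem theorem2p3 (R : realType) (K : fieldType) (iota : laurent R[i] -> K)
    (hK : base_or_monster iota) (n : nat) (hn : (1 <= n)%N)
    (X : set 'rV[K]_n) (hX : definable X) :
  definably_compact (valuation_ring iota) X <->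
  val_closed (valuation_ring iota) X /\ val_bounded (valuation_ring iota) X.
Proof.
apply: definably_compactP => //.
- exact: pchar_num.
- exact: solve_monicpoly.
- by case: hK => [f _ _|M h []]; rewrite ?map_formula_id.
Qed.
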